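(* There is an absolute constant $C$ such that the following holds. Let $f:\mathbb{R}^p\to\mathbb{R}$, its maximizer $x^*$, and a symmetric positive semidefinite matrix $G^2\le -\nabla^2 f(x^* )$ be such that $u\mapsto \ell(x^*+u)=f(x^*+u)+\frac12\|Gu\|^2$ is concave on $\mathbb{R}^p$. With the notation of the context (for fixed $\nu\in(0,1)$, $\mathtt{x}>0$), suppose that $-\ell(\cdot)=n\,h(\cdot)$ for some $n>0$ and a strongly convex function $h$ satisfying $$\sup_{u\in\mathcal{U}}\sup_{t\in[0,1]}\frac{|\langle\nabla^3h(x^*+tu),u^{\otimes3}\rangle|}{\langle\nabla^2h(x^* ),u^{\otimes2}\rangle^{3/2}}\le \mathsf{c}_3,$$ and that $\mathsf{c}_3\,\mathtt{r}_G\,n^{-1/2}\le 3/4$. Let $Q:\mathbb{R}^p\to\mathbb{R}^q$ be a linear mapping, $q\ge1$, with $Q^\top Q\le\mathsf{D}^2$. Then the mean $\bar{x}$ of $P_f$ satisfies $$\|Q(\bar{x}-x^* )\|\le 2.4\,\mathsf{c}_3\,\|Q\mathsf{D}_G^{-2}Q^\top\|^{1/2}\,\frac{(\mathtt{p}_G+1)^{3/2}}{n^{1/2}}+C e^{-\mathtt{x}}.$$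
   Context: Setting: $f:\mathbb{R}^p\to\mathbb{R}$ is three times continuously differentiable, $\int e^{f(x)}dx<\infty$, $x^*$ is a point of global maximum of $f$, and $-\nabla^2 f(x^* )$ is strictly positive definite. $P_f$ is the probability measure with density proportional to $e^{f(x)}$ and $\bar{x}=\int x\,e^{f(x)}dx\big/\int e^{f(x)}dx$. Notation: $\mathsf{D}_G^2=-\nabla^2 f(x^* )$, $\mathsf{D}^2=-\nabla^2 f(x^* )-G^2=-\nabla^2\ell(x^* )$; $\mathsf{D},\mathsf{D}_G,G$ are symmetric positive semidefinite square roots. $\mathtt{p}_G=\operatorname{tr}(\mathsf{D}^2\mathsf{D}_G^{-2})$. For fixed $\nu\in(0,1)$ (e.g. $\nu=2/3$) and $\mathtt{x}>0$: $\mathtt{r}_G=2\sqrt{\mathtt{p}_G}+\sqrt{2\mathtt{x}}$ and $\mathcal{U}=\{u\in\mathbb{R}^p:\|\mathsf{D}u\|\le\nu^{-1}\mathtt{r}_G\}$. In the supremum $u\neq0$. $\|\cdot\|$ is the Euclidean norm for vectors and the operator norm for matrices. *)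

(* Defs.v *)
From HB Require Import structures.
From mathcomp Require Import all_boot all_order all_algebra.
From mathcomp Require Import all_classical all_reals all_analysis.

Set Implicit Arguments.
Unset Strict Implicit.
Unset Printing Implicit Defensive.

Import Order.TTheory GRing.Theory Num.Theory.
Import numFieldNormedType.Exports.

Local Open Scope classical_set_scope.
Local Open Scope ring_scope.

(** The norm [`|u|] that the library puts on matrices is the max norm: it is used
    below only through its topology (continuity, differentiability). *)

Definition enorm (R : realType) (p : nat) (u : 'cV[R]_p) : R :=
  Num.sqrt (\sum_(i < p) u i 0 ^+ 2).

Definition opnorm (R : realType) (q p : nat) (A : 'M[R]_(q, p)) : R :=
  sup [set enorm (A *m u) | u in [set u : 'cV[R]_p | enorm u <= 1]].

Definition quad_form (R : realType) (p : nat) (A : 'M[R]_p) (u : 'cV[R]_p) : R :=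
  (u^T *m A *m u) 0 0.

Definition psd (R : realType) (p : nat) (A : 'M[R]_p) : Prop :=
  A^T = A /\ forall u : 'cV[R]_p, 0 <= quad_form A u.

Definition posdef (R : realType) (p : nat) (A : 'M[R]_p) : Prop :=
  A^T = A /\ forall u : 'cV[R]_p, u != 0 -> 0 < quad_form A u.

Definition loewner_le (R : realType) (p : nat) (A B : 'M[R]_p) : Prop :=
  psd (B - A).

Definition psd_sqrt (R : realType) (p : nat) (S A : 'M[R]_p) : Prop :=
  psd S /\ S *m S = A.

Definition partial (R : realType) (p : nat) (i : 'I_p) (f : 'cV[R]_p -> R) :
  'cV[R]_p -> R := fun x => 'D_(delta_mx i 0) f x.

(* k times continuously differentiable, by recursion on the partial derivatives *)
Fixpoint Ck (R : realType) (p : nat) (k : nat) (f : 'cV[R]_p -> R) : Prop :=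
  if k is k'.+1 then
    (forall x, differentiable f x) /\ (forall i, Ck k' (partial i f))
  else continuous f.

Definition hessian (R : realType) (p : nat) (f : 'cV[R]_p -> R) (x : 'cV[R]_p) :
  'M[R]_p := \matrix_(i, j) partial i (partial j f) x.

(* <nabla^3 f(x), u (x) u (x) u> *)
Definition third_form (R : realType) (p : nat) (f : 'cV[R]_p -> R)
    (x u : 'cV[R]_p) : R :=
  \sum_(i < p) \sum_(j < p) \sum_(k < p)
    partial i (partial j (partial k f)) x * u i 0 * u j 0 * u k 0.

Definition concave (R : realType) (p : nat) (g : 'cV[R]_p -> R) : Prop :=
  convex_function setT (fun x => - g x).

Definition strongly_convex (R : realType) (p : nat) (h : 'cV[R]_p -> R) : Prop :=
  exists2 m : R, 0 < m &
    convex_function setT (fun x => h x - m / 2 * enorm x ^+ 2).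

(** Lebesgue measure on R^p, carried by [p.-tuple R] (which the library equips
    with the product sigma-algebra): the Dirac mass for p = 0, and the image of
    the product of the one-dimensional Lebesgue measure and the p-dimensional one
    under (x, t) |-> x :: t for p + 1. *)

Section lebesgue_tuple.
Variable R : realType.

Definition cons_pair (n : nat) (z : R * n.-tuple R) : n.+1.-tuple R :=
  [tuple of z.1 :: z.2].

Let measurable_cons_pair (n : nat) :
  measurable_fun [set: measurableTypeR R * n.-tuple R] (@cons_pair n).
Proof.
exact: (@measurable_cons _ _ _ R fst n snd measurable_fst measurable_snd).
Qed.

Section step.
Variables (n : nat) (m : {sigma_finite_measure set (n.-tuple R) -> \bar R}).

Definition lebesgue_step : set (n.+1.-tuple R) -> \bar R :=
  pushforward (@lebesgue_measure R \x m)%E (@cons_pair n).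

Let pushed := measure_function_pushforward__canonical__measure_function_Measure
  (@lebesgue_measure R \x m)%E (@measurable_cons_pair n).

HB.instance Definition _ := isMeasure.Build _ _ _ lebesgue_step
  (measure0 pushed) (fun A => measure_ge0 pushed A)
  (@measure_semi_sigma_additive _ _ _ pushed).

Let lebesgue_step_sigma_finite : sigma_finite setT lebesgue_step.
Proof.
have /sigma_finiteP[F [TF ndF Foo]] := sigma_finiteT (@lebesgue_measure R).
have /sigma_finiteP[G [TG ndG Goo]] := sigma_finiteT m.
pose hd (t : n.+1.-tuple R) : measurableTypeR R := thead t.
pose tl (t : n.+1.-tuple R) := [tuple of behead t].
exists (fun k => hd @^-1` F k `&` tl @^-1` G k).
  rewrite predeqE => t; split=> // _.
  have [i _ Fi] : (\bigcup_i F i) (hd t) by rewrite -TF.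
  have [j _ Gj] : (\bigcup_i G i) (tl t) by rewrite -TG.
  exists (maxn i j) => //; split => /=.
    by move: (hd t) Fi; exact/subsetPset/ndF/leq_maxl.
  by move: (tl t) Gj; exact/subsetPset/ndG/leq_maxr.
move=> k; have [mF Flt] := Foo k; have [mG Glt] := Goo k; split.
  apply: measurableI.
    by rewrite -[X in measurable X]setTI; exact: measurable_tnth.
  by rewrite -[X in measurable X]setTI; exact: measurable_behead.
rewrite /lebesgue_step /pushforward.
rewrite (_ : _ @^-1` _ = F k `*` G k); last first.
  apply/seteqP; split=> -[x t] [/= Fx Gt]; split=> //=.
    by rewrite (_ : t = tl (cons_pair (x, t)))//; exact: val_inj.
  by rewrite (_ : tl _ = t)//; exact: val_inj.
by rewrite product_measure1E// lte_mul_pinfty// ge0_fin_numE.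
Qed.

HB.instance Definition _ := Measure_isSigmaFinite.Build _ _ _ lebesgue_step
  lebesgue_step_sigma_finite.

End step.

Fixpoint lebesgue_tuple (n : nat) :
    {sigma_finite_measure set (n.-tuple R) -> \bar R} :=
  match n with
  | 0 => [the {sigma_finite_measure set (0.-tuple R) -> \bar R} of
           dirac [tuple]]
  | n'.+1 => [the {sigma_finite_measure set (n'.+1.-tuple R) -> \bar R} of
               lebesgue_step (lebesgue_tuple n')]
  end.

End lebesgue_tuple.

Definition col_of_tuple (R : realType) (p : nat) (t : p.-tuple R) : 'cV[R]_p :=
  \col_i tnth t i.

(** Total mass of exp f and mean of the probability measure with density
    proportional to exp f, computed coordinatewise. *)

Definition gibbs_mass (R : realType) (p : nat) (f : 'cV[R]_p -> R) : \bar R :=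
  (\int[lebesgue_tuple R p]_t (expR (f (col_of_tuple t)))%:E)%E.

Definition gibbs_mean (R : realType) (p : nat) (f : 'cV[R]_p -> R) : 'cV[R]_p :=
  \col_i ((\int[lebesgue_tuple R p]_t
             (col_of_tuple t i 0 * expR (f (col_of_tuple t)))) /
          fine (gibbs_mass f)).

(* Main.v *)
Require Import Defs.
From mathcomp Require Import all_boot all_order all_algebra.
From mathcomp Require Import all_classical all_reals all_analysis.
From mathcomp Require Import measurable_realfun.
From mathcomp Require Import ring lra.
From mathcomp.real_closed Require complex.

Set Implicit Arguments.
Unset Strict Implicit.
Unset Printing Implicit Defensive.

Import Order.TTheory GRing.Theory Num.Theory.
Import numFieldNormedType.Exports.

Local Open Scope classical_set_scope.
Local Open Scope ring_scope.

(** Write [E] for the expectation under the Gaussian [N(xs, DG2^-1)], [Z] for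
    [|D (y - xs)|], [w] for [c3 / sqrt n] and [dl] for the logarithm of the density of
    [P_f] relative to [E], up to a constant.  Taylor's formula along rays gives
    [|dl| <= w Z^3 / 6] when [Z <= rG]; beyond, the concavity of [l] bounds [dl] by its
    tangent at radius [rG] and by [Z^2 / 2].  By duality it is enough to bound the
    [P_f]-mean of a linear form [L] with [E L^2 <= 1].

    On [Z <= rG] the mean of [L] under the truncated tilt is at most
    [sqrt (2 KL)], where [KL], the relative entropy of the tilt with respect to [E], is of
    the order of the second moment of [dl], hence of [w^2 (pG + 1)^3].  On [Z > rG] the
    Laplace transform of [Z^2], computed from the Gaussian integral and the spectral
    theorem, is used in Chernoff bounds: the region is cut into shells, and the
    quadratic gain [- (Z - rG)^2 / 2] left by the tangent bound makes their
    contributions summable. *)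

(** * Weighted expectations *)

(** The difficulty is uniformity: [C] depends on no parameter, and the coefficient [12 / 5] leaves
    little room. It is spent as [21 / 20 * (25 / 12) + 17 / 80]: ratio of the mass of the truncated
    tilt to its part [core] on [Z <= rG], entropy bound, share of the tail. [core] may be as small
    as a multiple of [expR (- pG / 6)], so tail bounds have to win a factor exponential in [pG];
    they do because [rG ^+ 2 >= 4 * pG], which leaves [expR (- 4 / 5 * pG)] in every shell. If [rG]
    is below a numerical threshold, [pG] and [x] are bounded and everything is charged to
    [expR (- x)]. Above it, a single Chernoff bound replaces the shells when [pG <= 1 / 4].
    Otherwise, if [w * rG ^+ 3 <= 6], the Taylor remainder at radius [rG] is bounded and the tail
    keeps its full [expR (- x)]; if [w * rG ^+ 3 > 6], this factor may be lost, but [w] exceeds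
    [6 / rG ^+ 3] and the tail, exponentially small in [rG ^+ 2], is charged to the main term. *)

Section weighted_expectation.
Context d (T : measurableType d) (R : realType).
Variables (m : {measure set T -> \bar R}) (g : T -> R).

Definition wint (F : T -> R) := m.-integrable setT (EFin \o (fun t => F t * g t)).

Definition wE (F : T -> R) : R := \int[m]_t (F t * g t).

Hypotheses (mg : measurable_fun setT g) (g0 : forall t, 0 <= g t).

Lemma eq_wE (F H : T -> R) : F =1 H -> wE F = wE H.
Proof. by move=> FH; apply: eq_Rintegral => t _; rewrite FH. Qed.

Lemma eq_wint (F H : T -> R) : F =1 H -> wint F -> wint H.
Proof. by move=> FH; apply: eq_integrable => // t _ /=; rewrite FH. Qed.

Lemma wint_le (F H : T -> R) : measurable_fun setT F ->
  (forall t, `|F t| <= H t) -> wint H -> wint F.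
Proof.
move=> mF FH iH; apply: le_integrable iH => //.
  by apply/measurable_EFinP; apply: measurable_funM.
move=> t _ /=; rewrite lee_fin !normrM ler_wpM2r//.
by rewrite (le_trans (FH t))// ler_norm.
Qed.

Lemma wintD (F H : T -> R) : wint F -> wint H -> wint (fun t => F t + H t).
Proof.
move=> iF iH; have := integrableD measurableT iF iH.
by apply: eq_integrable => // t _ /=; rewrite -EFinD mulrDl.
Qed.

Lemma wintZ (k : R) (F : T -> R) : wint F -> wint (fun t => k * F t).
Proof.
move=> iF; have := integrableZl measurableT k iF.
by apply: eq_integrable => // t _ /=; rewrite -EFinM mulrA.
Qed.

Lemma wED (F H : T -> R) : wint F -> wint H ->
  wE (fun t => F t + H t) = wE F + wE H.
Proof.
move=> iF iH; rewrite /wE -RintegralD//.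
by apply: eq_Rintegral => t _; rewrite mulrDl.
Qed.

Lemma wEZ (k : R) (F : T -> R) : wint F -> wE (fun t => k * F t) = k * wE F.
Proof.
move=> iF; rewrite /wE -RintegralZl//.
by apply: eq_Rintegral => t _; rewrite mulrA.
Qed.

Lemma le_wE (F H : T -> R) : wint F -> wint H -> (forall t, F t <= H t) ->
  wE F <= wE H.
Proof.
by move=> iF iH FH; apply: le_Rintegral => // t _; apply: ler_wpM2r.
Qed.

Lemma wE_ge0 (F : T -> R) : (forall t, 0 <= F t) -> 0 <= wE F.
Proof. by move=> F0; apply: Rintegral_ge0 => t _; apply: mulr_ge0. Qed.

Lemma normr_wE (F : T -> R) : wint F -> `|wE F| <= wE (fun t => `|F t|).
Proof.
move=> iF; apply: (le_trans (le_normr_Rintegral _ iF)) => //.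
by rewrite le_eqVlt; apply/orP; left; apply/eqP; apply: eq_Rintegral => t _;
  rewrite normrM (ger0_norm (g0 t)).
Qed.

Lemma wint_normr (F : T -> R) : wint F -> wint (fun t => `|F t|).
Proof.
move=> iF; have := integrable_norm iF.
by apply: eq_integrable => // t _ /=; rewrite normrM (ger0_norm (g0 t)).
Qed.

Lemma wint_sum (I : Type) (s : seq I) (F : I -> T -> R) :
  (forall i, wint (F i)) -> wint (fun t => \sum_(i <- s) F i t).
Proof.
move=> iF; elim: s => [|i s IH].
  apply: (@eq_wint (fun t => 0 * 0)) => [t|]; first by rewrite big_nil mul0r.
  have := integrable0 m setT.
  by apply: eq_integrable => // t _ /=; rewrite !mul0r.
by apply: eq_wint (wintD (iF i) IH) => t; rewrite big_cons.
Qed.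

Lemma wE_sum (I : Type) (s : seq I) (F : I -> T -> R) :
  (forall i, wint (F i)) ->
  wE (fun t => \sum_(i <- s) F i t) = \sum_(i <- s) wE (F i).
Proof.
move=> iF; elim: s => [|i s IH].
  rewrite big_nil /wE (@eq_Rintegral _ _ _ m setT (fun=> 0)).
    by rewrite Rintegral_cst// mul0r.
  by move=> t _; rewrite big_nil mul0r.
rewrite big_cons -IH -wED//; last exact: wint_sum.
by apply: eq_wE => t; rewrite big_cons.
Qed.

(* Peeling bound: the F_k need not be disjointly supported. *)
Lemma wE_le_geometric (F : T -> R) (Fk : nat -> T -> R) (c q : R) :
  measurable_fun setT F -> (forall t, 0 <= F t) -> (forall k t, 0 <= Fk k t) ->
  (forall t, exists k, F t <= Fk k t) -> (forall k, wint (Fk k)) ->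
  0 <= c -> 0 < q < 1 -> (forall k, wE (Fk k) <= c * q ^+ k) ->
  wint F /\ wE F <= c / (1 - q).
Proof.
move=> mF F0 Fk0 FFk iFk c0 /andP[q0 q1] hk.
have mFk k : measurable_fun setT (fun t => (Fk k t * g t)%:E).
  exact: measurable_int (iFk k).
have mFg : measurable_fun setT (fun t => (F t * g t)%:E).
  by apply/measurable_EFinP; apply: measurable_funM.
have key : (\int[m]_t (F t * g t)%:E <= (c / (1 - q))%:E)%E.
  apply: (@le_trans _ _ (\int[m]_t (\sum_(0 <= k <oo) (Fk k t * g t)%:E))%E).
    apply: ge0_le_integral => //.
    - by move=> t _; rewrite lee_fin mulr_ge0.
    - by apply: ge0_emeasurable_sum => // k t _; rewrite lee_fin mulr_ge0.
    move=> t _; have [k hkt] := FFk t.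
    apply: (@le_trans _ _ (Fk k t * g t)%:E); first by rewrite lee_fin ler_wpM2r.
    rewrite (@nneseriesD1 _ _ k xpredT)//; last by move=> n _; rewrite lee_fin mulr_ge0.
    by rewrite leeDl// nneseries_ge0// => n _ _; rewrite lee_fin mulr_ge0.
  rewrite integral_nneseries//; last by move=> k t _; rewrite lee_fin mulr_ge0.
  apply: (@le_trans _ _ (\sum_(0 <= k <oo) (c * q ^+ k)%:E)%E).
    apply: lee_nneseries => k _.
      by move=> _; apply: integral_ge0 => t _; rewrite lee_fin mulr_ge0.
    rewrite -(fineK (integrable_fin_num measurableT (iFk k))) lee_fin.
    exact: hk.
  have nq : `|q| < 1 by rewrite ger0_norm ?ltW.
  have cq := @cvg_geometric_series _ c q nq.
  rewrite -(cvg_lim (@Rhausdorff R) cq) -EFin_lim; last exact: cvgP cq.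
  rewrite le_eqVlt; apply/orP; left; apply/eqP; congr (limn _).
  by apply/funext => n /=; rewrite /series/= -sumEFin.
have iF : wint F.
  apply/integrableP; split => //.
  rewrite (eq_integral (fun t => (F t * g t)%:E)); last first.
    by move=> t _ /=; rewrite ger0_norm ?mulr_ge0.
  exact: le_lt_trans key (ltry _).
split => //.
by rewrite -lee_fin /wE /Rintegral fineK//; exact: integrable_fin_num iF.
Qed.

End weighted_expectation.

(** * Exponential estimates *)

Section exponential_estimates.
Context (R : realType).
Implicit Types x y : R.

Lemma expR_ge_series n x : 0 <= x -> \sum_(0 <= i < n) x ^+ i / i`!%:R <= expR x.
Proof.
move=> x0; rewrite /expR.
have -> : \sum_(0 <= i < n) x ^+ i / i`!%:R = series (exp_coeff x) n.
  by rewrite /series/=; apply: eq_bigr => i _; rewrite /exp_coeff.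
apply: nondecreasing_cvgn_le; last exact: is_cvg_series_exp_coeff.
by apply: nondecreasing_series => i _ _; exact: exp_coeff_ge0.
Qed.

Lemma ln_le_expR x y : 0 < x -> x <= expR y -> ln x <= y.
Proof. by move=> x0 xy; rewrite -[leRHS]expRK ler_ln// posrE ?expR_gt0. Qed.

Lemma ln2_le : ln (2 : R) <= 7 / 10.
Proof.
apply: ln_le_expR => //.
have h : 0 <= 7 / 10 :> R by lra.
apply: le_trans (expR_ge_series 5 h).
rewrite !big_nat_recr ?big_geq//= !factS fact0; lra.
Qed.

(** [3 / 20] is [1 - mu] for [mu = 17 / 20], the Laplace parameter of the tilted sixth moment when
    [p <= 4]. *)
Lemma ln_div320_ge : - (192 / 100) <= ln (3 / 20 : R).
Proof.
have -> : 3 / 20 = (20 / 3)^-1 :> R by rewrite invf_div.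
rewrite lnV ?posrE; last by lra.
rewrite lerN2; apply: ln_le_expR; first by lra.
have h : 0 <= 192 / 100 :> R by lra.
apply: le_trans (expR_ge_series 9 h).
rewrite !big_nat_recr ?big_geq//= !factS fact0; lra.
Qed.

Lemma expR3_ge : 20 <= expR (3 : R).
Proof.
apply: le_trans (expR_ge_series 9 _) => //.
rewrite !big_nat_recr ?big_geq//= !factS fact0; lra.
Qed.

Lemma expR18_7_ge : 49 / 4 <= expR (18 / 7 : R).
Proof.
have h : 0 <= 18 / 7 :> R by lra.
apply: le_trans (expR_ge_series 9 h).
rewrite !big_nat_recr ?big_geq//= !factS fact0; lra.
Qed.

Lemma oppr_ln1B_le x : x < 1 -> - ln (1 - x) <= x / (1 - x).
Proof.
move=> x1; have h : 0 < 1 - x by lra.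
rewrite -lnV ?posrE//.
have := @le_ln1Dx _ (x / (1 - x)).
have -> : 1 + x / (1 - x) = (1 - x)^-1 by field; lra.
by apply; rewrite ltr_pdivlMr//; lra.
Qed.

(** Convexity: the tangent at [v * b] is evaluated at [0] and at [b], and the two inequalities are
    averaged. *)
Lemma expR_chord (v b : R) : 0 <= v <= 1 -> expR (v * b) <= 1 - v + v * expR b.
Proof.
move=> /andP[v0 v1]; set y := expR (v * b).
have tangent z : y * (1 + (z - v * b)) <= expR z.
  rewrite -[z in leRHS](subrKC (v * b)) expRD ler_wpM2l ?expR_ge0//.
  exact: expR_ge1Dx.
have h1 := tangent 0; rewrite expR0 in h1; have h2 := tangent b.
have h3 : (1 - v) * (y * (1 + (0 - v * b))) <= (1 - v) * 1.
  by rewrite ler_wpM2l// subr_ge0.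
have h4 : v * (y * (1 + (b - v * b))) <= v * expR b by rewrite ler_wpM2l.
lra.
Qed.

Lemma normr_le_expR x : `|x| <= expR x + expR (- x).
Proof.
have := expR_ge1Dx x; have := expR_ge1Dx (- x).
have := expR_gt0 x; have := expR_gt0 (- x).
by case: (ger0P x) => *; lra.
Qed.

(** This is [1 + z <= expR z] at [z = x / y - 1], cubed. It is used with [x = Z ^+ 2], and [y] is
    tuned to the size of [x]. *)
Lemma cube_le_expR x y : 0 < y -> 0 <= x ->
  x ^+ 3 <= y ^+ 3 * expR (3 * (x / y - 1)).
Proof.
move=> y0 x0; rewrite expRM_natl -exprMn ler_pXn2r ?nnegrE//.
  have := expR_ge1Dx (x / y - 1); rewrite addrC subrK.
  by rewrite ler_pdivrMr// mulrC.
by rewrite mulr_ge0 ?expR_ge0 ?ltW.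
Qed.

(* The tangent of [x ^ 3] at [y] is absorbed by the exponential once [a * y >= 3]. *)
Lemma cube_le_tangent_expR x y a : 0 < a -> 3 <= a * y -> 0 <= x ->
  x ^+ 3 <= y ^+ 3 + 3 * y ^+ 2 / a * expR (a * (x - y)).
Proof.
move=> a0 ay x0.
have y0 : 0 < y by rewrite -(pmulr_rgt0 _ a0); lra.
have c0 : 0 <= 3 * y ^+ 2 / a by rewrite divr_ge0 ?mulr_ge0 ?sqr_ge0 ?ltW.
case: (lerP x y) => xy.
  have h : x ^+ 3 <= y ^+ 3 by rewrite ler_pXn2r ?nnegrE// ltW.
  by apply: le_trans h _; rewrite lerDl mulr_ge0 ?expR_ge0.
set z := x - y; have z0 : 0 < z by rewrite /z; lra.
have e : 1 + a * z + (a * z) ^+ 2 / 2 + (a * z) ^+ 3 / 6 <= expR (a * z).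
  have h : 0 <= a * z by rewrite mulr_ge0 ?ltW.
  apply: le_trans (expR_ge_series 4 h).
  by rewrite !big_nat_recr ?big_geq//= !factS fact0; lra.
have -> : x = y + z by rewrite /z; lra.
apply: (@le_trans _ _ (y ^+ 3 + 3 * y ^+ 2 / a *
    (1 + a * z + (a * z) ^+ 2 / 2 + (a * z) ^+ 3 / 6))); last first.
  by rewrite lerD2l ler_wpM2l.
(* The products [a * y] are isolated: once they are at least [3], the coefficients of [z ^+ 2] and
   [z ^+ 3] dominate those of [(y + z) ^+ 3]. *)
have -> : y ^+ 3 + 3 * y ^+ 2 / a *
    (1 + a * z + (a * z) ^+ 2 / 2 + (a * z) ^+ 3 / 6) =
  y ^+ 3 + 3 * y ^+ 2 / a + 3 * y ^+ 2 * z +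
  3 / 2 * y * (a * y) * z ^+ 2 + (a * y) ^+ 2 / 2 * z ^+ 3.
  by field; lra.
have h1 : y * 3 * z ^+ 2 <= y * (a * y) * z ^+ 2.
  by rewrite ler_wpM2r ?sqr_ge0// ler_wpM2l// ltW.
have h2 : 9 * z ^+ 3 <= (a * y) ^+ 2 * z ^+ 3.
  rewrite ler_wpM2r ?exprn_ge0//; first exact: ltW.
  have : 0 <= (a * y - 3) * (a * y + 3) by rewrite mulr_ge0//; lra.
  by move=> h; lra.
have h3 : 0 <= z ^+ 3 by rewrite exprn_ge0 ?ltW.
have h4 : 0 <= y * z ^+ 2 by rewrite mulr_ge0 ?sqr_ge0 ?ltW.
have -> : (y + z) ^+ 3 = y ^+ 3 + 3 * y ^+ 2 * z + 3 * y * z ^+ 2 + z ^+ 3 by ring.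
lra.
Qed.

Lemma derive_ge0_ge0 (K K' : R -> R) (b : R) :
  (forall t : R, is_derive t (1 : R) K (K' t)) -> K 0 = 0 ->
  (forall t, 0 <= t <= b -> 0 <= K' t) -> forall t, 0 <= t -> t <= b -> 0 <= K t.
Proof.
move=> dK K0 K'0 t; rewrite le_eqVlt => /predU1P[<-|t0] tb; first by rewrite K0.
have cK : {within `[0, t], continuous K}.
  apply: continuous_subspaceT => x.
  by apply: differentiable_continuous; apply/derivable1_diffP; case: (dK x).
have [c] := MVT t0 (fun x _ => dK x) cK.
rewrite in_itv/= => /andP[c0 ct]; rewrite K0 !subr0 => ->.
by rewrite mulr_ge0 ?(ltW t0)// K'0// (ltW c0) (le_trans (ltW ct)).
Qed.

(* Trapezoidal bound for the exponential, i.e. [tanh u <= u]. *)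
Lemma expR_trapezoid x : (expR x - 1) * x <= x ^+ 2 / 2 * (expR x + 1).
Proof.
suff pos y : 0 <= y -> (expR y - 1) * y <= y ^+ 2 / 2 * (expR y + 1).
  case: (lerP 0 x) => [/pos//|x0].
  have /pos : 0 <= - x by lra.
  move=> h; have e0 := expR_gt0 x.
  have : expR x * ((expR (- x) - 1) * - x) <=
         expR x * ((- x) ^+ 2 / 2 * (expR (- x) + 1)) by rewrite ler_wpM2l ?expR_ge0.
  rewrite expRN.
  have -> : expR x * (((expR x)^-1 - 1) * - x) = (expR x - 1) * x by field; lra.
  by have -> : expR x * ((- x) ^+ 2 / 2 * ((expR x)^-1 + 1)) =
               x ^+ 2 / 2 * (expR x + 1) by field; lra.
move=> y0.
have [->|yn0] := eqVneq y 0; first by rewrite mulr0 expr0n/= mul0r mul0r.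
suff : 0 <= (y - 2) * expR y + (y + 2).
  move=> h; have : 0 <= y * ((y - 2) * expR y + (y + 2)) by rewrite mulr_ge0.
  by lra.
case: (lerP 2 y) => y2.
  by rewrite addr_ge0 ?mulr_ge0 ?expR_ge0//; lra.
pose F (t : R) := (t - 2) * expR t + (t + 2).
have dF (t : R) : is_derive t 1 F ((t - 1) * expR t + 1).
  rewrite /F; apply: is_derive_eq.
  rewrite /GRing.scale/=; ring.
pose H (t : R) := (t - 1) * expR t + 1.
have dH (t : R) : is_derive t 1 H (t * expR t).
  rewrite /H; apply: is_derive_eq.
  rewrite /GRing.scale/=; ring.
have H0 t : 0 <= t -> 0 <= H t.
  move=> t0; apply: (derive_ge0_ge0 dH) t0 (lexx t); first by rewrite /H expR0; ring.
  by move=> u /andP[u0 _]; rewrite mulr_ge0 ?expR_ge0.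
suff : 0 <= F y by [].
apply: (derive_ge0_ge0 dF) y0 (lexx y); first by rewrite /F expR0; ring.
by move=> u /andP[u0 _]; exact: H0.
Qed.

End exponential_estimates.

(** * Exponential tilts of a Gaussian *)

Section gaussian_tilt.
Context d (T : measurableType d) (R : realType).
Variables (m : {measure set T -> \bar R}) (g : T -> R).
Hypotheses (mg : measurable_fun setT g) (g0 : forall t, 0 <= g t).
Variables (p s w : R) (Z L dl : T -> R).

Local Notation E := (wE m g).
Local Notation In := (wint m g).
Let r := 2 * Num.sqrt p + s.

Hypotheses (p0 : 0 <= p) (s0 : 0 < s) (w0 : 0 <= w) (wr : w * r <= 3 / 4).
Hypotheses (mZ : measurable_fun setT Z) (mL : measurable_fun setT L)
  (mdl : measurable_fun setT dl).
Hypothesis Z0 : forall t, 0 <= Z t.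
Hypothesis int1 : In (fun=> 1).
Hypothesis E1 : E (fun=> 1) = 1.
(** [lam] stands for an upper bound of [D DG2^-1 D], a matrix at most [1] and of trace [p]: both
    numbers are admissible. A small [lam] permits [mu > 1], which the region [Z > r] requires when
    [p] is small. *)
Hypothesis mgf : forall lam mu tau, 0 < lam <= 1 -> lam = 1 \/ p <= lam ->
  0 <= mu -> mu * lam < 1 ->
  In (fun t => expR (tau * L t + mu / 2 * Z t ^+ 2)) /\
  E (fun t => expR (tau * L t + mu / 2 * Z t ^+ 2)) <=
    expR (- (p / (2 * lam)) * ln (1 - mu * lam) + tau ^+ 2 / (2 * (1 - mu * lam))).
Hypothesis dl_in : forall t, Z t <= r -> `|dl t| <= w * Z t ^+ 3 / 6.
Hypothesis dl_out : forall t, r < Z t ->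
  dl t <= (Z t - r) ^+ 2 / 2 + w * r ^+ 3 / 6 + w * r ^+ 2 * (Z t - r) / 2.
Hypothesis dl_le : forall t, dl t <= Z t ^+ 2 / 2.
Hypothesis int_dl : In (fun t => expR (dl t)).
Hypothesis int_Ldl : In (fun t => L t * expR (dl t)).

Let r0 : 0 < r.
Proof. by rewrite /r ltr_wpDl// mulr_ge0// sqrtr_ge0. Qed.

Let sp2 : Num.sqrt p * Num.sqrt p = p.
Proof. by rewrite -expr2 sqr_sqrtr. Qed.

Let sp0 : 0 <= Num.sqrt p.
Proof. exact: sqrtr_ge0. Qed.

Let r2E : r ^+ 2 = 4 * p + 4 * Num.sqrt p * s + s ^+ 2.
Proof. by rewrite /r; move: sp2; move: (Num.sqrt p) => q <-; ring. Qed.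

Let sps : 0 <= Num.sqrt p * s.
Proof. by rewrite mulr_ge0 ?(ltW s0). Qed.

Let r2_ge : 4 * p + s ^+ 2 <= r ^+ 2.
Proof. by rewrite r2E; have := sps; lra. Qed.

Lemma wint_bounded (F : T -> R) (k : R) : measurable_fun setT F ->
  (forall t, `|F t| <= k) -> In F.
Proof.
move=> mF Fk; apply: (wint_le mg mF _ (wintZ k int1)) => t.
by rewrite mulr1.
Qed.

Lemma wE_cst (k : R) : E (fun=> k) = k.
Proof.
rewrite -[RHS]mulr1 -E1 -wEZ//; apply: eq_wE => t.
by rewrite mulr1.
Qed.

Lemma mgf_sqr mu : 0 <= mu < 1 ->
  In (fun t => expR (mu / 2 * Z t ^+ 2)) /\
  E (fun t => expR (mu / 2 * Z t ^+ 2)) <= expR (- (p / 2) * ln (1 - mu)).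
Proof.
move=> /andP[mu0 mu1].
have [||//||] := @mgf 1 mu 0; rewrite ?mulr1 ?ltr01 ?lexx//; first by left.
move=> iF leF; have eF : (fun t => expR (0 * L t + mu / 2 * Z t ^+ 2)) =1
  (fun t => expR (mu / 2 * Z t ^+ 2)) by move=> t; rewrite mul0r add0r.
split; first exact: eq_wint iF.
by rewrite -(eq_wE _ _ eF) (le_trans leF)// expr0n/= mul0r addr0.
Qed.

(** The inequality [|y| <= expR y + expR (- y)] at [y = tau * L t] trades [|L|] for two Laplace
    transforms. The price is [2 / tau], with [tau] free at each use. *)
Lemma mgf_normr lam mu tau : 0 < lam <= 1 -> lam = 1 \/ p <= lam ->
  0 <= mu -> mu * lam < 1 -> 0 < tau ->
  In (fun t => `|L t| * expR (mu / 2 * Z t ^+ 2)) /\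
  E (fun t => `|L t| * expR (mu / 2 * Z t ^+ 2)) <= 2 / tau *
    expR (- (p / (2 * lam)) * ln (1 - mu * lam) + tau ^+ 2 / (2 * (1 - mu * lam))).
Proof.
move=> hlam hp mu0 mul1 tau0.
have [i1 l1] := mgf tau hlam hp mu0 mul1.
have [i2 l2] := mgf (- tau) hlam hp mu0 mul1.
pose H t := tau^-1 * (expR (tau * L t + mu / 2 * Z t ^+ 2) +
              expR (- tau * L t + mu / 2 * Z t ^+ 2)).
have iH : In H by apply: wintZ; exact: wintD.
have mF : measurable_fun setT (fun t => `|L t| * expR (mu / 2 * Z t ^+ 2)).
  apply: measurable_funM; first exact: measurableT_comp.
  apply: measurableT_comp => //; apply: measurable_funM => //.
  exact: measurable_funX.
have FH t : `|L t| * expR (mu / 2 * Z t ^+ 2) <= H t.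
  have -> : H t = tau^-1 * (expR (tau * L t) + expR (- (tau * L t))) *
      expR (mu / 2 * Z t ^+ 2) by rewrite /H !expRD mulNr; ring.
  rewrite ler_wpM2r ?expR_ge0//.
  have := normr_le_expR (tau * L t); rewrite normrM (gtr0_norm tau0).
  by rewrite -ler_pdivlMl.
have iF : In (fun t => `|L t| * expR (mu / 2 * Z t ^+ 2)).
  apply: (wint_le mg mF _ iH) => t.
  by rewrite ger0_norm ?mulr_ge0 ?expR_ge0.
split => //.
apply: (le_trans (le_wE g0 iF iH FH)).
rewrite /H wEZ ?wED//; last exact: wintD.
rewrite sqrrN in l2.
have := lerD l1 l2; set e := expR _ => h.
rewrite (_ : 2 / tau * e = tau^-1 * (e + e)); last by field; lra.
by rewrite ler_wpM2l// invr_ge0 ltW.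
Qed.

Lemma int_normL : In (fun t => `|L t|).
Proof.
have [||//||//|iF _] := @mgf_normr 1 0 1; rewrite ?mul0r ?ltr01 ?lexx//; first by left.
by apply: eq_wint iF => t; rewrite !mul0r expR0 mulr1.
Qed.

Lemma int_sqr : In (fun t => Z t ^+ 2).
Proof.
have [|iF _] := @mgf_sqr (1 / 2); first by lra.
apply: (wint_le mg _ _ (wintZ 4 iF)); first exact: measurable_funX.
move=> t; rewrite ger0_norm ?sqr_ge0//.
have := expR_ge1Dx (1 / 2 / 2 * Z t ^+ 2); lra.
Qed.

(** The Laplace bound is differentiated at [mu = 0] by hand: [1 + mu / 2 * X] is at most
    [(1 - y)^-1] with [y] close to [p * mu / 2], which gives [X <= p] up to an error of order
    [mu]. *)
Lemma wE_sqr_le : E (fun t => Z t ^+ 2) <= p.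
Proof.
set X := E _; have p0' := p0.
have X0 : 0 <= X by apply: wE_ge0 => // t; exact: sqr_ge0.
have key mu : 0 < mu -> mu <= 2^-1 -> mu * (1 + p) < 1 ->
    X <= p + X * (mu * (1 + p)).
  move=> mu0 mu2 mup; have [|iF lF] := @mgf_sqr mu; first by lra.
  have h1 : 1 + mu / 2 * X <= E (fun t => expR (mu / 2 * Z t ^+ 2)).
    have -> : 1 + mu / 2 * X = E (fun t => 1 + mu / 2 * Z t ^+ 2).
      by rewrite wED ?E1 ?wEZ//; [exact: int_sqr|exact/wintZ/int_sqr].
    apply: le_wE => //; first by apply: wintD => //; exact/wintZ/int_sqr.
    by move=> t; exact: expR_ge1Dx.
  set y := p * mu / (2 * (1 - mu)).
  have y0 : 0 <= y by rewrite divr_ge0 ?mulr_ge0//; lra.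
  have ymu : y <= p * mu.
    rewrite ler_pdivrMr; last by lra.
    by rewrite ler_peMr ?mulr_ge0//; lra.
  have y1 : y < 1 by lra.
  have h2 : expR (- (p / 2) * ln (1 - mu)) <= (1 - y)^-1.
    have h : expR (- (p / 2) * ln (1 - mu)) <= expR y.
      rewrite ler_expR /y mulNr -mulrN.
      have := @oppr_ln1B_le _ mu; move=> /(_ ltac:(lra)) h.
      have -> : p * mu / (2 * (1 - mu)) = p / 2 * (mu / (1 - mu)) by field; lra.
      by rewrite ler_wpM2l// divr_ge0.
    apply: (le_trans h); rewrite -[y]opprK expRN opprK.
    rewrite lef_pV2 ?posrE ?expR_gt0//; last by lra.
    by have := expR_ge1Dx (- y).
  have h3 : (1 + mu / 2 * X) * (1 - y) <= 1.
    rewrite -ler_pdivlMr ?div1r; last by lra.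
    exact: le_trans h1 (le_trans lF h2).
  have h4 : y * (1 - mu) = p * mu / 2 by rewrite /y; field; lra.
  have h5 : mu * (X * ((1 - y) * (1 - mu))) <= mu * p.
    have : (1 + mu / 2 * X) * (1 - y) * (1 - mu) <= 1 * (1 - mu).
      by rewrite ler_wpM2r//; lra.
    have -> : (1 + mu / 2 * X) * (1 - y) * (1 - mu) = 1 - mu - y * (1 - mu) +
      mu * (X * ((1 - y) * (1 - mu))) / 2 by ring.
    by rewrite h4; lra.
  rewrite ler_pM2l// in h5.
  have h6 : X * (1 - mu * (1 + p)) <= X * ((1 - y) * (1 - mu)).
    rewrite ler_wpM2l//.
    have : 0 <= y * mu by rewrite mulr_ge0// ltW.
    lra.
  lra.
apply/ler_addgt0Pr => e e0.
(* The parameter is [mu = k^-1]: this [k] meets the three side conditions of [key] and makes the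
   error [X * (mu * (1 + p))] at most [e]. *)
pose k := (1 + p) * (X + 1) * (1 + e^-1) + 2.
have e'0 : 0 < e^-1 by rewrite invr_gt0.
have k1 : 0 <= (1 + p) * (X + 1) by rewrite mulr_ge0//; lra.
have k2 : 0 <= (1 + p) * X by rewrite mulr_ge0//; lra.
have k3 : 0 <= (1 + p) * (X + 1) * e^-1 by rewrite mulr_ge0// ltW.
have k4 : 0 <= (1 + p) * e^-1 by rewrite mulr_ge0 ?(ltW e'0)//; lra.
have k0 : 0 < k by rewrite /k; lra.
have := key k^-1; rewrite invr_gt0 lef_pV2 ?posrE// => /(_ k0).
have -> : 2 <= k by rewrite /k; lra.
have kp : k^-1 * (1 + p) < 1 by rewrite mulrC ltr_pdivrMr// mul1r /k; lra.
move=> /(_ isT kp) h; apply: (le_trans h); rewrite lerD2l.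
rewrite mulrA mulrC mulrA ler_pdivrMr//.
have : (1 + p) * X <= e * ((1 + p) * (X + 1) * e^-1).
  have -> : e * ((1 + p) * (X + 1) * e^-1) = (1 + p) * (X + 1) by field; lra.
  lra.
move=> h'; apply: (le_trans h'); rewrite ler_wpM2l ?(ltW e0)// /k; lra.
Qed.

Lemma int_pow6 : In (fun t => Z t ^+ 6).
Proof.
have [|iF _] := @mgf_sqr (1 / 2); first by lra.
apply: (wint_le mg _ _ (wintZ (12 ^+ 3 * expR (-3)) iF)).
  exact: measurable_funX.
move=> t; rewrite ger0_norm ?exprn_ge0// (exprM _ 2 3).
apply: (le_trans (@cube_le_expR _ _ 12 _ (sqr_ge0 _))) => //.
rewrite -mulrA ler_wpM2l// -expRD ler_expR; lra.
Qed.

Lemma wE_pow6_le : E (fun t => Z t ^+ 6) <= 28 * (p + 1) ^+ 3.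
Proof.
(* With this [y0] the Laplace parameter is [6 / y0 < 1] and its exponent [3 * p / (7 * p + 1)] is at
   most [3 / 7]; the constant is [7 ^+ 3 * expR (- (18 / 7)) <= 28]. *)
have p0' := p0; pose y0 : R := 7 * (p + 1); have y00 : 0 < y0 by rewrite /y0 mulr_gt0//; lra.
have p10 : p + 1 != 0 by lra.
have y03 : 0 <= y0 ^+ 3 by exact: exprn_ge0 (ltW y00).
have [|iF lF] := @mgf_sqr (6 / y0).
  by rewrite divr_ge0 ?(ltW y00)//= ltr_pdivrMr// mul1r /y0; lra.
apply: (@le_trans _ _ (E (fun t => y0 ^+ 3 * expR (-3) * expR (6 / y0 / 2 * Z t ^+ 2)))).
  apply: le_wE => //; [exact: int_pow6|exact: wintZ|] => t.
  rewrite (exprM _ 2 3); apply: (le_trans (cube_le_expR y00 (sqr_ge0 _))).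
  rewrite -mulrA (ler_wpM2l y03)// -expRD ler_expR.
  by rewrite le_eqVlt; apply/orP; left; apply/eqP; rewrite /y0; field; lra.
rewrite wEZ//; apply: (@le_trans _ _ (y0 ^+ 3 * expR (-3) * expR (3 / 7))).
  rewrite (ler_wpM2l (mulr_ge0 y03 (expR_ge0 _)))//.
  apply: (le_trans lF); rewrite ler_expR mulNr -mulrN.
  have h1 : 6 / y0 < 1 by rewrite ltr_pdivrMr// mul1r /y0; lra.
  apply: (@le_trans _ _ (p / 2 * (6 / y0 / (1 - 6 / y0)))).
    by rewrite ler_wpM2l ?divr_ge0// oppr_ln1B_le.
  have -> : p / 2 * (6 / y0 / (1 - 6 / y0)) = 3 * p / (7 * p + 1).
    rewrite /y0; field; lra.
  rewrite ler_pdivrMr; lra.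
rewrite -mulrA -expRD (_ : -3 + 3 / 7 = - (18 / 7)); last by field.
have := expR18_7_ge R; rewrite expRN; set e := expR _ => he.
have ei : e^-1 <= 4 / 49 by rewrite -[4 / 49]invrK lef_pV2 ?posrE ?invf_div//; lra.
have q3 : 0 <= (p + 1) ^+ 3 by rewrite exprn_ge0//; lra.
apply: (@le_trans _ _ (y0 ^+ 3 * (4 / 49))).
  exact: (ler_wpM2l y03).
rewrite /y0 exprMn; lra.
Qed.

(** * Truncation of the tilt at radius [r]: masses and moments *)

Let out t : R := if Z t <= r then 0 else 1.
(** The value [0] beyond [r] keeps the truncated tilt a bounded positive density on the whole space;
    its [mass] exceeds [core] by exactly [E out]. *)
Let dlt t : R := if Z t <= r then dl t else 0.
Let core := E (fun t => if Z t <= r then expR (dl t) else 0).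
Let mass := E (fun t => expR (dlt t)).

Let mle : measurable_fun setT (fun t => Z t <= r).
Proof. by apply: measurable_fun_ler => //; exact: measurable_cst. Qed.

Let mout : measurable_fun setT out.
Proof. by apply: measurable_fun_ifT => //; exact: measurable_cst. Qed.

Let mdlt : measurable_fun setT dlt.
Proof. by apply: measurable_fun_ifT => //; exact: measurable_cst. Qed.

Let int_out : In out.
Proof.
apply: (@wint_bounded out 1 mout) => t; rewrite /out.
by case: ifP; rewrite ?normr0 ?normr1.
Qed.

(** Markov's inequality for [Z ^+ 2], since [4 * p <= r ^+ 2]. *)
Lemma wE_out_le4 : E out <= 1 / 4.
Proof.
have p0' := p0; have r0' := r0; have s0' := s0; have r2_ge' := r2_ge.
have r20 : 0 < r ^+ 2 by rewrite exprn_gt0.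
have h : E out <= E (fun t => (r ^+ 2)^-1 * Z t ^+ 2).
  apply: le_wE => //; first exact/wintZ/int_sqr.
  move=> t; rewrite /out; case: (lerP (Z t) r) => Zr.
    by rewrite mulr_ge0 ?sqr_ge0// invr_ge0 ltW.
  by rewrite mulrC ler_pdivlMr// mul1r ler_pXn2r ?nnegrE ?(ltW r0) ?(ltW Zr).
apply: (le_trans h); rewrite wEZ; last exact: int_sqr.
rewrite mulrC ler_pdivrMr//; apply: (le_trans wE_sqr_le).
by have := sqr_ge0 s; lra.
Qed.

(** Chernoff bound at [mu = 3 / 4], where [1 - mu] is a power of [2] and the logarithm reduces to
    [ln 2 <= 7 / 10]. *)
Lemma wE_out_le_expR : E out <= expR (7 / 10 * p - 3 / 8 * r ^+ 2).
Proof.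
have p0' := p0; have r0' := r0.
have [|iF lF] := @mgf_sqr (3 / 4); first by lra.
have h : E out <= E (fun t => expR (- (3 / 8) * r ^+ 2) * expR (3 / 4 / 2 * Z t ^+ 2)).
  apply: le_wE => //; first exact: wintZ.
  move=> t; rewrite /out; case: (lerP (Z t) r) => Zr.
    by rewrite mulr_ge0 ?expR_ge0.
  rewrite -expRD -[leLHS](@expR0 R) ler_expR.
  have : r ^+ 2 <= Z t ^+ 2 by rewrite ler_pXn2r ?nnegrE ?(ltW r0) ?(ltW Zr).
  by lra.
apply: (le_trans h); rewrite wEZ//.
apply: (@le_trans _ _ (expR (- (3 / 8) * r ^+ 2) * expR (7 / 10 * p))).
  rewrite (ler_wpM2l (expR_ge0 _))//; apply: (le_trans lF); rewrite ler_expR.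
  have -> : 1 - 3 / 4 = (2 ^+ 2)^-1 :> R by rewrite expr2; field.
  rewrite lnV ?posrE ?exprn_gt0// lnXn// mulrNN [ln 2 *+ 2]mulr2n.
  have := ln2_le R => h2.
  have : p / 2 * (ln 2 + ln 2) <= p / 2 * (14 / 10) by rewrite ler_wpM2l//; lra.
  by lra.
by rewrite -expRD ler_expR; lra.
Qed.

Let wZ3_le t : Z t <= r -> w * Z t ^+ 3 / 6 <= Z t ^+ 2 / 8.
Proof.
move=> Zr; have := Z0 t => Zt0; have w0' := w0; have wr' := wr.
have : w * Z t <= w * r by rewrite ler_wpM2l.
move=> h; have : (w * Z t) * Z t ^+ 2 <= 3 / 4 * Z t ^+ 2.
  by rewrite ler_wpM2r ?sqr_ge0//; lra.
have -> : w * Z t ^+ 3 = w * Z t * Z t ^+ 2 by ring.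
by lra.
Qed.

(** The exponential is replaced by its tangent at [- p / 6]. This point makes the terms in [p]
    cancel: [E out <= 1 / 4] leaves [3 / 4 * (1 + p / 6)], and [E Z ^+ 2 <= p] removes [p / 8]. *)
Lemma core_ge : 3 / 4 * expR (- p / 6) <= core.
Proof.
have p0' := p0; have out4 := wE_out_le4; have Z2 := wE_sqr_le.
have iF : In (fun t => if Z t <= r then expR (dl t) else 0).
  apply: (@wint_le _ _ _ _ _ mg _ (fun t => expR (dl t))) => //.
    apply: measurable_fun_ifT => //; exact: measurableT_comp.
  by move=> t; case: ifP => _; rewrite ?normr0 ?expR_ge0// ger0_norm ?expR_ge0.
pose H t := expR (- p / 6) * (1 + p / 6 + (- (1 + p / 6) * out t + - (1 / 8) * Z t ^+ 2)).
have iH1 : In (fun t => - (1 + p / 6) * out t + - (1 / 8) * Z t ^+ 2).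
  by apply: wintD; apply: wintZ => //; exact: int_sqr.
have ic : In (fun=> 1 + p / 6) by exact: (@wint_bounded _ `|1 + p / 6|).
have iH : In H by apply: wintZ; apply: wintD.
have HF t : H t <= if Z t <= r then expR (dl t) else 0.
  rewrite /H /out; case: (lerP (Z t) r) => Zr.
    apply: (@le_trans _ _ (expR (- p / 6) * expR (p / 6 - Z t ^+ 2 / 8))).
      rewrite (ler_wpM2l (expR_ge0 _))//.
      by have := expR_ge1Dx (p / 6 - Z t ^+ 2 / 8); lra.
    rewrite -expRD ler_expR; have := dl_in Zr; have := wZ3_le Zr.
    by rewrite ler_norml => ? /andP[? _]; lra.
  rewrite pmulr_rle0 ?expR_gt0//; have := sqr_ge0 (Z t); lra.
apply: le_trans (le_wE g0 iH iF HF); rewrite /H wEZ; last exact: wintD.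
rewrite wED// wE_cst wED; [|by apply: wintZ|by apply: wintZ; exact: int_sqr].
rewrite !wEZ//; last exact: int_sqr.
rewrite mulrC (ler_wpM2l (expR_ge0 _))//.
have : (1 + p / 6) * E out <= (1 + p / 6) * (1 / 4) by rewrite ler_wpM2l//; lra.
lra.
Qed.

Lemma normr_dlt_cube t : `|dlt t| <= w * Z t ^+ 3 / 6.
Proof.
rewrite /dlt; case: (lerP (Z t) r) => [/dl_in//|_].
by rewrite normr0 divr_ge0// mulr_ge0// exprn_ge0.
Qed.

Lemma normr_dlt_sqr t : `|dlt t| <= Z t ^+ 2 / 8.
Proof.
rewrite /dlt; case: (lerP (Z t) r) => [Zr|_].
  exact: le_trans (dl_in Zr) (wZ3_le Zr).
by rewrite normr0 divr_ge0 ?sqr_ge0.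
Qed.

Let bd := w * r ^+ 3 / 6.

Lemma normr_dlt_le t : `|dlt t| <= bd.
Proof.
have bd0 : 0 <= bd by rewrite /bd divr_ge0// mulr_ge0// exprn_ge0// ltW.
rewrite /dlt; case: (lerP (Z t) r) => [Zr|_]; last by rewrite normr0.
apply: (le_trans (dl_in Zr)).
by rewrite /bd ler_wpM2r// ler_wpM2l// ler_pXn2r ?nnegrE// ltW.
Qed.

Let expR_dlt_le t : expR (dlt t) <= expR bd.
Proof. by rewrite ler_expR (le_trans (ler_norm _) (normr_dlt_le t)). Qed.

Let int_expdlt : In (fun t => expR (dlt t)).
Proof.
apply: (@wint_bounded _ (expR bd)); first exact: measurableT_comp.
by move=> t; rewrite ger0_norm ?expR_ge0.
Qed.

(** Jensen's inequality, written with the tangent at [- p / 8]. *)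
Lemma mass_ge : expR (- p / 8) <= mass.
Proof.
have p0' := p0; have Z2 := wE_sqr_le.
pose H t := expR (- p / 8) * (1 + p / 8 + - (1 / 8) * Z t ^+ 2).
have ic : In (fun=> 1 + p / 8) by exact: (@wint_bounded _ `|1 + p / 8|).
have iZ : In (fun t => - (1 / 8) * Z t ^+ 2) by apply: wintZ; exact: int_sqr.
have iH : In H by apply: wintZ; apply: wintD.
have HF t : H t <= expR (dlt t).
  rewrite /H; apply: (@le_trans _ _ (expR (- p / 8) * expR (p / 8 - Z t ^+ 2 / 8))).
    rewrite (ler_wpM2l (expR_ge0 _))//.
    by have := expR_ge1Dx (p / 8 - Z t ^+ 2 / 8); lra.
  rewrite -expRD ler_expR; have := normr_dlt_sqr t.
  by rewrite ler_norml => /andP[? _]; lra.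
apply: le_trans (le_wE g0 iH int_expdlt HF); rewrite /H wEZ; last exact: wintD.
rewrite wED// wE_cst wEZ; last exact: int_sqr.
by rewrite -[leLHS]mulr1 (ler_wpM2l (expR_ge0 _))//; lra.
Qed.

Lemma mass_le : mass <= core + E out.
Proof.
rewrite /mass /core -wED//; last first.
  apply: (@wint_le _ _ _ _ _ mg _ (fun t => expR (dl t))) => //.
    apply: measurable_fun_ifT => //; exact: measurableT_comp.
  by move=> t; case: ifP => _; rewrite ?normr0 ?expR_ge0// ger0_norm ?expR_ge0.
rewrite le_eqVlt; apply/orP; left; apply/eqP; apply: eq_wE => t.
by rewrite /dlt /out; case: ifP; rewrite ?addr0// add0r expR0.
Qed.

Let int_expdlt_pow6 : In (fun t => expR (dlt t) * Z t ^+ 6).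
Proof.
apply: (wint_le mg _ _ (wintZ (expR bd) int_pow6)).
  apply: measurable_funM; last exact: measurable_funX.
  exact: measurableT_comp.
move=> t; rewrite ger0_norm ?mulr_ge0 ?expR_ge0 ?exprn_ge0//.
by rewrite ler_wpM2r ?exprn_ge0.
Qed.

(** The chord over [[0, 29 / 20]] lies below [1 + x] because [expR (29 / 20) <= 5], a bound reached
    from [29 / 320] by four doublings. *)
Lemma expR_le_1D (x : R) : 0 <= x <= 4 -> expR (29 / 80 * x) <= 1 + x.
Proof.
move=> /andP[x0 x4].
have e5 : expR (29 / 20 : R) <= 5.
  have dbl (a b c : R) : expR a <= b -> b * b <= c -> expR (a + a) <= c.
    by move=> ab; apply: le_trans; rewrite expRD; apply: ler_pM; rewrite ?expR_ge0.
  have e1 : expR (29 / 320 : R) <= 11 / 10.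
    have h := expR_ge1Dx (- (29 / 320) : R).
    rewrite -[29 / 320]opprK expRN -[11 / 10]invrK lef_pV2 ?posrE ?invf_div ?expR_gt0//.
    by lra.
  have e2 := dbl _ _ (121 / 100) e1 ltac:(lra).
  have e4 := dbl _ _ (1465 / 1000) e2 ltac:(lra).
  have e8 := dbl _ _ (215 / 100) e4 ltac:(lra).
  have := dbl _ _ 5 e8 ltac:(lra); apply: le_trans; rewrite ler_expR; lra.
have h := @expR_chord _ (x / 4) (29 / 20).
have {}h := h ltac:(lra).
have -> : 29 / 80 * x = x / 4 * (29 / 20) by field.
have : x / 4 * expR (29 / 20) <= x / 4 * 5 by rewrite ler_wpM2l//; lra.
lra.
Qed.

(** The bound has to be relative to [mass], which may be of order [expR (- p / 8)]. A purely
    exponential majorant of the cube loses a factor exponential in [p], affordable for [p <= 4]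
    only; for larger [p] the tangent version keeps the main term [y0 ^+ 3 * mass] intact. *)
Lemma tilted_pow6_le :
  E (fun t => expR (dlt t) * Z t ^+ 6) <= 50 * (p + 1) ^+ 3 * mass.
Proof.
have p0' := p0; have mge := mass_ge.
have dltZ t : dlt t <= Z t ^+ 2 / 8 := le_trans (ler_norm _) (normr_dlt_sqr t).
have P0 : 0 <= (p + 1) ^+ 3 by rewrite exprn_ge0//; lra.
case: (lerP p 4) => p4.
  (* Half of [17 / 20] is [1 / 8 + 3 / 10]: the bound [Z ^+ 2 / 8] on [dlt], and [cube_le_expR] at
     [y = 10]. *)
  have [|iF lF] := @mgf_sqr (17 / 20); first by lra.
  have h : E (fun t => expR (dlt t) * Z t ^+ 6) <=
           E (fun t => 10 ^+ 3 * expR (-3) * expR (17 / 20 / 2 * Z t ^+ 2)).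
    apply: le_wE => //; first exact: wintZ.
    move=> t; rewrite (exprM _ 2 3).
    apply: (@le_trans _ _ (expR (Z t ^+ 2 / 8) *
        (10 ^+ 3 * expR (3 * (Z t ^+ 2 / 10 - 1))))).
      apply: ler_pM; rewrite ?expR_ge0 ?exprn_ge0 ?sqr_ge0 ?ler_expR//.
      by apply: cube_le_expR; rewrite ?sqr_ge0.
    rewrite mulrCA -mulrA -!expRD ler_wpM2l// ler_expR; lra.
  apply: (le_trans h); rewrite wEZ//.
  have h2 : expR (- (p / 2) * ln (1 - 17 / 20)) <= (p + 1) ^+ 3 * mass.
    apply: (@le_trans _ _ (expR (29 / 80 * p) ^+ 3 * expR (- p / 8))).
      rewrite -expRM_natl -expRD ler_expR.
      have -> : 1 - 17 / 20 = 3 / 20 :> R by field.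
      have := ln_div320_ge R => hl.
      have : p / 2 * - ln (3 / 20) <= p / 2 * (192 / 100).
        by rewrite ler_wpM2l//; lra.
      by lra.
    apply: ler_pM; rewrite ?expR_ge0 ?exprn_ge0 ?expR_ge0//.
    rewrite ler_pXn2r ?nnegrE ?expR_ge0//; last by lra.
    by rewrite addrC expR_le_1D// p0.
  have h3 : 10 ^+ 3 * expR (-3) <= 50 :> R.
    rewrite expRN; have := expR3_ge R; set e := expR 3 => he.
    by rewrite ler_pdivrMr; lra.
  rewrite -[leRHS]mulrA; apply: ler_pM.
  - by rewrite mulr_ge0 ?expR_ge0.
  - by apply: wE_ge0 => // t; exact: expR_ge0.
  - exact: h3.
  - exact: le_trans lF h2.
have [|iF lF] := @mgf_sqr (3 / 4); first by lra.
(* [33 / 10] is tuned so that [expR (- y0 / 4)] times the Laplace bound [expR (7 / 10 * p)] is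
   exactly [expR (- p / 8)], the lower bound of [mass]. *)
pose y0 := 33 / 10 * p.
have h : E (fun t => expR (dlt t) * Z t ^+ 6) <=
  E (fun t => y0 ^+ 3 * expR (dlt t) +
     3 * y0 ^+ 2 / (1 / 4) * expR (- y0 / 4) * expR (3 / 4 / 2 * Z t ^+ 2)).
  apply: le_wE => //; first by apply: wintD; exact: wintZ.
  move=> t; rewrite (exprM _ 2 3).
  have hh := @cube_le_tangent_expR R (Z t ^+ 2) y0 (1 / 4).
  have {}hh := hh ltac:(lra) ltac:(rewrite /y0; lra) (sqr_ge0 _).
  apply: (@le_trans _ _ (expR (dlt t) * (y0 ^+ 3 + 3 * y0 ^+ 2 / (1 / 4) *
      expR (1 / 4 * (Z t ^+ 2 - y0))))).
    by rewrite ler_wpM2l ?expR_ge0.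
  rewrite mulrDr [expR (dlt t) * y0 ^+ 3]mulrC lerD2l mulrCA -[leRHS]mulrA.
  apply: ler_wpM2l; first by rewrite divr_ge0 ?mulr_ge0 ?sqr_ge0.
  by rewrite -!expRD ler_expR; have := dltZ t; lra.
apply: (le_trans h); rewrite wED ?wEZ//; [|exact: wintZ..].
have h2 : expR (- y0 / 4) * E (fun t => expR (3 / 4 / 2 * Z t ^+ 2)) <= mass.
  apply: le_trans mge.
  apply: (@le_trans _ _ (expR (- y0 / 4) * expR (7 / 10 * p))).
    rewrite (ler_wpM2l (expR_ge0 _))//; apply: (le_trans lF); rewrite ler_expR.
    have -> : 1 - 3 / 4 = (2 ^+ 2)^-1 :> R by rewrite expr2; field.
    rewrite lnV ?posrE ?exprn_gt0// lnXn// mulrNN [ln 2 *+ 2]mulr2n.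
    have := ln2_le R => hl.
    have : p / 2 * (ln 2 + ln 2) <= p / 2 * (14 / 10) by rewrite ler_wpM2l//; lra.
    by lra.
  by rewrite -expRD ler_expR /y0; lra.
have m0 : 0 <= mass by apply: le_trans mge; exact: expR_ge0.
have h3 : 3 * y0 ^+ 2 / (1 / 4) * (expR (- y0 / 4) *
   E (fun t => expR (3 / 4 / 2 * Z t ^+ 2))) <= 3 * y0 ^+ 2 / (1 / 4) * mass.
  by rewrite ler_wpM2l// divr_ge0 ?mulr_ge0 ?sqr_ge0.
rewrite -[X in _ + X <= _]mulrA.
apply: (@le_trans _ _ ((y0 ^+ 3 + 3 * y0 ^+ 2 / (1 / 4)) * mass)).
  rewrite [leRHS]mulrDl; apply: lerD; last exact: h3.
  exact: lexx.
rewrite ler_wpM2r//.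
have -> : y0 ^+ 3 + 3 * y0 ^+ 2 / (1 / 4) =
  (33 / 10) ^+ 3 * p ^+ 3 + 12 * (33 / 10) ^+ 2 * p ^+ 2 by rewrite /y0; field.
have -> : (p + 1) ^+ 3 = p ^+ 3 + 3 * p ^+ 2 + 3 * p + 1 by ring.
have : 0 <= p ^+ 3 by exact: exprn_ge0.
have : 0 <= p ^+ 2 by exact: exprn_ge0.
lra.
Qed.

Let W := (p + 1) `^ (3 / 2).

Let W2 : W ^+ 2 = (p + 1) ^+ 3.
Proof.
have p1 : 0 <= p + 1 by have := p0; lra.
rewrite /W -powR_mulrn ?powR_ge0// -powRrM -powR_mulrn//.
by congr (_ `^ _); field.
Qed.

Let W1 : 1 <= W.
Proof.
have p1 : 1 <= p + 1 by have := p0; lra.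
by apply: (le_trans p1); apply: le1r_powR => //; lra.
Qed.

Lemma mgf_lin tau :
  In (fun t => expR (tau * L t)) /\ E (fun t => expR (tau * L t)) <= expR (tau ^+ 2 / 2).
Proof.
have [||||i l] := @mgf 1 0 tau; rewrite ?mul0r ?ltr01 ?lexx//; first by left.
have eF : (fun t => expR (tau * L t + 0 / 2 * Z t ^+ 2)) =1 (fun t => expR (tau * L t)).
  by move=> t; rewrite !mul0r addr0.
split; first exact: eq_wint i.
rewrite -(eq_wE _ _ eF) (le_trans l)// mul0r subr0 ln1 mulr0 add0r.
by rewrite mulr1.
Qed.

Let mass0 : 0 < mass.
Proof. by apply: lt_le_trans mass_ge; exact: expR_gt0. Qed.

(* Donsker-Varadhan in its pointwise form [e^b (1 + v - b) <= e^v] bounds half the squared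
   tilted mean of [L] by the relative entropy, which is then bounded by second moments
   of the tilt. *)
Lemma tilted_mean_le :
  `|E (fun t => L t * expR (dlt t))| <= mass * (25 / 12 * w * W).
Proof.
have w0' := w0.
pose c := ln mass; pose q t := expR (dlt t - c).
have ec : expR c = mass by rewrite lnK// posrE.
have qE t : q t = mass^-1 * expR (dlt t).
  by rewrite /q expRD expRN ec mulrC.
have mq : measurable_fun setT q.
  by apply: measurableT_comp => //; apply: measurable_funB => //; exact: measurable_cst.
have q0 t : 0 <= q t by exact: expR_ge0.
have qb t : q t <= expR (bd - c).
  by rewrite ler_expR lerD2r (le_trans (ler_norm _) (normr_dlt_le t)).
have bd0 : 0 <= bd by rewrite /bd divr_ge0// mulr_ge0// exprn_ge0// ltW.
have dlt2 t : dlt t ^+ 2 <= bd ^+ 2.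
  by rewrite -[dlt t ^+ 2]real_normK ?num_real// ler_pXn2r ?nnegrE// normr_dlt_le.
have iq : In q.
  by apply: (@wint_bounded _ (expR (bd - c))) => // t; rewrite ger0_norm.
have Eq : E q = 1.
  rewrite (eq_wE _ _ qE) wEZ; last exact: int_expdlt.
  by rewrite mulVf// gt_eqF.
have id1 : In dlt by apply: (@wint_bounded _ bd) => //; exact: normr_dlt_le.
have id2 : In (fun t => dlt t ^+ 2).
  apply: (@wint_bounded _ (bd ^+ 2)); first exact: measurable_funX.
  by move=> t; rewrite ger0_norm ?sqr_ge0.
have iqd : In (fun t => q t * dlt t).
  apply: (@wint_bounded _ (expR (bd - c) * bd)); first exact: measurable_funM.
  move=> t; rewrite normrM ger0_norm//; apply: ler_pM => //.
  exact: normr_dlt_le.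
have iqd2 : In (fun t => q t * dlt t ^+ 2).
  apply: (@wint_bounded _ (expR (bd - c) * bd ^+ 2)).
    by apply: measurable_funM => //; exact: measurable_funX.
  move=> t; rewrite (ger0_norm (mulr_ge0 (q0 t) (sqr_ge0 _))).
  by apply: ler_pM => //; exact: sqr_ge0.
have iqL : In (fun t => q t * L t).
  apply: (wint_le mg _ _ (wintZ (expR (bd - c)) int_normL)).
    exact: measurable_funM.
  by move=> t; rewrite normrM ger0_norm// ler_wpM2r.
(* As [q] is a probability density relative to [E], [a - c] is its relative entropy and [c - m0] the
   entropy in the reverse direction. *)
pose a := E (fun t => q t * dlt t); pose v1 := E (fun t => q t * dlt t ^+ 2).
pose m0 := E dlt; pose v0 := E (fun t => dlt t ^+ 2).
pose ell := E (fun t => q t * L t).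
have dv tau : tau * ell - tau ^+ 2 / 2 <= a - c.
  have [iL lL] := mgf_lin tau.
  have : E (fun t => tau * (q t * L t) + - (tau ^+ 2 / 2) * q t) <=
         E (fun t => (q t * dlt t + - (c + 1) * q t) +
                     expR (- (tau ^+ 2 / 2)) * expR (tau * L t)).
    apply: le_wE => //.
    - by apply: wintD; exact: wintZ.
    - by apply: wintD; [apply: wintD => //|]; exact: wintZ.
    move=> t; rewrite -expRD.
    pose b := dlt t - c; pose v := - (tau ^+ 2 / 2) + tau * L t.
    have : q t * (1 + (v - b)) <= expR v.
      rewrite -[v in leRHS](subrKC b) expRD ler_wpM2l//; exact: expR_ge1Dx.
    rewrite /v /b; lra.
  rewrite wED; [|exact: wintZ..]; rewrite [leRHS]wED; last first.
    exact: wintZ.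
    by apply: wintD => //; exact: wintZ.
  rewrite [X in _ <= X + _]wED//; last exact: wintZ.
  rewrite !wEZ// Eq mulr1 mulr1 -/ell -/a => h.
  have : expR (- (tau ^+ 2 / 2)) * E (fun t => expR (tau * L t)) <= 1.
    apply: (@le_trans _ _ (expR (- (tau ^+ 2 / 2)) * expR (tau ^+ 2 / 2))).
      by rewrite ler_wpM2l ?expR_ge0.
    by rewrite -expRD addNr expR0.
  lra.
have ac : 0 <= a - c.
  by have := dv 0; rewrite mul0r expr0n/= mul0r subr0.
have m0c : m0 <= c.
  have : E (fun t => mass * dlt t + mass * (1 - c)) <= E (fun t => expR (dlt t)).
    have ik : In (fun=> mass * (1 - c)).
      by exact: (@wint_bounded _ `|mass * (1 - c)|).
    apply: le_wE => //; first by apply: wintD => //; exact: wintZ.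
    move=> t; rewrite -mulrDr -[dlt t in leRHS](subrKC c) expRD ec.
    by rewrite ler_wpM2l ?(ltW mass0)//; have := expR_ge1Dx (dlt t - c); lra.
  rewrite wED; [|exact: wintZ|by exact: (@wint_bounded _ `|mass * (1 - c)|)].
  rewrite wEZ// wE_cst -/m0 -/mass -mulrDr -[leRHS]mulr1 ler_pM2l//; lra.
(* The symmetrized entropy [a - m0] is the mean of [(q t - 1) * (dlt t - c)], to which the
   trapezoidal bound applies pointwise. *)
have trap : a - m0 <= (v1 - 2 * c * a + c ^+ 2 + (v0 - 2 * c * m0 + c ^+ 2)) / 2.
  have i1 : In (fun t => - dlt t) by apply: eq_wint (wintZ (-1) id1) => t; rewrite mulN1r.
  have i2 : In (fun t => q t * dlt t + - c * q t) by apply: wintD => //; exact: wintZ.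
  have i3 : In (fun=> c) by exact: (@wint_bounded _ `|c|).
  have i3' : In (fun=> c ^+ 2) by exact: (@wint_bounded _ `|c ^+ 2|).
  have i4 : In (fun t => -1 * dlt t + c) by apply: wintD => //; exact: wintZ.
  have i5 : In (fun t => q t * dlt t ^+ 2 + (- (2 * c) * (q t * dlt t) + c ^+ 2 * q t)).
    by apply: wintD => //; apply: wintD; exact: wintZ.
  have i6 : In (fun t => dlt t ^+ 2 + (- (2 * c) * dlt t + c ^+ 2)).
    by apply: wintD => //; apply: wintD => //; exact: wintZ.
  have : E (fun t => (q t * dlt t + - c * q t) + (-1 * dlt t + c)) <=
    E (fun t => 2^-1 * ((q t * dlt t ^+ 2 + (- (2 * c) * (q t * dlt t) + c ^+ 2 * q t))
      + (dlt t ^+ 2 + (- (2 * c) * dlt t + c ^+ 2)))).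
    apply: le_wE => //; [exact: wintD|by apply: wintZ; exact: wintD|] => t.
    have := expR_trapezoid (dlt t - c); rewrite -/(q t); lra.
  have -> : E (fun t => (q t * dlt t + - c * q t) + (-1 * dlt t + c)) =
      (a + - c * 1) + (-1 * m0 + c).
    rewrite wED// wED//; last exact: wintZ.
    rewrite [E (fun t => -1 * dlt t + c)]wED//; last exact: wintZ.
    by rewrite !wEZ// Eq wE_cst.
  rewrite wEZ; last exact: wintD.
  rewrite wED//.
  have -> : E (fun t => q t * dlt t ^+ 2 + (- (2 * c) * (q t * dlt t) + c ^+ 2 * q t)) =
      v1 + (- (2 * c) * a + c ^+ 2 * 1).
    rewrite wED//; last by apply: wintD; exact: wintZ.
    by rewrite wED; [|exact: wintZ..]; rewrite !wEZ// Eq.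
  have -> : E (fun t => dlt t ^+ 2 + (- (2 * c) * dlt t + c ^+ 2)) =
      v0 + (- (2 * c) * m0 + c ^+ 2).
    rewrite wED//; last by apply: wintD => //; exact: wintZ.
    by rewrite wED//; [rewrite wEZ// wE_cst|exact: wintZ].
  lra.
have va : a ^+ 2 <= v1.
  have : 0 <= E (fun t => q t * dlt t ^+ 2 + (- (2 * a) * (q t * dlt t) + a ^+ 2 * q t)).
    apply: wE_ge0 => // t.
    have -> : q t * dlt t ^+ 2 + (- (2 * a) * (q t * dlt t) + a ^+ 2 * q t) =
              q t * (dlt t - a) ^+ 2 by ring.
    by rewrite mulr_ge0 ?sqr_ge0.
  rewrite wED//; last by apply: wintD; exact: wintZ.
  rewrite wED; [|exact: wintZ..]; rewrite !wEZ// Eq -/a -/v1; lra.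
have vm : m0 ^+ 2 <= v0.
  have i3 : In (fun=> m0 ^+ 2) by exact: (@wint_bounded _ `|m0 ^+ 2|).
  have : 0 <= E (fun t => dlt t ^+ 2 + (- (2 * m0) * dlt t + m0 ^+ 2)).
    apply: wE_ge0 => // t.
    have -> : dlt t ^+ 2 + (- (2 * m0) * dlt t + m0 ^+ 2) = (dlt t - m0) ^+ 2 by ring.
    exact: sqr_ge0.
  rewrite wED//; last by apply: wintD => //; exact: wintZ.
  rewrite wED//; last exact: wintZ.
  rewrite wEZ// wE_cst -/m0 -/v0; lra.
(* First [a - c <= a - m0]. In [trap] the cross term [c ^+ 2 - c * a - c * m0] is at most
   [(a ^+ 2 + m0 ^+ 2) / 2] because [m0 <= c <= a], and [va], [vm] absorb these squares. *)
have kl : a - c <= v0 + v1.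
  have h : c ^+ 2 - c * a - c * m0 <= (a ^+ 2 + m0 ^+ 2) / 2.
    have sq := sqr_ge0 (a + m0); have sq' := sqr_ge0 (a - m0).
    have := sqr_ge0 a; have := sqr_ge0 m0.
    case: (lerP 0 c) => c0.
      have h1 : 0 <= c * (a - c) by rewrite mulr_ge0.
      case: (lerP 0 m0) => mm.
        by have : 0 <= c * m0 := mulr_ge0 c0 mm; lra.
      have : 0 <= (a - c) * - m0 by rewrite mulr_ge0//; lra.
      lra.
    have h1 : 0 <= - c * (c - m0) by rewrite mulr_ge0//; lra.
    case: (lerP 0 a) => aa; last first.
      have : 0 <= - c * - a by rewrite mulr_ge0//; lra.
      lra.
    have : 0 <= (c - m0) * a by rewrite mulr_ge0//; lra.
    lra.
  lra.
have ell2 : ell ^+ 2 <= 2 * (v0 + v1).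
  have := dv ell; lra.
have dlt6 t : dlt t ^+ 2 <= w ^+ 2 / 36 * Z t ^+ 6.
  rewrite -[dlt t ^+ 2]real_normK ?num_real//.
  have -> : w ^+ 2 / 36 * Z t ^+ 6 = (w * Z t ^+ 3 / 6) ^+ 2 by field.
  rewrite ler_pXn2r ?nnegrE ?normr_dlt_cube//.
  by rewrite divr_ge0// mulr_ge0// exprn_ge0.
have w2 : 0 <= w ^+ 2 / 36 by rewrite divr_ge0 ?sqr_ge0.
have v0_le : v0 <= w ^+ 2 / 36 * (28 * W ^+ 2).
  apply: (@le_trans _ _ (E (fun t => w ^+ 2 / 36 * Z t ^+ 6))).
    by apply: le_wE => //; apply: wintZ; exact: int_pow6.
  rewrite wEZ; last exact: int_pow6.
  by rewrite ler_wpM2l// W2 wE_pow6_le.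
have v1_le : v1 <= w ^+ 2 / 36 * (50 * W ^+ 2).
  apply: (@le_trans _ _ (E (fun t => w ^+ 2 / 36 * mass^-1 * (expR (dlt t) * Z t ^+ 6)))).
    apply: le_wE => //; first by apply: wintZ; exact: int_expdlt_pow6.
    move=> t; rewrite qE.
    have -> : w ^+ 2 / 36 * mass^-1 * (expR (dlt t) * Z t ^+ 6) =
      mass^-1 * expR (dlt t) * (w ^+ 2 / 36 * Z t ^+ 6) by ring.
    by rewrite ler_wpM2l// -qE.
  rewrite wEZ; last exact: int_expdlt_pow6.
  rewrite -mulrA ler_wpM2l// mulrC ler_pdivrMr// W2; exact: tilted_pow6_le.
have ellE : E (fun t => L t * expR (dlt t)) = mass * ell.
  rewrite -wEZ//; apply: eq_wE => t; rewrite qE; field.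
  by rewrite gt_eqF.
rewrite ellE normrM gtr0_norm// ler_pM2l//.
have WW : 0 <= 25 / 12 * w * W by rewrite mulr_ge0 ?mulr_ge0// (le_trans ler01 W1).
rewrite -(@ler_pXn2r _ 2%N) ?nnegrE// real_normK ?num_real//.
(* The comparison is [2 * (28 + 50) / 36 = 13 / 3] against [(25 / 12) ^+ 2 = 625 / 144]. *)
have : 0 <= w ^+ 2 * W ^+ 2 by rewrite mulr_ge0 ?sqr_ge0.
have -> : (25 / 12 * w * W) ^+ 2 = 625 / 144 * (w ^+ 2 * W ^+ 2) by field.
lra.
Qed.

(** * Contribution of the region [Z > r] *)

Let tail t : R := if Z t <= r then 0 else `|L t| * expR (Num.max (dl t) 0).

Let tail0 t : 0 <= tail t.
Proof. by rewrite /tail; case: ifP => // _; rewrite mulr_ge0 ?expR_ge0. Qed.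

Let mtail : measurable_fun setT tail.
Proof.
apply: measurable_fun_ifT => //.
apply: measurable_funM; first exact: measurableT_comp.
by apply: measurableT_comp => //; exact: measurable_maxr.
Qed.

(** With [dl <= Z ^+ 2 / 2] as the only control, decay needs a Laplace parameter above [1]. Since
    [lam = 1 / 4] dominates [p], [mu = 2] is available: half of the exponent pays for [dl], the
    other half yields [expR (- r ^+ 2 / 2)]. *)
Lemma tail_le_of_small : p <= 1 / 4 ->
  In tail /\ E tail <= 2 * expR 2 * expR (- s ^+ 2 / 2).
Proof.
move=> p4; have p0' := p0.
have [||||| iF lF] := @mgf_normr (1 / 4) 2 1; [lra|by right|lra|lra|lra|].
have tF t : tail t <= expR (- r ^+ 2 / 2) * (`|L t| * expR (2 / 2 * Z t ^+ 2)).
  rewrite /tail; case: (lerP (Z t) r) => Zr.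
    by rewrite mulr_ge0 ?expR_ge0// mulr_ge0 ?expR_ge0.
  rewrite mulrCA ler_wpM2l// -expRD ler_expR.
  have : r ^+ 2 <= Z t ^+ 2 by rewrite ler_pXn2r ?nnegrE ?(ltW r0) ?(ltW Zr).
  have := dl_le t => h1 h2.
  by rewrite ge_max; apply/andP; split; have := sqr_ge0 r; lra.
have it : In tail.
  by apply: (wint_le mg mtail _ (wintZ (expR (- r ^+ 2 / 2)) iF)) => t; rewrite ger0_norm.
split => //; apply: (le_trans (le_wE g0 it (wintZ _ iF) tF)); rewrite wEZ//.
rewrite mulrC; apply: ler_pM; rewrite ?expR_ge0//.
- by apply: wE_ge0 => // t; rewrite mulr_ge0 ?expR_ge0.
- apply: (le_trans lF); rewrite divr1 ler_wpM2l// ler_expR.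
  have -> : 1 - 2 * (1 / 4) = 2^-1 :> R by field.
  rewrite lnV ?posrE//; have := ln2_le R => h2.
  have : 2 * p * ln 2 <= 2 * p * (7 / 10) by rewrite ler_wpM2l//; lra.
  lra.
- by rewrite ler_expR; have := r2_ge; lra.
Qed.

(** [mu] is the Chernoff optimum for [Z >= r + y]. The square [y ^+ 2 / 2] of the tangent bound
    cancels against [(r + y) ^+ 2 / 2], so that a gain linear in [y] remains: with [w * r <= 3 / 4],
    [2 * Num.sqrt p <= r] and [1 <= r] it is at least [y / 4]. Half of it absorbs the prefactor
    [2 / tau], which grows with [y]. *)
Lemma shell_le (y : R) : 1 / 4 <= p -> 0 <= y ->
  let mu := 1 - p / (r + y) ^+ 2 in
  let a := expR ((y + 1 / 8) ^+ 2 / 2 + w * r ^+ 3 / 6 + w * r ^+ 2 * (y + 1 / 8) / 2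
                 - mu * (r + y) ^+ 2 / 2) in
  In (fun t => `|L t| * expR (mu / 2 * Z t ^+ 2)) /\
  a * E (fun t => `|L t| * expR (mu / 2 * Z t ^+ 2)) <=
  32 * r * expR (1 + w * r ^+ 3 / 6 + w * r ^+ 2 / 16 - 4 / 5 * p
                 - 3 / 2 * Num.sqrt p * s - s ^+ 2 / 2) * expR (- y / 8).
Proof.
move=> p4 y0 mu a; have p0' := p0; have s0' := s0; have w0' := w0; have wr' := wr.
have r0' := r0; have sp2' := sp2; have sps' := sps.
set sg := Num.sqrt p in sp2' sps' *.
have sg2 : 1 / 2 <= sg.
  case: (lerP (1 / 2) sg) => // h.
  have : 0 <= sg * (1 / 2 - sg) by rewrite mulr_ge0 ?sqrtr_ge0//; lra.
  by rewrite mulrBr sp2'; lra.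
have rE : r = 2 * sg + s by [].
pose M := r + y; have M0 : 0 < M by rewrite /M; lra.
have rM : r <= M by rewrite /M; lra.
have Mn : M != 0 by rewrite gt_eqF.
have pM : p / M ^+ 2 < 1.
  rewrite ltr_pdivrMr ?exprn_gt0// mul1r.
  have : r ^+ 2 <= M ^+ 2 by rewrite ler_pXn2r ?nnegrE ?(ltW r0) ?(ltW M0).
  have := sqr_ge0 s; have := r2_ge; lra.
have pM0 : 0 < p / M ^+ 2 by rewrite divr_gt0 ?exprn_gt0//; lra.
(* The choice [tau = sg / M] makes the exponent coming from [tau] equal to [1 / 2]. *)
have [||||| iF lF] := @mgf_normr 1 mu (sg / M).
- by rewrite ltr01 lexx.
- by left.
- by rewrite /mu -/M; lra.
- by rewrite /mu -/M; lra.
- by rewrite divr_gt0//; lra.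
split => //.
have a0 : 0 <= a by exact: expR_ge0.
apply: (le_trans (ler_wpM2l a0 lF)).
have muE : 1 - mu * 1 = p / M ^+ 2 by rewrite /mu -/M; ring.
rewrite muE !mulr1.
have -> : 2 / (sg / M) = 2 * M / sg by field; lra.
have -> : (sg / M) ^+ 2 / (2 * (p / M ^+ 2)) = 1 / 2.
  by rewrite -sp2'; field; lra.
(* The logarithm of [M / sg] is linearized at [M = 2 * sg], which is the value of [r] without
   [s]. *)
have lnb : - (p / 2) * ln (p / M ^+ 2) <= 7 / 10 * p + sg * M / 2 - p.
  have -> : p / M ^+ 2 = ((M / sg) ^+ 2)^-1 by rewrite -sp2'; field; lra.
  have Ms : 0 < M / sg by rewrite divr_gt0//; lra.
  rewrite lnV ?posrE ?exprn_gt0// lnXn// mulrNN.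
  rewrite (_ : p / 2 * (ln (M / sg) *+ 2) = p * ln (M / sg)); last first.
    by rewrite -[ln (M / sg) *+ 2]mulr_natr; field.
  have -> : M / sg = 2 * (1 + (M / (2 * sg) - 1)) by field; lra.
  have h : -1 < M / (2 * sg) - 1.
    have : 0 < M / (2 * sg) by rewrite divr_gt0//; lra.
    lra.
  rewrite lnM ?posrE//; last by lra.
  have h1 := le_ln1Dx h; have h2 := ln2_le R.
  have : p * (ln 2 + ln (1 + (M / (2 * sg) - 1))) <=
         p * (7 / 10 + (M / (2 * sg) - 1)) by rewrite ler_wpM2l//; lra.
  have -> : p * (7 / 10 + (M / (2 * sg) - 1)) = 7 / 10 * p + sg * M / 2 - p.
    by rewrite -sp2'; field; lra.
  by [].
have prefac : 2 * M / sg <= 32 * r * expR (y / 8).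
  have h1 : 2 * M / sg <= 4 * M.
    rewrite ler_pdivrMr; last by lra.
    have : 0 <= M * (sg - 1 / 2) by rewrite mulr_ge0 ?(ltW M0)//; lra.
    lra.
  apply: (le_trans h1); have e := expR_ge1Dx (y / 8).
  have : 32 * r * (1 + y / 8) <= 32 * r * expR (y / 8) by rewrite ler_wpM2l//; lra.
  have : 0 <= (r - 1) * y by rewrite mulr_ge0//; lra.
  rewrite /M; lra.
rewrite mulrCA.
apply: (@le_trans _ _ (32 * r * expR (y / 8) *
   expR (1 + w * r ^+ 3 / 6 + w * r ^+ 2 / 16 - 4 / 5 * p
                 - 3 / 2 * sg * s - s ^+ 2 / 2 - y / 4))); last first.
  rewrite -!mulrA ler_wpM2l// ler_wpM2l ?(ltW r0)// -!expRD ler_expR; lra.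
apply: ler_pM => //.
- by rewrite divr_ge0 ?mulr_ge0 ?(ltW M0)//; lra.
- by rewrite mulr_ge0 ?expR_ge0.
rewrite -expRD ler_expR.
have -> : mu * (r + y) ^+ 2 / 2 = (M ^+ 2 - p) / 2 by rewrite /mu -/M; field.
have h1 : w * r * r * y <= 3 / 4 * r * y by do 2 rewrite ler_wpM2r ?(ltW r0)//.
have h2 : 0 <= (r - 2 * sg) * y by rewrite mulr_ge0//; lra.
have h3 : 0 <= (r - 1) * y by rewrite mulr_ge0//; lra.
(* At [y = 0] the coefficient of [p] is [- 2 + 1 / 2 + 7 / 10 - 1 + 1 = - 4 / 5], and that of
   [sg * s] is [- 2 + 1 / 2 = - 3 / 2]. *)
have h4 : r ^+ 2 = 4 * p + 4 * sg * s + s ^+ 2 := r2E.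
have h5 : sg * r = 2 * p + sg * s by rewrite rE -sp2'; ring.
rewrite /M in lnb *; lra.
Qed.

Lemma tail_le_of_large : 1 / 4 <= p ->
  In tail /\ E tail <= 32 / (1 - expR (- (1 / 64))) * r *
    expR (1 + w * r ^+ 3 / 6 + w * r ^+ 2 / 16 - 4 / 5 * p
          - 3 / 2 * Num.sqrt p * s - s ^+ 2 / 2).
Proof.
move=> p4; have r0' := r0; have w0' := w0.
pose y (k : nat) : R := k%:R / 8.
have y0 k : 0 <= y k by rewrite divr_ge0.
pose mu k := 1 - p / (r + y k) ^+ 2.
pose a k := expR ((y k + 1 / 8) ^+ 2 / 2 + w * r ^+ 3 / 6 +
   w * r ^+ 2 * (y k + 1 / 8) / 2 - mu k * (r + y k) ^+ 2 / 2).
pose c := 32 * r * expR (1 + w * r ^+ 3 / 6 + w * r ^+ 2 / 16 - 4 / 5 * p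
                 - 3 / 2 * Num.sqrt p * s - s ^+ 2 / 2).
pose q := expR (- (1 / 64) : R).
have q1 : 0 < q < 1 by rewrite expR_gt0 expR_lt1; lra.
have c0 : 0 <= c by rewrite mulr_ge0 ?expR_ge0 ?mulr_ge0 ?(ltW r0).
have mu0 k : 0 <= mu k.
  have ry : 0 < r + y k by rewrite ltr_pwDl.
  rewrite /mu subr_ge0 ler_pdivrMr ?exprn_gt0// mul1r.
  have : r ^+ 2 <= (r + y k) ^+ 2.
    by rewrite ler_pXn2r ?nnegrE ?(ltW ry) ?(ltW r0)// lerDl.
  have := r2_ge; have := sqr_ge0 s; have := p0; lra.
have wr2 : 0 <= w * r ^+ 2 by rewrite mulr_ge0 ?sqr_ge0.
have wr3 : 0 <= w * r ^+ 3 by rewrite mulr_ge0// exprn_ge0// ltW.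
pose Fk k t := a k * (`|L t| * expR (mu k / 2 * Z t ^+ 2)).
have Fk0 k t : 0 <= Fk k t.
  by rewrite mulr_ge0 ?expR_ge0// mulr_ge0 ?expR_ge0.
have tF t : exists k, tail t <= Fk k t.
  rewrite /Fk /tail; case: (lerP (Z t) r) => Zr.
    by exists 0%N; rewrite mulr_ge0 ?expR_ge0// mulr_ge0 ?expR_ge0.
  have z0 : 0 <= (Z t - r) * 8 by rewrite mulr_ge0 ?subr_ge0 ?(ltW Zr).
  exists (Num.truncn ((Z t - r) * 8)); set k := Num.truncn _.
  have /andP[k1 k2] := truncn_itv z0; rewrite -/k in k1 k2.
  have ky : y k <= Z t - r by rewrite /y ler_pdivrMr.
  have ky' : Z t - r <= y k + 1 / 8.
    by move: k2; rewrite -[k.+1%:R]natr1 /y; lra.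
  rewrite mulrCA ler_wpM2l// /a -expRD ler_expR.
  have hZ : (r + y k) ^+ 2 <= Z t ^+ 2.
    have ry : 0 <= r + y k by rewrite addr_ge0 ?(ltW r0).
    rewrite ler_pXn2r ?nnegrE ?ry ?Z0//; lra.
  have h1 : mu k * (r + y k) ^+ 2 <= mu k * Z t ^+ 2 by rewrite ler_wpM2l.
  have h2 : (Z t - r) ^+ 2 <= (y k + 1 / 8) ^+ 2.
    by rewrite ler_pXn2r ?nnegrE ?subr_ge0 ?(ltW Zr)// addr_ge0.
  have h3 : w * r ^+ 2 * (Z t - r) <= w * r ^+ 2 * (y k + 1 / 8) by rewrite ler_wpM2l.
  have h4 : 0 <= w * r ^+ 2 * (y k + 1 / 8) by rewrite mulr_ge0// addr_ge0.
  have := dl_out Zr; have := sqr_ge0 (y k + 1 / 8); have := sqr_ge0 (Z t).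
  by rewrite ge_max => *; apply/andP; split; lra.
have iF k : wint m g (Fk k) by apply: wintZ; have [] := shell_le p4 (y0 k).
have lF k : wE m g (Fk k) <= c * q ^+ k.
  have [i l] := shell_le p4 (y0 k).
  rewrite wEZ//; apply: (le_trans l); rewrite -/c ler_wpM2l//.
  by rewrite /q -expRM_natl ler_expR /y; lra.
have [iT lT] := wE_le_geometric mg g0 mtail tail0 Fk0 tF iF c0 q1 lF.
split => //; apply: (le_trans lT); rewrite /c /q.
by rewrite mulrAC [32 * r / _]mulrAC.
Qed.

Let core_le_mass : core <= E (fun t => expR (dl t)).
Proof.
apply: le_wE => //; last by move=> t; case: ifP => _ //; exact: expR_ge0.
apply: (@wint_le _ _ _ _ _ mg _ (fun t => expR (dl t))) => //.
  by apply: measurable_fun_ifT => //; exact: measurableT_comp.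
by move=> t; case: ifP => _; rewrite ?normr0 ?expR_ge0// ger0_norm ?expR_ge0.
Qed.

Let int_Ldlt : In (fun t => L t * expR (dlt t)).
Proof.
apply: (wint_le mg _ _ (wintZ (expR bd) int_normL)).
  by apply: measurable_funM => //; exact: measurableT_comp.
by move=> t; rewrite normrM (ger0_norm (expR_ge0 _)) mulrC ler_wpM2r.
Qed.

(** Beyond [r] the two tilts differ by [expR (dl t) - 1], whose absolute value is at most
    [expR (Num.max (dl t) 0)]; hence the maximum in [tail]. *)
Lemma tilt_split : In tail ->
  `|E (fun t => L t * expR (dl t))| <= `|E (fun t => L t * expR (dlt t))| + E tail.
Proof.
move=> it; pose F t := L t * expR (dl t) + -1 * (L t * expR (dlt t)).
have iF : In F by apply: wintD => //; exact: wintZ.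
have -> : E (fun t => L t * expR (dl t)) = E (fun t => L t * expR (dlt t)) + E F.
  by rewrite /F wED// ?wEZ//; [ring|exact: wintZ].
apply: (le_trans (ler_normD _ _)); rewrite lerD2l.
apply: (le_trans (normr_wE g0 iF)); apply: le_wE => //; first exact: wint_normr.
move=> t; rewrite /F /tail /dlt; case: (lerP (Z t) r) => Zr.
  by rewrite mulN1r subrr normr0.
rewrite expR0 mulr1 mulN1r -[X in _ - X]mulr1 -mulrBr normrM ler_wpM2l//.
have e0 := expR_gt0 (dl t).
have e1 : expR (dl t) <= expR (Num.max (dl t) 0) by rewrite ler_expR le_max lexx.
have e2 : 1 <= expR (Num.max (dl t) 0).
  by rewrite -[leLHS](@expR0 R) ler_expR le_max lexx orbT.
by rewrite ler_norml; apply/andP; split; lra.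
Qed.

(* [K] sums the geometric series of the shells of width [1 / 8].  Below the radius [B]
   everything is bounded and crude estimates suffice; above it, the tail is compared
   with [w * W] or with [expR (- s ^+ 2 / 2)]. *)
Let K : R := 32 / (1 - expR (- (1 / 64))).
Let B : R := 80 + 7 * 64 ^+ 3 * K.

Let K0 : 0 <= K.
Proof.
rewrite /K divr_ge0// subr_ge0 -[leRHS](@expR0 R) ler_expR; lra.
Qed.

Let sg_le : 2 * Num.sqrt p <= 1 + p.
Proof.
have := sqr_ge0 (Num.sqrt p - 1).
have -> : (Num.sqrt p - 1) ^+ 2 = Num.sqrt p * Num.sqrt p - 2 * Num.sqrt p + 1 by ring.
by rewrite sp2; lra.
Qed.

Lemma tail_le_core : B <= r ->
  In tail /\ E tail <= core * (17 / 80 * w * W + (3 + 3 * K) * expR 2 * expR (- s ^+ 2 / 2)).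
Proof.
move=> Br; have p0' := p0; have s0' := s0; have w0' := w0; have wr' := wr; have r0' := r0.
have cg := core_ge; have K0' := K0; have B80 : 80 <= B by rewrite /B lerDl ?mulr_ge0 ?exprn_ge0.
have B8 : 8 <= B by lra.
have wW0 : 0 <= 17 / 80 * w * W by rewrite !mulr_ge0// (le_trans ler01).
have Ke0 : 0 <= 3 * K * expR 2 * expR (- s ^+ 2 / 2) by rewrite !mulr_ge0 ?expR_ge0.
have c0 : 0 < core.
  by apply: lt_le_trans cg; rewrite mulr_gt0 ?expR_gt0.
case: (lerP p (1 / 4)) => p4.
  have [i l] := tail_le_of_small p4; split => //; apply: (le_trans l).
  have c7 : 7 / 10 <= core.
    by have := expR_ge1Dx (- p / 6); lra.
  have e0 : 0 <= expR 2 * expR (- s ^+ 2 / 2) by rewrite mulr_ge0 ?expR_ge0.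
  apply: (@le_trans _ _ (7 / 10 * (3 * expR 2 * expR (- s ^+ 2 / 2)))).
    by rewrite -!mulrA; move: e0; set e := expR 2 * _; lra.
  apply: ler_pM; [by []|by rewrite !mulr_ge0 ?expR_ge0|exact: c7|].
  lra.
have [i l] := tail_le_of_large (ltW p4); split => //; apply: (le_trans l); rewrite -/K.
set X := 1 + w * r ^+ 3 / 6 + w * r ^+ 2 / 16 - 4 / 5 * p
          - 3 / 2 * Num.sqrt p * s - s ^+ 2 / 2.
have sps' := sps; have sp2' := sp2; have sg_le' := sg_le.
have sg2 : 1 / 2 <= Num.sqrt p.
  case: (lerP (1 / 2) (Num.sqrt p)) => // h.
  have : 0 <= Num.sqrt p * (1 / 2 - Num.sqrt p) by rewrite mulr_ge0 ?sqrtr_ge0//; lra.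
  by rewrite mulrBr sp2'; lra.
have sgs : 1 / 2 * s <= Num.sqrt p * s by rewrite ler_wpM2r// ltW.
(* [core_ge] turns an absolute bound into one relative to [core], at the price [expR (p / 6)]. *)
have red Y : r * expR (X + p / 6) <= Y -> K * r * expR X <= core * (4 / 3 * K * Y).
  move=> h; apply: (@le_trans _ _ (3 / 4 * expR (- p / 6) * (4 / 3 * K * Y))).
    have : K * (expR (- p / 6) * (r * expR (X + p / 6))) <= K * (expR (- p / 6) * Y).
      by rewrite !ler_wpM2l ?expR_ge0.
    have -> : expR (- p / 6) * (r * expR (X + p / 6)) = r * expR X.
      by rewrite mulrCA -expRD; congr (_ * expR _); field.
    lra.
  apply: (ler_wpM2r _ cg); apply: mulr_ge0; first by rewrite mulr_ge0.
  by apply: le_trans h; rewrite mulr_ge0 ?expR_ge0 ?(ltW r0).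
have [wr6|wr6] := lerP (w * r ^+ 3) 6.
  have w2 : w * r ^+ 2 <= 1.
    have : 8 * (w * r ^+ 2) <= r * (w * r ^+ 2).
      rewrite ler_wpM2r//; first by rewrite mulr_ge0 ?sqr_ge0.
      exact: le_trans B8 Br.
    have -> : r * (w * r ^+ 2) = w * r ^+ 3 by ring.
    lra.
  apply: (le_trans (red (5 / 3 * expR 2 * expR (1 / 16) * expR (- s ^+ 2 / 2)) _)).
    (* The prefactor satisfies [r <= 1 + p + s]; it is absorbed by the decay in [p] and [s] left in
       [X + p / 6]. *)
    have h : r * (expR (3 / 5 * (p + s)))^-1 <= 5 / 3.
      rewrite ler_pdivrMr ?expR_gt0//.
      have := expR_ge1Dx (3 / 5 * (p + s)); rewrite /r; lra.
    apply: (@le_trans _ _ (r * (expR (3 / 5 * (p + s)))^-1 *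
        (expR 2 * expR (1 / 16) * expR (- s ^+ 2 / 2)))).
      rewrite -mulrA ler_wpM2l ?(ltW r0)// -expRN -!expRD ler_expR /X; lra.
    have e0 : 0 <= expR 2 * expR (1 / 16) * expR (- s ^+ 2 / 2) by rewrite !mulr_ge0 ?expR_ge0.
    by apply: (le_trans (ler_wpM2r e0 h)); rewrite !mulrA.
  rewrite ler_pM2l//.
  have e16 : expR (1 / 16 : R) <= 16 / 15.
    rewrite -[1 / 16]opprK expRN -[16 / 15]invrK lef_pV2 ?posrE ?invf_div ?expR_gt0//.
    by have := expR_ge1Dx (- (1 / 16) : R); lra.
  have e0 : 0 <= K * (expR 2 * expR (- s ^+ 2 / 2)) by rewrite !mulr_ge0 ?expR_ge0.
  have : K * (expR 2 * expR (- s ^+ 2 / 2)) * expR (1 / 16) <=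
    K * (expR 2 * expR (- s ^+ 2 / 2)) * (16 / 15) by rewrite ler_wpM2l.
  have : 0 <= expR 2 * expR (- s ^+ 2 / 2) by rewrite !mulr_ge0 ?expR_ge0.
  have -> : (3 + 3 * K) * expR 2 * expR (- s ^+ 2 / 2) =
    3 * (expR 2 * expR (- s ^+ 2 / 2)) + 3 * (K * (expR 2 * expR (- s ^+ 2 / 2))) by ring.
  lra.
have r2n : r != 0 by rewrite gt_eqF.
(* Here [w > 6 / r ^+ 3], while the tail is at most [r * expR (- (r ^+ 2 / 64))]. The cubic term of
   the exponential series bounds the latter by [r ^- 5] up to a constant, and the two spare powers
   of [r] beat [K] once [B <= r]. *)
apply: (le_trans (red (6 * 64 ^+ 3 / r ^+ 5) _)).
  have XE : X + p / 6 <= - (r ^+ 2 / 64).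
    have h1 : w * r * r ^+ 2 <= 3 / 4 * r ^+ 2 by rewrite ler_wpM2r ?sqr_ge0.
    have h2 : w * r * r <= 3 / 4 * r by rewrite ler_wpM2r ?(ltW r0).
    have h3 : 80 * r <= r * r by rewrite ler_wpM2r ?(ltW r0)// (le_trans B80 Br).
    have h4 : r ^+ 2 = 4 * p + 4 * Num.sqrt p * s + s ^+ 2 := r2E.
    have := sqr_ge0 s; rewrite /X => h5.
    have -> : w * r ^+ 3 = w * r * r ^+ 2 by ring.
    have -> : w * r ^+ 2 = w * r * r by ring.
    have h6 : 6400 <= r ^+ 2 by rewrite expr2; have := le_trans B80 Br; lra.
    lra.
  have : (r ^+ 2 / 64) ^+ 3 / 6 <= expR (r ^+ 2 / 64).
    have h0 : 0 <= r ^+ 2 / 64 by rewrite divr_ge0 ?sqr_ge0.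
    apply: le_trans (expR_ge_series 4 h0).
    rewrite !big_nat_recr ?big_geq//= !factS fact0.
    have := sqr_ge0 (r ^+ 2 / 64); set v := r ^+ 2 / 64 in h0 *; lra.
  move=> h; apply: (@le_trans _ _ (r * expR (- (r ^+ 2 / 64)))).
    by rewrite ler_wpM2l ?(ltW r0)// ler_expR.
  rewrite expRN; apply: (@le_trans _ _ (r * ((r ^+ 2 / 64) ^+ 3 / 6)^-1)).
    by rewrite ler_wpM2l ?(ltW r0)// lef_pV2 ?posrE ?expR_gt0// ?divr_gt0 ?exprn_gt0 ?divr_gt0 ?exprn_gt0.
  rewrite le_eqVlt; apply/orP; left; apply/eqP; field; exact: r2n.
rewrite ler_pM2l//.
apply: (@le_trans _ _ (17 / 80 * w * W)); last first.
  have : 0 <= (3 + 3 * K) * expR 2 * expR (- s ^+ 2 / 2).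
    by rewrite !mulr_ge0 ?expR_ge0 ?addr_ge0 ?mulr_ge0.
  lra.
have w6 : 6 / r ^+ 3 <= w by rewrite ler_pdivrMr ?exprn_gt0// ltW.
apply: (@le_trans _ _ (17 / 80 * (6 / r ^+ 3))); last first.
  have : w <= w * W by rewrite ler_peMr.
  rewrite -[_ * _ * W]mulrA; lra.
have -> : 4 / 3 * K * (6 * 64 ^+ 3 / r ^+ 5) = 8 * 64 ^+ 3 * K / r ^+ 2 / r ^+ 3.
  by field; exact: r2n.
rewrite [17 / 80 * _]mulrA ler_wpM2r ?invr_ge0 ?exprn_ge0 ?(ltW r0)//.
rewrite ler_pdivrMr ?exprn_gt0//.
have : B * 8 <= r ^+ 2.
  by rewrite expr2; apply: ler_pM; rewrite ?(le_trans _ B8) ?(le_trans B8 Br).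
have : 0 <= 64 ^+ 3 * K by rewrite mulr_ge0 ?exprn_ge0.
rewrite /B -!mulrA; set k := 64 ^+ 3 * K; lra.
Qed.

Let bigC : R := 4 / 3 * expR (B ^+ 2) *
  (2 * expR (B ^+ 2 + 1) + 2 * expR 2 + K * B * expR (1 + B ^+ 2)) * expR (B ^+ 2).

(** Both [p] and [s] are bounded in terms of [B], so [core] and [expR (- s ^+ 2 / 2)] are bounded
    below and the whole mean is charged to the exponential error. *)
Lemma tilt_le_of_small : r <= B ->
  `|E (fun t => L t * expR (dl t))| <= core * (bigC * expR (- s ^+ 2 / 2)).
Proof.
move=> rB; have p0' := p0; have s0' := s0; have w0' := w0; have wr' := wr; have r0' := r0.
have K0' := K0; have B8 : 8 <= B.
  by have : 0 <= 7 * 64 ^+ 3 * K; [rewrite ?mulr_ge0 ?exprn_ge0|rewrite /B; lra].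
have sps' := sps.
have rB2 : r ^+ 2 <= B ^+ 2 by rewrite ler_pXn2r ?nnegrE ?(ltW r0)//; lra.
have pB : 4 * p <= B ^+ 2 by have := r2_ge; have := sqr_ge0 s; lra.
have sB : s ^+ 2 <= B ^+ 2 by have := r2_ge; lra.
have BB : 8 * B <= B ^+ 2 by rewrite expr2 ler_wpM2r//; lra.
have inner : `|E (fun t => L t * expR (dlt t))| <= 2 * expR (B ^+ 2 + 1).
  have [|||||iF lF] := @mgf_normr 1 (1 / 4) 1; [lra|by left|lra|lra|lra|].
  apply: (le_trans (normr_wE g0 int_Ldlt)).
  apply: (@le_trans _ _ (E (fun t => `|L t| * expR (1 / 4 / 2 * Z t ^+ 2)))).
    apply: le_wE => //; first exact: wint_normr.
    move=> t; rewrite normrM (ger0_norm (expR_ge0 _)) ler_wpM2l// ler_expR.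
    by have := normr_dlt_sqr t; rewrite ler_norml => /andP[_]; lra.
  apply: (le_trans lF); rewrite divr1 ler_wpM2l// ler_expR !mulr1.
  have h := @oppr_ln1B_le R (1 / 4) ltac:(lra).
  have : p / 2 * - ln (1 - 1 / 4) <= p / 2 * (1 / 4 / (1 - 1 / 4)).
    by rewrite ler_wpM2l//; lra.
  have -> : (1 / 4) / (1 - 1 / 4) = 1 / 3 :> R by field.
  have -> : 1 ^+ 2 / (2 * (1 - 1 / 4)) = 2 / 3 :> R by field.
  lra.
have [it lt] : In tail /\ E tail <= 2 * expR 2 + K * B * expR (1 + B ^+ 2).
  have kb : 0 <= K * B * expR (1 + B ^+ 2).
    by rewrite mulr_ge0 ?expR_ge0 ?mulr_ge0//; lra.
  case: (lerP p (1 / 4)) => p4.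
    have [i l] := tail_le_of_small p4; split => //; apply: (le_trans l).
    have : 2 * expR 2 * expR (- s ^+ 2 / 2) <= 2 * expR 2 * 1.
      rewrite ler_wpM2l ?mulr_ge0 ?expR_ge0// -[leRHS](@expR0 R) ler_expR.
      by have := sqr_ge0 s; lra.
    lra.
  have [i l] := tail_le_of_large (ltW p4); split => //; apply: (le_trans l); rewrite -/K.
  have : 0 <= expR (2 : R) by exact: expR_ge0.
  suff : K * r * expR (1 + w * r ^+ 3 / 6 + w * r ^+ 2 / 16 - 4 / 5 * p -
       3 / 2 * Num.sqrt p * s - s ^+ 2 / 2) <= K * B * expR (1 + B ^+ 2) by lra.
  apply: ler_pM; rewrite ?expR_ge0//; first by rewrite mulr_ge0 ?(ltW r0).
    by rewrite ler_wpM2l.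
  rewrite ler_expR.
  have h1 : w * r * r ^+ 2 <= 3 / 4 * r ^+ 2 by rewrite ler_wpM2r ?sqr_ge0.
  have h2 : w * r * r <= 3 / 4 * r by rewrite ler_wpM2r ?(ltW r0).
  have -> : w * r ^+ 3 = w * r * r ^+ 2 by ring.
  have -> : w * r ^+ 2 = w * r * r by ring.
  by have := sqr_ge0 s; lra.
apply: (le_trans (tilt_split it)).
have S0 : 0 <= 2 * expR (B ^+ 2 + 1) + 2 * expR 2 + K * B * expR (1 + B ^+ 2).
  by rewrite !addr_ge0 ?mulr_ge0 ?expR_ge0//; lra.
apply: (@le_trans _ _ (2 * expR (B ^+ 2 + 1) + 2 * expR 2 + K * B * expR (1 + B ^+ 2))).
  lra.
set S := _ + _ + _ in S0 *; rewrite /bigC -/S.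
have c1 : 1 <= core * (4 / 3 * expR (B ^+ 2)).
  apply: (@le_trans _ _ (3 / 4 * expR (- p / 6) * (4 / 3 * expR (B ^+ 2)))); last first.
    by rewrite ler_wpM2r ?core_ge// mulr_ge0 ?expR_ge0.
  have -> : 3 / 4 * expR (- p / 6) * (4 / 3 * expR (B ^+ 2)) =
     expR (- p / 6) * expR (B ^+ 2) by field.
  by rewrite -expRD -[leLHS](@expR0 R) ler_expR; lra.
have c2 : 1 <= expR (B ^+ 2) * expR (- s ^+ 2 / 2).
  by rewrite -expRD -[leLHS](@expR0 R) ler_expR; lra.
have -> : core * (4 / 3 * expR (B ^+ 2) * S * expR (B ^+ 2) * expR (- s ^+ 2 / 2)) =
  S * ((core * (4 / 3 * expR (B ^+ 2))) * (expR (B ^+ 2) * expR (- s ^+ 2 / 2))) by ring.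
rewrite ler_peMr//; rewrite -[leLHS]mulr1; exact: ler_pM.
Qed.

(** [K] and [B] are explicit numbers, so that this constant depends on [R] alone. *)
Definition tilt_const : R := bigC + (3 + 3 * K) * expR 2.

Lemma tilt_mass_gt0 : 0 < E (fun t => expR (dl t)).
Proof.
apply: lt_le_trans core_le_mass; apply: lt_le_trans core_ge.
by rewrite mulr_gt0 ?expR_gt0.
Qed.

Lemma tilt_mean_le :
  `|E (fun t => L t * expR (dl t))| <= E (fun t => expR (dl t)) *
    (12 / 5 * w * (p + 1) `^ (3 / 2) + tilt_const * expR (- s ^+ 2 / 2)).
Proof.
have p0' := p0; have w0' := w0; have W1' := W1.
have cg := core_ge; have K0' := K0.
have B80 : 80 <= B.
  by have : 0 <= 7 * 64 ^+ 3 * K; [rewrite ?mulr_ge0 ?exprn_ge0|rewrite /B; lra].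
have c0 : 0 < core by apply: lt_le_trans cg; rewrite mulr_gt0 ?expR_gt0.
have wW0 : 0 <= w * W by rewrite mulr_ge0// (le_trans ler01).
have b0 : 0 <= bigC.
  rewrite /bigC !mulr_ge0 ?expR_ge0 ?addr_ge0 ?mulr_ge0 ?expR_ge0//; lra.
have k0 : 0 <= (3 + 3 * K) * expR 2 by rewrite mulr_ge0 ?expR_ge0// addr_ge0 ?mulr_ge0.
have e0 : 0 <= expR (- s ^+ 2 / 2) by exact: expR_ge0.
have be0 := mulr_ge0 b0 e0; have ke0 := mulr_ge0 k0 e0.
rewrite -/W -[12 / 5 * w * W]mulrA.
have RHS0 : 0 <= 12 / 5 * (w * W) + tilt_const * expR (- s ^+ 2 / 2).
  apply: addr_ge0; first by rewrite mulr_ge0.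
  by apply: mulr_ge0 => //; exact: addr_ge0.
apply: (@le_trans _ _ (core * (12 / 5 * (w * W) + tilt_const * expR (- s ^+ 2 / 2)))); last first.
  by rewrite ler_wpM2r.
rewrite /tilt_const mulrDl.
have [rB|Br] := lerP r B.
  apply: (le_trans (tilt_le_of_small rB)); rewrite ler_wpM2l ?(ltW c0)//.
  have : 0 <= 12 / 5 * (w * W) by rewrite mulr_ge0.
  lra.
have [it lt] := tail_le_core (ltW Br).
apply: (le_trans (tilt_split it)).
(* At radius at least [80] the Gaussian mass beyond [r] is negligible even against
   [expR (- p / 6)]. *)
have mass105 : mass <= 21 / 20 * core.
  apply: (le_trans mass_le).
  have : E out <= 1 / 20 * core.
    apply: (le_trans wE_out_le_expR).
    apply: (@le_trans _ _ (3 / 80 * expR (- p / 6))); last by lra.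
    have h10 : 80 / 3 <= expR (10 : R) by have := expR_ge1Dxn 1 (ler0n R 10); rewrite !factS fact0; lra.
    have : expR (7 / 10 * p - 3 / 8 * r ^+ 2) <= expR (- (10)) * expR (- p / 6).
      rewrite -expRD ler_expR.
      have : 6400 <= r ^+ 2.
        have -> : 6400 = 80 ^+ 2 :> R by rewrite expr2; lra.
        by rewrite ler_pXn2r ?nnegrE ?(ltW r0)//; have := le_trans B80 (ltW Br).
      have := r2_ge; have := sqr_ge0 s; lra.
    move=> h; apply: (le_trans h); rewrite ler_wpM2r ?expR_ge0// expRN.
    by rewrite -[3 / 80]invrK lef_pV2 ?posrE ?invf_div ?expR_gt0.
  lra.
apply: (le_trans (lerD tilted_mean_le lt)).
(* The coefficients of [w * W] add up: [21 / 20 * (25 / 12) + 17 / 80 = 12 / 5]. *)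
have h : mass * (25 / 12 * (w * W)) <= 21 / 20 * core * (25 / 12 * (w * W)).
  by rewrite ler_wpM2r// mulr_ge0.
have hb := mulr_ge0 (ltW c0) be0.
move: h hb; move: (expR (- s ^+ 2 / 2)) (expR 2) => e1 e2 h hb; lra.
Qed.

End gaussian_tilt.

(** * Gaussian integrals *)

Section dot_product.
Context (R : realType).

Definition dotv n (u v : 'cV[R]_n) : R := (u^T *m v) 0 0.

Lemma dotvE n (u v : 'cV[R]_n) : dotv u v = \sum_i u i 0 * v i 0.
Proof. by rewrite /dotv mxE; apply: eq_bigr => i _; rewrite mxE. Qed.

Lemma dotvC n (u v : 'cV[R]_n) : dotv u v = dotv v u.
Proof. by rewrite !dotvE; apply: eq_bigr => i _; rewrite mulrC. Qed.

Lemma dotvDl n (u v w : 'cV[R]_n) : dotv (u + v) w = dotv u w + dotv v w.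
Proof. by rewrite /dotv linearD mulmxDl mxE. Qed.

Lemma dotvZl n (a : R) (u w : 'cV[R]_n) : dotv (a *: u) w = a * dotv u w.
Proof. by rewrite /dotv linearZ -scalemxAl mxE. Qed.

Lemma dotvDr n (u v w : 'cV[R]_n) : dotv w (u + v) = dotv w u + dotv w v.
Proof. by rewrite !(dotvC w) dotvDl. Qed.

Lemma dotvZr n (a : R) (u w : 'cV[R]_n) : dotv w (a *: u) = a * dotv w u.
Proof. by rewrite !(dotvC w) dotvZl. Qed.

Lemma dotvNl n (u w : 'cV[R]_n) : dotv (- u) w = - dotv u w.
Proof. by rewrite -scaleN1r dotvZl mulN1r. Qed.

Lemma dotvNr n (u w : 'cV[R]_n) : dotv w (- u) = - dotv w u.
Proof. by rewrite !(dotvC w) dotvNl. Qed.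

Lemma dotvBl n (u v w : 'cV[R]_n) : dotv (u - v) w = dotv u w - dotv v w.
Proof. by rewrite dotvDl dotvNl. Qed.

Lemma dotvBr n (u v w : 'cV[R]_n) : dotv w (u - v) = dotv w u - dotv w v.
Proof. by rewrite dotvDr dotvNr. Qed.

Lemma dotv0l n (w : 'cV[R]_n) : dotv 0 w = 0.
Proof. by rewrite -(scale0r 0) dotvZl mul0r. Qed.

Lemma dotv0r n (w : 'cV[R]_n) : dotv w 0 = 0.
Proof. by rewrite dotvC dotv0l. Qed.

Lemma dotv_ge0 n (u : 'cV[R]_n) : 0 <= dotv u u.
Proof. by rewrite dotvE; apply: sumr_ge0 => i _; rewrite -expr2 sqr_ge0. Qed.

Lemma dotv_eq0 n (u : 'cV[R]_n) : (dotv u u == 0) = (u == 0).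
Proof.
apply/idP/eqP => [|->]; last by rewrite dotv0l eqxx.
rewrite dotvE psumr_eq0 => [/allP h|i _]; last by rewrite -expr2 sqr_ge0.
apply/matrixP => i j; rewrite ord1 mxE.
by have := h i (mem_index_enum i); rewrite /= -expr2 sqrf_eq0 => /eqP.
Qed.

Lemma dotv_deltal n (k : 'I_n) (v : 'cV[R]_n) : dotv (delta_mx k 0) v = v k 0.
Proof.
rewrite dotvE (bigD1 k)//= big1 => [|l /negPf lk]; rewrite mxE eqxx.
  by rewrite eqxx mul1r addr0.
by rewrite lk mul0r.
Qed.

Lemma enorm_sqr n (u : 'cV[R]_n) : enorm u ^+ 2 = dotv u u.
Proof.
rewrite /enorm sqr_sqrtr ?dotvE; last by apply: sumr_ge0 => i _; exact: sqr_ge0.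
by apply: eq_bigr => i _; rewrite expr2.
Qed.

Lemma enorm_ge0 n (u : 'cV[R]_n) : 0 <= enorm u.
Proof. exact: sqrtr_ge0. Qed.

Lemma quad_formE n (A : 'M[R]_n) (u : 'cV[R]_n) : quad_form A u = dotv u (A *m u).
Proof. by rewrite /quad_form /dotv mulmxA. Qed.

Lemma dotv_mulmx m n (A : 'M[R]_(m, n)) (u : 'cV[R]_m) (v : 'cV[R]_n) :
  dotv u (A *m v) = dotv (A^T *m u) v.
Proof. by rewrite /dotv trmx_mul trmxK mulmxA. Qed.

Lemma quad_formD n (A B : 'M[R]_n) (u : 'cV[R]_n) :
  quad_form (A + B) u = quad_form A u + quad_form B u.
Proof. by rewrite !quad_formE mulmxDl dotvDr. Qed.

Lemma quad_formN n (A : 'M[R]_n) (u : 'cV[R]_n) :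
  quad_form (- A) u = - quad_form A u.
Proof. by rewrite !quad_formE mulNmx dotvNr. Qed.

Lemma quad_formZ n (c : R) (A : 'M[R]_n) (u : 'cV[R]_n) :
  quad_form (c *: A) u = c * quad_form A u.
Proof. by rewrite !quad_formE -scalemxAl dotvZr. Qed.

Lemma quad_form_scale n (c : R) (A : 'M[R]_n) (u : 'cV[R]_n) :
  quad_form A (c *: u) = c ^+ 2 * quad_form A u.
Proof. by rewrite !quad_formE -scalemxAr dotvZl dotvZr mulrA. Qed.

Lemma quad_form0 n (A : 'M[R]_n) : quad_form A 0 = 0.
Proof. by rewrite quad_formE mulmx0 dotv0r. Qed.

Lemma quad_formNv n (A : 'M[R]_n) (u : 'cV[R]_n) : quad_form A (- u) = quad_form A u.
Proof. by rewrite -scaleN1r quad_form_scale sqrrN expr1n mul1r. Qed.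

Lemma quad_form_addv n (A : 'M[R]_n) (u v : 'cV[R]_n) : A^T = A ->
  quad_form A (u + v) = quad_form A u + 2 * dotv u (A *m v) + quad_form A v.
Proof.
move=> sA; rewrite !quad_formE mulmxDr !dotvDl !dotvDr.
have -> : dotv v (A *m u) = dotv u (A *m v) by rewrite dotv_mulmx sA dotvC.
ring.
Qed.

Lemma dotv_col_mx m n (u : 'cV[R]_m) (v : 'cV[R]_n) (u' : 'cV[R]_m) (v' : 'cV[R]_n) :
  dotv (col_mx u v) (col_mx u' v') = dotv u u' + dotv v v'.
Proof. by rewrite /dotv tr_col_mx mul_row_col mxE. Qed.

Lemma dotv1 (x y : R) : dotv (x%:M : 'cV[R]_1) y%:M = x * y.
Proof. by rewrite /dotv tr_scalar_mx -scalar_mxM mxE eqxx mulr1n. Qed.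

End dot_product.

Section lebesgue_tuple_integral.
Context (R : realType).

Lemma measurable_coord n (i : 'I_n) :
  measurable_fun setT (fun t : n.-tuple R => col_of_tuple t i 0).
Proof.
have -> : (fun t : n.-tuple R => col_of_tuple t i 0) = (fun t => tnth t i).
  by apply/funext => t; rewrite mxE.
exact: measurable_tnth.
Qed.

Lemma measurable_dotv n (b : 'cV[R]_n) :
  measurable_fun setT (fun t : n.-tuple R => dotv b (col_of_tuple t)).
Proof.
under eq_fun do rewrite dotvE.
apply: measurable_sum => i; apply: measurable_funM => //; exact: measurable_coord.
Qed.

Lemma measurable_quad_form n (A : 'M[R]_n) :
  measurable_fun setT (fun t : n.-tuple R => quad_form A (col_of_tuple t)).
Proof.
under eq_fun do rewrite quad_formE dotvE.
apply: measurable_sum => i; apply: measurable_funM; first exact: measurable_coord.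
under eq_fun do rewrite mxE.
apply: measurable_sum => j; apply: measurable_funM => //; exact: measurable_coord.
Qed.

Lemma measurable_cons_pair n :
  measurable_fun [set: measurableTypeR R * n.-tuple R] (@cons_pair R n).
Proof.
exact: (@measurable_cons _ _ _ R fst n snd measurable_fst measurable_snd).
Qed.

Lemma integral_lebesgue_tupleS n (F : n.+1.-tuple R -> \bar R) :
  measurable_fun setT F -> (forall t, 0 <= F t)%E ->
  (\int[lebesgue_tuple R n.+1]_t F t =
   \int[lebesgue_tuple R n]_t \int[@lebesgue_measure R]_x F (cons_pair (x, t)))%E.
Proof.
move=> mF F0.
have mFc : measurable_fun setT (F \o @cons_pair R n).
  by apply: measurableT_comp => //; exact: measurable_cons_pair.
transitivity (\int[(@lebesgue_measure R \x lebesgue_tuple R n)%E]_z (F \o @cons_pair R n) z)%E.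
  by apply: (ge0_integral_pushforward (@measurable_cons_pair n)) => // t _.
by rewrite fubini_tonelli2// => z /=; exact: F0.
Qed.

Lemma col_of_tuple_cons n (x : R) (t : n.-tuple R) :
  col_of_tuple (cons_pair (x, t)) = col_mx (x%:M : 'cV[R]_1) (col_of_tuple t) :> 'cV_(1 + n).
Proof.
apply/matrixP => i j; rewrite ord1 mxE.
case: (split_ordP i) => k ->; rewrite ?col_mxEu ?col_mxEd.
  by rewrite ord1 (_ : lshift n 0 = 0) ?tnth0 ?mxE//; exact: val_inj.
rewrite mxE (_ : rshift 1 k = lift ord0 k); last exact: val_inj.
by rewrite tnthS; congr tnth; exact: val_inj.
Qed.

(** Completing the square leaves a multiple of the normal density of mean [b / a] and variance
    [a^-1]. *)
Lemma integral_gauss_shift (a b : R) : 0 < a ->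
  (\int[@lebesgue_measure R]_x (expR (- (a / 2) * x ^+ 2 + b * x))%:E =
   (Num.sqrt (2 * pi) / Num.sqrt a * expR (b ^+ 2 / (2 * a)))%:E)%E.
Proof.
move=> a0; pose s := (Num.sqrt a)^-1.
have sa0 : 0 < Num.sqrt a by rewrite sqrtr_gt0.
have s0 : s != 0 by rewrite invr_eq0 gt_eqF.
have s2 : s ^+ 2 = a^-1 by rewrite exprVn sqr_sqrtr ?ltW.
have an0 : a != 0 by rewrite gt_eqF.
have := integral_normal_pdf (b / a) s; rewrite normal_pdfE// => h.
have peak : normal_peak s = Num.sqrt a / Num.sqrt (2 * pi).
  rewrite /normal_peak s2 -mulr_natr -mulrA [pi * 2%:R]mulrC sqrtrM ?invr_ge0 ?ltW//.
  by rewrite sqrtrV ?ltW// invfM invrK.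
have p0 : 0 < Num.sqrt (2 * pi : R) by rewrite sqrtr_gt0 mulr_gt0 ?pi_gt0.
have E x : (expR (- (a / 2) * x ^+ 2 + b * x))%:E =
   ((Num.sqrt (2 * pi) / Num.sqrt a * expR (b ^+ 2 / (2 * a)))%:E *
   (normal_peak s * normal_fun (b / a) s x)%:E)%E.
  rewrite -EFinM peak /normal_fun s2; congr EFin.
  set e1 := expR (b ^+ 2 / _); set e2 := expR (- (x - _) ^+ 2 / _).
  have -> : Num.sqrt (2 * pi) / Num.sqrt a * e1 * (Num.sqrt a / Num.sqrt (2 * pi) * e2) =
      e1 * e2 by field; rewrite !gt_eqF.
  rewrite /e1 /e2 -expRD; congr expR; rewrite -[a^-1 *+ 2]mulr_natr; field.
  exact: an0.
under eq_integral do rewrite E.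
rewrite ge0_integralZl_EFin//.
- by rewrite h mule1.
- by move=> x _; rewrite lee_fin mulr_ge0 ?normal_peak_ge0 ?normal_fun_ge0.
- apply/measurable_EFinP; apply: measurable_funM => //; exact: measurable_normal_fun.
Qed.

Lemma posdef_unit n (A : 'M[R]_n) : posdef A -> A \in unitmx.
Proof.
move=> [sA pA]; rewrite -row_free_unit -kermx_eq0; apply/eqP/row_matrixP => i.
rewrite row0; apply/eqP; apply: contraT => hi.
have := pA (row i (kermx A))^T.
have -> : (row i (kermx A))^T != 0 by apply: contra hi => /eqP/(congr1 trmx); rewrite trmxK trmx0 => ->.
move=> /(_ isT); rewrite /quad_form trmxK -row_mul mulmx_ker row0 mul0mx mxE.
by rewrite ltxx.
Qed.

(** * Schur complement of a scalar block *)

Section schur.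
Variables (n : nat) (a : R) (c : 'cV[R]_n) (B : 'M[R]_n).
Let A : 'M[R]_(1 + n) := block_mx (a%:M : 'M[R]_1) c^T c B.
Let S : 'M[R]_n := B - a^-1 *: (c *m c^T).

Lemma schur_mulmx (x : R) (t : 'cV[R]_n) :
  A *m col_mx (x%:M : 'cV[R]_1) t =
  col_mx ((a * x + dotv c t)%:M : 'cV[R]_1) (x *: c + B *m t).
Proof.
rewrite /A mul_block_col; congr col_mx; last first.
  by rewrite mul_mx_scalar.
rewrite -scalar_mxM; apply/matrixP => i j; rewrite !ord1 !mxE /dotv mxE eqxx !mulr1n.
by [].
Qed.

Lemma schur_quad (x : R) (t : 'cV[R]_n) :
  quad_form A (col_mx (x%:M : 'cV[R]_1) t) =
  a * x ^+ 2 + 2 * x * dotv c t + quad_form B t.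
Proof.
rewrite quad_formE schur_mulmx dotv_col_mx dotv1 dotvDr dotvZr (dotvC t) quad_formE.
ring.
Qed.

Hypothesis a0 : a != 0.

Lemma schur_quad_comp (t : 'cV[R]_n) :
  quad_form S t = quad_form B t - dotv c t ^+ 2 / a.
Proof.
rewrite /S !quad_formE mulmxBl dotvBr; congr (_ - _).
rewrite -scalemxAl dotvZr -mulmxA dotv_mulmx -/(dotv _ _).
rewrite mulrC; congr (_ / _).
have -> : c^T *m t = (dotv c t)%:M by apply/matrixP => i j; rewrite !ord1 [RHS]mxE eqxx mulr1n.
by rewrite dotv1 expr2.
Qed.

Lemma schur_comp_mulmx (t : 'cV[R]_n) : S *m t = B *m t - (dotv c t / a) *: c.
Proof.
rewrite /S mulmxBl; congr (_ - _); rewrite -scalemxAl -mulmxA.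
have -> : c^T *m t = (dotv c t)%:M by apply/matrixP => i j; rewrite !ord1 [RHS]mxE eqxx mulr1n.
have -> : c *m (dotv c t)%:M = dotv c t *: c.
  by rewrite mul_mx_scalar.
by rewrite scalerA mulrC.
Qed.

Lemma schur_det : \det A = a * \det S.
Proof.
have -> : A = block_mx 1%:M 0 (a^-1 *: c) 1%:M *m block_mx (a%:M : 'M[R]_1) c^T 0 S.
  rewrite mulmx_block !mul1mx !mul0mx !addr0; congr block_mx.
    apply/matrixP => i j; rewrite !mxE big_ord1 !mxE !ord1 eqxx mulr1n.
    by field.
  by rewrite -scalemxAl /S addrC subrK.
by rewrite det_mulmx det_lblock det_ublock !det1 !mul1r det_scalar1.
Qed.

End schur.

(** Induction on the dimension: integrating out the first coordinate leaves the Schur complement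
    [S]. The linear term is written [A *m v] because this shape is inherited, as [S *m w] with [w]
    the lower part of [v]. *)
Lemma integral_gaussian n (A : 'M[R]_n) (v : 'cV[R]_n) : posdef A ->
  0 < \det A /\
  (\int[lebesgue_tuple R n]_t
     (expR (- (quad_form A (col_of_tuple t) / 2) + dotv (A *m v) (col_of_tuple t)))%:E =
   (Num.sqrt (2 * pi) ^+ n / Num.sqrt (\det A) * expR (quad_form A v / 2))%:E)%E.
Proof.
elim: n => [|n IH] in A v *.
  move=> _; split; first by rewrite det_mx00.
  rewrite det_mx00 expr0 sqrtr1 divr1 mul1r.
  rewrite (_ : (lebesgue_tuple R 0 : set _ -> _) = dirac [tuple])//.
  have q0 (u : 'cV[R]_0) : quad_form A u = 0 by rewrite quad_formE dotvE big_ord0.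
  rewrite integral_dirac//.
    by rewrite diracT mul1e !q0 mul0r oppr0 dotvE big_ord0 addr0.
  apply/measurable_EFinP; apply: measurableT_comp => //; apply: measurable_funD.
    apply: measurable_funN; apply: measurable_funM => //; exact: measurable_quad_form.
  exact: measurable_dotv.
move=> [sA pA]; move: A v sA pA; rewrite -[n.+1]/(1 + n)%N => A v sA pA.
pose a := A 0 0; pose c : 'cV[R]_n := dlsubmx A; pose B : 'M[R]_n := drsubmx A.
have AE : A = block_mx (a%:M : 'M[R]_1) c^T c B.
  rewrite -[LHS]submxK; congr block_mx.
    by apply/matrixP => i j; rewrite !ord1 !mxE eqxx mulr1n; congr (A _ _); exact: val_inj.
  by rewrite /c trmx_dlsub sA.
have a0 : 0 < a.
  have := pA (col_mx (1%:M : 'cV[R]_1) 0); rewrite AE schur_quad.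
  rewrite quad_formE mulmx0 !dotv0r mulr0 !addr0 expr1n mulr1; apply.
  by rewrite col_mx_eq0 negb_and oner_eq0.
have an : a != 0 by rewrite gt_eqF.
pose S : 'M[R]_n := B - a^-1 *: (c *m c^T).
have pS : posdef S.
  split.
    rewrite /S linearB linearZ/= trmx_mul trmxK; congr (_ - _).
    by rewrite /B trmx_drsub sA.
  move=> t t0; rewrite schur_quad_comp//.
  (* This first coordinate minimizes the form of [A] for fixed [t]; the minimum is the form of
     [S]. *)
  have := pA (col_mx ((- (dotv c t / a))%:M : 'cV[R]_1) t).
  rewrite AE schur_quad col_mx_eq0 negb_and t0 orbT => /(_ isT).
  have -> // : a * (- (dotv c t / a)) ^+ 2 + 2 * - (dotv c t / a) * dotv c t +
     quad_form B t = quad_form B t - dotv c t ^+ 2 / a.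
  by field.
have detA : \det A = a * \det S by rewrite AE schur_det.
pose x := v 0 0; pose w : 'cV[R]_n := dsubmx v.
have vE : v = col_mx (x%:M : 'cV[R]_1) w.
  rewrite -[LHS]vsubmxK; congr col_mx.
  by apply/matrixP => i j; rewrite !ord1 !mxE eqxx mulr1n; congr (v _ _); exact: val_inj.
have [dS intS] := IH S w pS.
split; first by rewrite detA mulr_gt0.
rewrite integral_lebesgue_tupleS; last 2 first.
- apply/measurable_EFinP; apply: measurableT_comp => //; apply: measurable_funD.
    apply: measurable_funN; apply: measurable_funM => //; exact: measurable_quad_form.
  exact: measurable_dotv.
- by move=> t; rewrite lee_fin expR_ge0.
pose be := a * x + dotv c w.
pose K := Num.sqrt (2 * pi) / Num.sqrt a * expR (be ^+ 2 / (2 * a)).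
have inner (t : n.-tuple R) :
  (\int[@lebesgue_measure R]_y (expR (- (quad_form A (col_of_tuple (cons_pair (y, t))) / 2)
     + dotv (A *m v) (col_of_tuple (cons_pair (y, t)))))%:E =
   K%:E * (expR (- (quad_form S (col_of_tuple t) / 2) +
           dotv (S *m w) (col_of_tuple t)))%:E)%E.
  set u := col_of_tuple t.
  have E y : (expR (- (quad_form A (col_of_tuple (cons_pair (y, t))) / 2)
     + dotv (A *m v) (col_of_tuple (cons_pair (y, t)))))%:E =
    ((expR (- (quad_form B u / 2) + dotv (x *: c + B *m w) u))%:E *
     (expR (- (a / 2) * y ^+ 2 + (be - dotv c u) * y))%:E)%E.
    rewrite col_of_tuple_cons -/u vE AE schur_quad schur_mulmx dotv_col_mx dotv1.
    by rewrite -EFinM -expRD; congr (expR _)%:E; rewrite /be; field.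
  under eq_integral do rewrite E.
  rewrite ge0_integralZl_EFin ?expR_ge0//; last first.
    apply/measurable_EFinP; apply: measurableT_comp => //; apply: measurable_funD.
      by apply: measurable_funM => //; exact: measurable_funX.
    by apply: measurable_funM.
  rewrite integral_gauss_shift// -!EFinM; congr EFin; rewrite /K.
  rewrite mulrCA -!mulrA; congr (_ * (_ * _)); rewrite -!expRD; congr expR.
  rewrite schur_quad_comp// schur_comp_mulmx// dotvBl dotvDl !dotvZl /be; field.
  exact: an.
under eq_integral do rewrite inner.
rewrite ge0_integralZl_EFin//; last 2 first.
- apply/measurable_EFinP; apply: measurableT_comp => //; apply: measurable_funD.
    apply: measurable_funN; apply: measurable_funM => //; exact: measurable_quad_form.
  exact: measurable_dotv.
- by rewrite mulr_ge0 ?expR_ge0 ?divr_ge0.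
rewrite intS -EFinM; congr EFin; rewrite detA [Num.sqrt (a * _)]sqrtrM ?(ltW a0)// /K.
have -> : quad_form A v = be ^+ 2 / a + quad_form S w.
  rewrite vE AE schur_quad schur_quad_comp// /be; field; exact: an.
rewrite [(_ + _) / 2]mulrDl expRD [_ ^+ (1 + n)]exprS.
have -> : be ^+ 2 / a / 2 = be ^+ 2 / (2 * a) by field.
have sa : Num.sqrt a != 0 by rewrite gt_eqF ?sqrtr_gt0.
have sd : Num.sqrt (\det S) != 0 by rewrite gt_eqF ?sqrtr_gt0.
move: (Num.sqrt (2 * pi) ^+ n) => q.
by field; rewrite sa sd.
Qed.

End lebesgue_tuple_integral.

(** * Spectral theorem for real symmetric matrices *)

Section real_spectral.
Import complex.
Context (R : realType).
Local Notation C := (complex.complex R).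
Local Notation toC := (@real_complex_def R (Phant R)).
Local Notation cRe := (@complex.Re R).
Local Notation cIm := (@complex.Im R).

(** Over the complex numbers [M] is Hermitian and the spectral theorem applies, with real
    eigenvalues. A real eigenvector is the real part of a complex one, or its imaginary part when
    the real part vanishes. *)
Lemma real_spectral n (M : 'M[R]_n) : M^T = M ->
  exists e : 'I_n -> R,
    [/\ forall mu, \det (1%:M - mu *: M) = \prod_i (1 - mu * e i),
        \tr M = \sum_i e i &
        forall i, exists2 u : 'cV[R]_n, u != 0 & M *m u = e i *: u].
Proof.
move=> sM; pose MC : 'M[C]_n := map_mx toC M.
have toCJ (x : R) : (toC x)^* = toC x :> C by apply/CrealP; rewrite complex.complex_real.
have hM : MC \is hermsymmx.
  apply/is_hermitianmxP; rewrite expr0 scale1r; apply/matrixP => i j.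
  by rewrite !mxE toCJ -[in LHS]sM mxE.
have rM := hermitian_spectral_diag_real hM.
have /orthomx_spectralP := hermitian_normalmx hM.
set P := spectralmx MC; set sp := spectral_diag MC => ME.
have Pu : P \in unitmx by exact: spectral_unit.
pose e i := cRe (sp 0 i).
have spE i : sp 0 i = toC (e i).
  have : sp 0 i \is Num.real by have /mxOverP := rM; apply.
  by rewrite /e; case: (sp 0 i) => a b; rewrite complex.complex_real => /eqP ->.
exists e; split.
- move=> mu; apply: (@complex.complexI R).
  rewrite -[LHS]det_map_mx map_mxB map_mx1 map_mxZ -/MC ME.
  rewrite rmorph_prod.
  have -> : 1%:M - toC mu *: (invmx P *m diag_mx sp *m P) =
     invmx P *m (1%:M - toC mu *: diag_mx sp) *m P.
    rewrite mulmxBr mulmxBl mulmx1 mulVmx//; congr (_ - _).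
    by rewrite -scalemxAr -scalemxAl.
  rewrite !det_mulmx mulrC mulrA -det_mulmx mulmxV// det1 mul1r.
  have -> : 1%:M - toC mu *: diag_mx sp = diag_mx (\row_i toC (1 - mu * e i)).
    apply/matrixP => i j; rewrite !mxE; case: eqVneq => [->|_].
      by rewrite !mulr1n spE rmorphB rmorph1 rmorphM.
    by rewrite !mulr0n mulr0 subr0.
  by rewrite det_diag; apply: eq_bigr => i _; rewrite mxE.
- apply: (@complex.complexI R); rewrite -[LHS]trace_map_mx -/MC ME.
  rewrite mxtrace_mulC mulmxA mulmxV// mul1mx mxtrace_diag rmorph_sum.
  by apply: eq_bigr => i _; rewrite spE.
move=> i; pose v := row i P.
have vM : v *m MC = toC (e i) *: v.
  rewrite ME /v -row_mul !mulmxA mulmxV// mul1mx -spE mul_diag_mx.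
  by apply/rowP => k; rewrite !mxE.
have vn : v != 0.
  apply: contraTneq Pu => v0; rewrite -row_free_unit; apply/negP => /row_freeP[Q PQ].
  have := congr1 (row i) PQ; rewrite row_mul -/v v0 mul0mx row1 => /rowP/(_ i).
  by rewrite !mxE !eqxx => /eqP; rewrite eq_sym oner_eq0.
have part (F : C -> R) : {morph F : x y / x + y} -> F 0 = 0 ->
    (forall (a : R) x, F (x * toC a) = F x * a) ->
    M *m (map_mx F v)^T = e i *: (map_mx F v)^T.
  move=> FD F0 FZ; apply/matrixP => j k; rewrite ord1 !mxE.
  have /rowP/(_ j) := vM; rewrite !mxE => /(congr1 F).
  rewrite (big_morph F FD F0) mulrC FZ mulrC => <-.
  by apply: eq_bigr => l _; rewrite !mxE FZ mulrC -[in LHS]sM mxE.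
have reD : {morph cRe : x y / x + y} by case=> ? ? [].
have imD : {morph cIm : x y / x + y} by case=> ? ? [].
have reZ (a : R) x : cRe (x * toC a) = cRe x * a by case: x => ? ? /=; rewrite mulr0 subr0.
have imZ (a : R) x : cIm (x * toC a) = cIm x * a by case: x => ? ? /=; rewrite mulr0 add0r.
have [v0|v0] := eqVneq ((map_mx cRe v)^T) 0; last first.
  by exists (map_mx cRe v)^T => //; exact: part.
exists (map_mx cIm v)^T; last exact: part.
apply: contra vn => /eqP v1; apply/eqP/rowP => j; rewrite [RHS]mxE.
have := congr1 (fun A : 'cV[R]_n => A j 0) v0; have := congr1 (fun A : 'cV[R]_n => A j 0) v1.
by rewrite !mxE; case: (P i j) => a b /= -> ->.
Qed.

(** Concavity of [ln (1 - mu * e)] in [e] over [[0, lam]], eigenvalue by eigenvalue. Only the trace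
    survives, which frees the Laplace bound from the dimension. *)
Lemma det_1B_ge n (M : 'M[R]_n) (lam mu : R) : M^T = M ->
  (forall u, 0 <= quad_form M u <= lam * dotv u u) ->
  0 < lam -> 0 <= mu -> mu * lam < 1 ->
  expR (\tr M / lam * ln (1 - mu * lam)) <= \det (1%:M - mu *: M).
Proof.
move=> sM hM lam0 mu0 mul1; have [e [detE trE eig]] := real_spectral sM.
rewrite detE trE mulr_suml mulr_suml expR_sum; apply: ler_prod => i _.
rewrite expR_ge0/=; have [u u0 Mu] := eig i.
have du : 0 < dotv u u by rewrite lt_neqAle dotv_ge0 eq_sym dotv_eq0 u0.
have := hM u; rewrite quad_formE Mu dotvZr => /andP[h1 h2].
have e0 : 0 <= e i by rewrite -(pmulr_lge0 _ du).
have el : e i <= lam by rewrite -(ler_pM2r du).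
have h : 0 <= e i / lam <= 1 by rewrite divr_ge0 ?(ltW lam0)//= ler_pdivrMr// mul1r.
apply: (le_trans (expR_chord _ h)); rewrite lnK ?posrE ?subr_gt0//.
by rewrite le_eqVlt; apply/orP; left; apply/eqP; field; rewrite gt_eqF.
Qed.

End real_spectral.

(** * Quadratic forms and the Gaussian weight *)

Section forms.
Context (R : realType).

(** Cauchy-Schwarz for the inner product of [A]: positivity is tested at [c *: u - b *: v]. *)
Lemma psd_dotv_sqr_le n (A : 'M[R]_n) (u v : 'cV[R]_n) : posdef A ->
  dotv u (A *m v) ^+ 2 <= quad_form A u * quad_form A v.
Proof.
move=> [sA pA]; have [->|v0] := eqVneq v 0.
  by rewrite mulmx0 dotv0r expr0n/= quad_form0 mulr0.
have c0 := pA v v0; set c := quad_form A v in c0 *; set b := dotv u (A *m v).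
have : 0 <= quad_form A (c *: u + (- b) *: v).
  have [->|h] := eqVneq (c *: u + (- b) *: v) 0; last exact/ltW/pA.
  by rewrite quad_form0.
rewrite quad_form_addv// !quad_form_scale -scalemxAr dotvZl dotvZr -/b -/c.
set a := quad_form A u => h.
have : 0 <= c * (a * c - b ^+ 2) by move: h; lra.
by rewrite pmulr_rge0// subr_ge0.
Qed.

Lemma posdef1 n : posdef (1%:M : 'M[R]_n).
Proof.
split; first by rewrite trmx1.
move=> u u0; rewrite quad_formE mul1mx lt_neqAle dotv_ge0 andbT eq_sym.
by rewrite dotv_eq0.
Qed.

Lemma dotv_sqr_le n (u v : 'cV[R]_n) : dotv u v ^+ 2 <= dotv u u * dotv v v.
Proof.
by have := psd_dotv_sqr_le u v (posdef1 n); rewrite !quad_formE !mul1mx.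
Qed.

Lemma psd_trace_ge0 n (M : 'M[R]_n) : psd M -> 0 <= \tr M.
Proof.
move=> [_ pM]; apply: sumr_ge0 => i _; have := pM (delta_mx i 0).
by rewrite quad_formE dotv_deltal -colE mxE.
Qed.

(* Summing [quad_form M (e_j delta_i - e_i delta_j) >= 0] over all [i], [j]. *)
Lemma psd_quad_form_le_trace n (M : 'M[R]_n) (e : 'cV[R]_n) : psd M ->
  quad_form M e <= \tr M * dotv e e.
Proof.
move=> [sM pM].
have h i j : 2 * (e i 0 * (M i j * e j 0)) <= M i i * (e j 0 * e j 0) + M j j * (e i 0 * e i 0).
  have := pM (e j 0 *: delta_mx i 0 - e i 0 *: delta_mx j 0).
  have ME k l : dotv (delta_mx k 0) (M *m delta_mx l 0) = M k l.
    by rewrite dotv_deltal -colE mxE.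
  have MJI : M j i = M i j by rewrite -[in LHS]sM mxE.
  rewrite quad_formE mulmxBr dotvBl !dotvBr -!scalemxAr !dotvZl !dotvZr !ME MJI.
  lra.
have tot : \sum_i \sum_j M i i * (e j 0 * e j 0) = \tr M * dotv e e.
  rewrite dotvE /mxtrace mulr_suml; apply: eq_bigr => i _; by rewrite mulr_sumr.
have -> : \tr M * dotv e e = 2^-1 * \sum_i \sum_j
    (M i i * (e j 0 * e j 0) + M j j * (e i 0 * e i 0)).
  under eq_bigr do rewrite big_split/=.
  by rewrite big_split/= [X in _ + X]exchange_big/= tot; field.
have -> : quad_form M e = 2^-1 * \sum_i \sum_j 2 * (e i 0 * (M i j * e j 0)).
  rewrite quad_formE dotvE mulr_sumr; apply: eq_bigr => i _.
  by rewrite mxE !mulr_sumr; apply: eq_bigr => j _; field.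
apply: ler_wpM2l; first by rewrite invr_ge0.
by apply: ler_sum => i _; apply: ler_sum => j _.
Qed.

(** Two triangular factorizations of the same block matrix. *)
Lemma det_1B_mulmxC n (X Y : 'M[R]_n) : \det (1%:M - X *m Y) = \det (1%:M - Y *m X).
Proof.
have h1 : block_mx 1%:M X Y 1%:M =
  block_mx 1%:M 0 Y 1%:M *m block_mx 1%:M X 0 (1%:M - Y *m X) :> 'M[R]_(n + n).
  by rewrite mulmx_block !mul1mx !mul0mx !mulmx1 !addr0 addrC subrK.
have h2 : block_mx 1%:M X Y 1%:M =
  block_mx (1%:M - X *m Y) X 0 1%:M *m block_mx 1%:M 0 Y 1%:M :> 'M[R]_(n + n).
  by rewrite mulmx_block !mul0mx !mulmx1 !mulmx0 !mul1mx !add0r subrK.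
have := congr1 determinant (etrans (esym h1) h2).
by rewrite !det_mulmx !det_lblock !det_ublock !det1 !mul1r !mulr1.
Qed.

Lemma invmx_sym n (A : 'M[R]_n) : A^T = A -> (invmx A)^T = invmx A.
Proof. by move=> sA; rewrite trmx_inv sA. Qed.

Lemma quad_form_sandwich n (A D : 'M[R]_n) v : posdef A -> D^T = D ->
  quad_form (D *m invmx A *m D) v = quad_form A (invmx A *m (D *m v)).
Proof.
move=> pA sD; rewrite [RHS]quad_formE (mulKVmx (posdef_unit pA)) dotvC quad_formE.
by rewrite -!mulmxA [LHS]dotv_mulmx sD.
Qed.

Lemma psd_sandwich n (A D : 'M[R]_n) : posdef A -> D^T = D ->
  psd (D *m invmx A *m D).
Proof.
move=> pA sD; split; first by rewrite !trmx_mul sD invmx_sym ?mulmxA//; case: pA.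
move=> v; rewrite quad_form_sandwich//; set u := invmx A *m _.
have [->|h] := eqVneq u 0; last by apply/ltW; case: pA => _; apply.
by rewrite quad_form0.
Qed.

End forms.

Section gaussian_weight.
Context (R : realType) (n : nat).
Variables (A D : 'M[R]_n) (x0 w : 'cV[R]_n).
Hypotheses (pA : posdef A) (sD : D^T = D)
  (DA : forall u, quad_form (D *m D) u <= quad_form A u)
  (hw : quad_form (invmx A) w <= 1).

Local Notation m := (lebesgue_tuple R n).
Let c0 : R := Num.sqrt (2 * pi) ^+ n.
Let ctr (t : n.-tuple R) : 'cV[R]_n := col_of_tuple t - x0.
Let p := \tr (D *m D *m invmx A).

Definition gauss_density (t : n.-tuple R) : R :=
  expR (- (quad_form A (ctr t) / 2)) / (c0 / Num.sqrt (\det A)).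

Let c0_gt0 : 0 < c0.
Proof. by rewrite exprn_gt0// sqrtr_gt0 mulr_gt0// pi_gt0. Qed.

Let sA : A^T = A. Proof. by case: pA. Qed.

Let Au : A \in unitmx. Proof. exact: posdef_unit. Qed.

Lemma gauss_density_ge0 t : 0 <= gauss_density t.
Proof. by rewrite /gauss_density divr_ge0 ?expR_ge0// divr_ge0// ltW. Qed.

Lemma measurable_quad_form_ctr (H : 'M[R]_n) :
  measurable_fun setT (fun t => quad_form H (ctr t)).
Proof.
have -> : (fun t => quad_form H (ctr t)) = (fun t => quad_form H (col_of_tuple t) -
   dotv (H *m x0 + H^T *m x0) (col_of_tuple t) + quad_form H x0).
  apply/funext => t; rewrite /ctr !quad_formE mulmxBr !dotvBl !dotvBr dotvDl.
  rewrite (dotvC (H *m x0)) (dotv_mulmx H x0 (col_of_tuple t)); ring.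
apply: measurable_funD => //; apply: measurable_funB.
  exact: measurable_quad_form.
exact: measurable_dotv.
Qed.

Lemma measurable_dotv_ctr (b : 'cV[R]_n) :
  measurable_fun setT (fun t => dotv b (ctr t)).
Proof.
under eq_fun do rewrite dotvBr.
apply: measurable_funB => //; exact: measurable_dotv.
Qed.

Lemma measurable_gauss_density : measurable_fun setT gauss_density.
Proof.
apply: measurable_funM => //; apply: measurableT_comp => //; apply: measurable_funN.
by apply: measurable_funM => //; exact: measurable_quad_form_ctr.
Qed.

Lemma integral_gaussian_ctr (H : 'M[R]_n) (c : 'cV[R]_n) : posdef H ->
  (\int[m]_t (expR (- (quad_form H (ctr t) / 2) + dotv (H *m c) (ctr t)))%:E =
   (c0 / Num.sqrt (\det H) * expR (quad_form H c / 2))%:E)%E.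
Proof.
move=> pH; have sH : H^T = H by case: pH.
have [dH intH] := integral_gaussian (c + x0) pH.
have E t : (expR (- (quad_form H (ctr t) / 2) + dotv (H *m c) (ctr t)))%:E =
  ((expR (- (quad_form H x0 / 2) - dotv (H *m c) x0))%:E *
   (expR (- (quad_form H (col_of_tuple t) / 2) + dotv (H *m (c + x0)) (col_of_tuple t)))%:E)%E.
  rewrite -EFinM -expRD; congr (expR _)%:E; rewrite /ctr.
  rewrite quad_form_addv// quad_formNv mulmxN dotvNr [dotv (H *m c) (_ - _)]dotvBr.
  by rewrite mulmxDr dotvDl (dotvC (H *m x0)); field.
under eq_integral do rewrite E.
rewrite ge0_integralZl_EFin ?expR_ge0//; last first.
  apply/measurable_EFinP; apply: measurableT_comp => //; apply: measurable_funD.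
    apply: measurable_funN; apply: measurable_funM => //; exact: measurable_quad_form.
  exact: measurable_dotv.
rewrite intH -EFinM mulrCA -expRD; congr (_ * expR _)%:E.
by rewrite quad_form_addv// (dotv_mulmx H) sH; field.
Qed.

Lemma wint_of_integral (F : n.-tuple R -> R) (k : R) :
  measurable_fun setT F -> (forall t, 0 <= F t) ->
  (\int[m]_t (F t * gauss_density t)%:E = k%:E)%E ->
  wint m gauss_density F /\ wE m gauss_density F = k.
Proof.
move=> mF F0 Fk.
have F0' t : 0 <= F t * gauss_density t by rewrite mulr_ge0 ?gauss_density_ge0.
split; last by rewrite /wE /Rintegral Fk.
apply/integrableP; split.
  apply/measurable_EFinP; apply: measurable_funM => //; exact: measurable_gauss_density.
under eq_integral do rewrite /= ger0_norm//.
by rewrite Fk ltry.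
Qed.

(** For [p <= lam]: [D A^-1 D] is nonnegative of trace [p], hence at most [p]. Cauchy-Schwarz for
    [A], between [u] and [A^-1 D e] with [e = D u], transfers this bound to [D *m D] against [A]. *)
Lemma gauss_form_le lam : lam = 1 \/ p <= lam ->
  forall u, quad_form (D *m D) u <= lam * quad_form A u.
Proof.
move=> [-> u|plam u]; first by rewrite mul1r.
have Du : quad_form (D *m D) u = dotv (D *m u) (D *m u).
  by rewrite quad_formE -mulmxA dotv_mulmx sD.
set e := D *m u in Du.
pose M := D *m invmx A *m D; have pM : psd M by exact: psd_sandwich.
have qME v : quad_form M v = quad_form A (invmx A *m (D *m v)).
  exact: quad_form_sandwich.
have qA v : 0 <= quad_form A v.
  have [->|h] := eqVneq v 0; last by apply/ltW; case: pA => _; apply.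
  by rewrite quad_form0.
have trM : \tr M = p by rewrite /M mxtrace_mulC mulmxA.
have h1 := psd_quad_form_le_trace e pM; rewrite trM qME in h1.
have := psd_dotv_sqr_le u (invmx A *m (D *m e)) pA.
rewrite mulKVmx// dotv_mulmx sD -/e => h2.
have : dotv e e ^+ 2 <= quad_form A u * (p * dotv e e).
  by apply: (le_trans h2); rewrite ler_wpM2l.
rewrite Du; have := dotv_ge0 e; rewrite le_eqVlt => /predU1P[<- _|e0].
  rewrite mulr_ge0//; apply: le_trans plam; rewrite -trM.
  exact: psd_trace_ge0.
rewrite expr2 mulrA ler_pM2r// => h; apply: (le_trans h).
by rewrite mulrC ler_wpM2r.
Qed.

(** The integrand is again Gaussian, of precision [H = A - mu D^2]. Its integral is a square root of
    a ratio of determinants times an exponential in [tau ^+ 2]; the two factors are bounded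
    separately. *)
Lemma gauss_mgf lam mu tau : 0 < lam <= 1 -> lam = 1 \/ p <= lam ->
  0 <= mu -> mu * lam < 1 ->
  wint m gauss_density
    (fun t => expR (tau * dotv w (ctr t) + mu / 2 * enorm (D *m ctr t) ^+ 2)) /\
  wE m gauss_density
    (fun t => expR (tau * dotv w (ctr t) + mu / 2 * enorm (D *m ctr t) ^+ 2)) <=
    expR (- (p / (2 * lam)) * ln (1 - mu * lam) + tau ^+ 2 / (2 * (1 - mu * lam))).
Proof.
move=> /andP[lam0 lam1] hlam mu0 mul1; have hDA := gauss_form_le hlam.
have qA v : 0 <= quad_form A v.
  have [->|h] := eqVneq v 0; last by apply/ltW; case: pA => _; apply.
  by rewrite quad_form0.
pose H := A - mu *: (D *m D).
have qH u : quad_form H u = quad_form A u - mu * quad_form (D *m D) u.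
  by rewrite quad_formD quad_formN quad_formZ.
have Hge u : (1 - mu * lam) * quad_form A u <= quad_form H u.
  rewrite qH; have : mu * quad_form (D *m D) u <= mu * (lam * quad_form A u).
    by rewrite ler_wpM2l.
  by lra.
have k0 : 0 < 1 - mu * lam by rewrite subr_gt0.
have pH : posdef H.
  split; first by rewrite /H linearB linearZ/= trmx_mul sD sA.
  move=> u u0; apply: lt_le_trans (Hge u); rewrite mulr_gt0//.
  by case: pA => _; apply.
have Hu := posdef_unit pH.
pose c := invmx H *m (tau *: w).
have Hc : H *m c = tau *: w by rewrite mulKVmx.
have E2 t : enorm (D *m ctr t) ^+ 2 = quad_form (D *m D) (ctr t).
  by rewrite enorm_sqr quad_formE -mulmxA [RHS]dotv_mulmx sD.
have [detA _] := integral_gaussian 0 pA; have [detH _] := integral_gaussian 0 pH.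
have sdA : 0 < Num.sqrt (\det A) by rewrite sqrtr_gt0.
have sdH : 0 < Num.sqrt (\det H) by rewrite sqrtr_gt0.
pose q := Num.sqrt (\det A) / Num.sqrt (\det H) * expR (quad_form H c / 2).
have [| | |i e] := @wint_of_integral
  (fun t => expR (tau * dotv w (ctr t) + mu / 2 * enorm (D *m ctr t) ^+ 2)) q.
- apply: measurableT_comp => //; apply: measurable_funD.
    by apply: measurable_funM => //; exact: measurable_dotv_ctr.
  under eq_fun do rewrite E2.
  by apply: measurable_funM => //; exact: measurable_quad_form_ctr.
- by move=> t; exact: expR_ge0.
- have F t : (expR (tau * dotv w (ctr t) + mu / 2 * enorm (D *m ctr t) ^+ 2) *
       gauss_density t)%:E = ((Num.sqrt (\det A) / c0)%:E *
      (expR (- (quad_form H (ctr t) / 2) + dotv (H *m c) (ctr t)))%:E)%E.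
    rewrite -EFinM /gauss_density invf_div mulrA -expRD mulrC; congr (_ * expR _)%:E.
    by rewrite Hc dotvZl E2 qH; field.
  under eq_integral do rewrite F.
  rewrite ge0_integralZl_EFin//.
  + rewrite integral_gaussian_ctr// -EFinM /q; congr EFin; field.
    by rewrite !gt_eqF.
  + apply/measurable_EFinP; apply: measurableT_comp => //; apply: measurable_funD.
      apply: measurable_funN; apply: measurable_funM => //; exact: measurable_quad_form_ctr.
    exact: measurable_dotv_ctr.
  by rewrite divr_ge0 ?ltW.
split => //; rewrite e /q expRD.
apply: ler_pM; rewrite ?expR_ge0 ?divr_ge0//.
  pose M := D *m invmx A *m D.
  have detHE : \det H = \det A * \det (1%:M - mu *: M).
    have -> : H = A *m (1%:M - (mu *: (invmx A *m D)) *m D).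
      by rewrite mulmxBr mulmx1 -scalemxAl -scalemxAr !mulmxA mulmxV// mul1mx.
    rewrite det_mulmx det_1B_mulmxC; congr (_ * \det (_ - _)).
    by rewrite -scalemxAr mulmxA.
  have sM : M^T = M by rewrite /M !trmx_mul sD invmx_sym// mulmxA.
  have qM u : quad_form M u = quad_form A (invmx A *m (D *m u)).
    rewrite [RHS]quad_formE mulKVmx// dotvC quad_formE /M -!mulmxA.
    by rewrite [LHS]dotv_mulmx sD.
  have Mle u : 0 <= quad_form M u <= lam * dotv u u.
    rewrite qM qA/=; set z := invmx A *m (D *m u).
    have zE : quad_form A z = dotv u (D *m z).
      by rewrite quad_formE [A *m z](mulKVmx Au) dotv_mulmx sD dotvC.
    have := dotv_sqr_le u (D *m z); rewrite -zE => h1.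
    have h2 : dotv (D *m z) (D *m z) <= lam * quad_form A z.
      by have := hDA z; rewrite quad_formE -mulmxA dotv_mulmx sD.
    have := qA z; rewrite le_eqVlt => /predU1P[<-|z0].
      by rewrite mulr_ge0 ?dotv_ge0 ?(ltW lam0).
    rewrite -(ler_pM2r z0) -expr2; apply: (le_trans h1).
    have : dotv u u * dotv (D *m z) (D *m z) <= dotv u u * (lam * quad_form A z).
      by rewrite ler_wpM2l ?dotv_ge0.
    by move=> h; apply: (le_trans h); rewrite mulrCA mulrA.
  have dge := det_1B_ge sM Mle lam0 mu0 mul1.
  have trM : \tr M = p by rewrite /M mxtrace_mulC mulmxA.
  rewrite detHE sqrtrM ?(ltW detA)// invfM mulrA divff ?gt_eqF// mul1r.
  set de := \det _ in dge *.
  have de0 : 0 < de by apply: lt_le_trans dge; exact: expR_gt0.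
  have h : expR (p / (2 * lam) * ln (1 - mu * lam)) <= Num.sqrt de.
    rewrite -(@ler_pXn2r _ 2%N) ?nnegrE ?expR_ge0 ?sqrtr_ge0// sqr_sqrtr ?(ltW de0)//.
    apply: le_trans dge; rewrite -expRM_natl ler_expR trM.
    by rewrite le_eqVlt; apply/orP; left; apply/eqP; field; rewrite gt_eqF.
  by rewrite mulNr expRN lef_pV2 ?posrE ?expR_gt0 ?sqrtr_gt0.
(* The bound on [sg] is closed on itself: the dual norm of [w] gives
   [sg ^+ 2 <= tau ^+ 2 * quad_form A c], and [quad_form A c] is in turn at most
   [sg / (1 - mu * lam)]. *)
rewrite ler_expR; set sg := quad_form H c.
have sgE : sg = tau * dotv c w by rewrite /sg quad_formE Hc dotvZr.
have h1 : sg ^+ 2 <= tau ^+ 2 * quad_form A c.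
  have := psd_dotv_sqr_le c (invmx A *m w) pA; rewrite mulKVmx// => h.
  rewrite sgE exprMn ler_wpM2l ?sqr_ge0//; apply: (le_trans h).
  rewrite -[leRHS]mulr1 ler_wpM2l//; apply: le_trans hw.
  rewrite quad_formE mulKVmx// dotvC quad_formE; exact: lexx.
have h2 : (1 - mu * lam) * quad_form A c <= sg := Hge c.
have sg0 : 0 <= sg by apply: le_trans h2; rewrite mulr_ge0// ltW.
have h3 : sg * (1 - mu * lam) <= tau ^+ 2.
  move: sg0; rewrite le_eqVlt => /predU1P[<-|sg0]; first by rewrite mul0r sqr_ge0.
  rewrite -(ler_pM2r sg0).
  have : sg ^+ 2 * (1 - mu * lam) <= tau ^+ 2 * quad_form A c * (1 - mu * lam).
    by rewrite ler_wpM2r// ltW.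
  have : tau ^+ 2 * ((1 - mu * lam) * quad_form A c) <= tau ^+ 2 * sg.
    by rewrite ler_wpM2l ?sqr_ge0.
  by rewrite expr2; lra.
rewrite -(ler_pdivlMr _ _ k0) in h3.
have -> : tau ^+ 2 / (2 * (1 - mu * lam)) = tau ^+ 2 / (1 - mu * lam) / 2.
  by field; rewrite gt_eqF.
lra.
Qed.

Lemma gauss_wE1 : wint m gauss_density (fun=> 1) /\ wE m gauss_density (fun=> 1) = 1.
Proof.
have [detA _] := integral_gaussian 0 pA.
have sdA : 0 < Num.sqrt (\det A) by rewrite sqrtr_gt0.
apply: wint_of_integral => //.
have F t : (1 * gauss_density t)%:E = ((Num.sqrt (\det A) / c0)%:E *
    (expR (- (quad_form A (ctr t) / 2) + dotv (A *m 0) (ctr t)))%:E)%E.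
  by rewrite -EFinM /gauss_density invf_div mul1r mulmx0 dotv0l addr0 mulrC.
under eq_integral do rewrite F.
rewrite ge0_integralZl_EFin//.
- rewrite integral_gaussian_ctr// -EFinM quad_formE mulmx0 dotv0l mul0r expR0 mulr1.
  by congr EFin; field; rewrite !gt_eqF.
- apply/measurable_EFinP; apply: measurableT_comp => //; apply: measurable_funD.
    apply: measurable_funN; apply: measurable_funM => //; exact: measurable_quad_form_ctr.
  exact: measurable_dotv_ctr.
by rewrite divr_ge0 ?ltW.
Qed.

End gaussian_weight.

(** * Third-order expansions along rays *)

Section continuous_col_measurable.
Context (R : realType) (n : nat).

Lemma measurable_countable_fiber (T : countType) (z : n.-tuple R -> T) :
  (forall c, measurable (z @^-1` [set c])) ->
  forall F : T -> R, measurable_fun setT (F \o z).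
Proof.
move=> mz F _ Y mY; rewrite setTI.
have -> : (F \o z) @^-1` Y = \bigcup_k (if @unpickle T k is Some c then
    (if `[< Y (F c) >] then z @^-1` [set c] else set0) else set0).
  apply/seteqP; split => t /=.
    by move=> h; exists (pickle (z t)) => //; rewrite pickleK; case: asboolP.
  by move=> [k _]; case: (unpickle k) => //= c; case: asboolP => //= h ->.
apply: bigcupT_measurable => k; case: (unpickle k) => // c.
by case: asboolP.
Qed.

Let rnd (k : nat) (t : n.-tuple R) : {ffun 'I_n -> int} :=
  [ffun i => Num.floor (k.+1%:R * tnth t i)].

Let unrnd (k : nat) (z : {ffun 'I_n -> int}) : 'cV[R]_n := \col_i ((z i)%:~R / k.+1%:R).

(* Rounding the coordinates to multiples of [1 / (k + 1)] gives countably valued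
   measurable approximations. *)
Lemma measurable_continuous_col (f : 'cV[R]_n -> R) : continuous f ->
  measurable_fun setT (fun t : n.-tuple R => f (col_of_tuple t)).
Proof.
move=> cf; pose F k t := f (unrnd k (rnd k t)).
apply: (@measurable_fun_cvg _ _ R setT F) => [k|t _].
  apply: (@measurable_countable_fiber _ (rnd k) _ (f \o unrnd k)) => c.
  have -> : rnd k @^-1` [set c] = \bigcap_(i in [set: 'I_n])
      [set t | (c i)%:~R <= k.+1%:R * tnth t i < (c i + 1)%:~R].
    apply/seteqP; split => t /=.
      by move=> <- i _ /=; rewrite ffunE floor_itv.
    move=> h; apply/ffunP => i; rewrite ffunE; apply: floor_def.
    exact: (h i).
  apply: fin_bigcap_measurable => [|i _]; first exact: finite_finset.
  have mi : measurable_fun setT (fun t : n.-tuple R => k.+1%:R * tnth t i).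
    by apply: measurable_funM => //; exact: measurable_tnth.
  have mb : measurable_fun setT
      (fun t : n.-tuple R => (c i)%:~R <= k.+1%:R * tnth t i < (c i + 1)%:~R).
    by apply: measurable_and; [exact: measurable_fun_ler|exact: measurable_fun_ltr].
  by have := mb measurableT [set true]; rewrite setTI; apply.
apply: continuous_cvg; first exact: cf.
apply/cvg_ballP => e e0; near=> k; split => // i j; rewrite ord1 /ball/= !mxE ffunE.
have k0 : 0 < k.+1%:R :> R by rewrite ltr0n.
have /andP[h1 h2] := floor_itv (k.+1%:R * tnth t i).
set z := Num.floor _ in h1 h2 *; rewrite intrD in h2.
have h1' : z%:~R / k.+1%:R <= tnth t i by rewrite ler_pdivrMr// mulrC.
have h2' : tnth t i - z%:~R / k.+1%:R < k.+1%:R^-1.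
  rewrite ltrBlDr -[X in _ < X + _]mul1r -mulrDl ltr_pdivlMr// mulrC addrC.
  exact: h2.
rewrite ger0_norm ?subr_ge0//; apply: (lt_trans h2').
near: k; exact: near_infty_natSinv_lt (PosNum e0).
Unshelve. all: by end_near. Qed.

End continuous_col_measurable.

(** * Derivatives along rays, Taylor bounds and tangents of convex functions *)

Section calculus.
Context (R : realType).

(** Both difference quotients are the same function, so rules for one real variable also serve for
    directional derivatives. *)
Lemma is_derive_ray n (F : 'cV[R]_n -> R) (x u : 'cV[R]_n) (t d : R) :
  is_derive t (1 : R) (fun s : R => F (x + s *: u)) d <-> is_derive (x + t *: u) u F d.
Proof.
have E : (fun h : R => h^-1 *: (((fun s : R => F (x + s *: u)) \o shift t) (h *: (1 : R)) -
    F (x + t *: u))) =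
  (fun h : R => h^-1 *: ((F \o shift (x + t *: u)) (h *: u) - F (x + t *: u))).
  apply/funext => h /=; congr (_ *: (F _ - _)).
  by rewrite /shift/= [h *: _]mulr1 scalerDl addrCA.
by split => -[dF vF]; apply: DeriveDef; move: dF vF; rewrite /derivable /derive E.
Qed.

Lemma differentiable_is_derive n (F : 'cV[R]_n -> R) (x u : 'cV[R]_n) :
  differentiable F x -> is_derive x u F (\sum_i partial i F x * u i 0).
Proof.
move=> dF; apply: DeriveDef; first exact: diff_derivable.
rewrite deriveE// {1}(_ : u = \sum_i u i 0 *: delta_mx i 0); last first.
  by rewrite [LHS]matrix_sum_delta; apply: eq_bigr => i _; rewrite big_ord1.
rewrite linear_sum; apply: eq_bigr => i _.
by rewrite linearZ/= /partial deriveE// mulrC.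
Qed.

Lemma is_derive_partial n (F : 'cV[R]_n -> R) (x : 'cV[R]_n) i :
  differentiable F x -> is_derive x (delta_mx i 0) F (partial i F x).
Proof. by move=> dF; apply: DeriveDef => //; exact: diff_derivable. Qed.

Lemma partial_is_derive n (F : 'cV[R]_n -> R) (x : 'cV[R]_n) i (d : R) :
  is_derive x (delta_mx i 0) F d -> partial i F x = d.
Proof. by case. Qed.

Definition dir1 n (F : 'cV[R]_n -> R) (u x : 'cV[R]_n) : R :=
  \sum_k partial k F x * u k 0.
Definition dir2 n (F : 'cV[R]_n -> R) (u x : 'cV[R]_n) : R :=
  \sum_k (\sum_j partial j (partial k F) x * u j 0) * u k 0.
Definition dir3 n (F : 'cV[R]_n -> R) (u x : 'cV[R]_n) : R :=
  \sum_k (\sum_j (\sum_i partial i (partial j (partial k F)) x * u i 0) * u j 0) * u k 0.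

Lemma is_derive_sumM n (h : 'I_n -> R -> R) (dh : 'I_n -> R) (c : 'I_n -> R) (t : R) :
  (forall k, is_derive t (1 : R) (h k) (dh k)) ->
  is_derive t (1 : R) (fun s => \sum_k h k s * c k) (\sum_k dh k * c k).
Proof.
move=> dhk.
have -> : (fun s => \sum_k h k s * c k) = \sum_k (c k *: h k).
  apply/funext => s; rewrite fct_sumE; apply: eq_bigr => k _.
  by rewrite mulrC.
have -> : \sum_k dh k * c k = \sum_k (c k *: dh k).
  by apply: eq_bigr => k _; rewrite mulrC.
by apply: is_derive_sum => k; exact: is_deriveZ.
Qed.

Lemma Ck3_ray n (F : 'cV[R]_n -> R) (x u : 'cV[R]_n) : Ck 3 F ->
  [/\ forall t : R, is_derive t (1 : R) (fun s : R => F (x + s *: u)) (dir1 F u (x + t *: u)),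
      forall t : R, is_derive t (1 : R) (fun s : R => dir1 F u (x + s *: u)) (dir2 F u (x + t *: u)) &
      forall t : R, is_derive t (1 : R) (fun s : R => dir2 F u (x + s *: u)) (dir3 F u (x + t *: u))].
Proof.
move=> [d0 C1]; have d1 k := (C1 k).1; have d2 k j := ((C1 k).2 j).1.
split => t.
- by apply/is_derive_ray; exact: differentiable_is_derive.
- apply: is_derive_sumM => k; apply/is_derive_ray.
  exact: differentiable_is_derive (d1 k _).
- apply: is_derive_sumM => k; apply: is_derive_sumM => j; apply/is_derive_ray.
  exact: differentiable_is_derive (d2 k j _).
Qed.

Lemma dir2E n (F : 'cV[R]_n -> R) (u x : 'cV[R]_n) : dir2 F u x = quad_form (hessian F x) u.
Proof.
rewrite quad_formE dotvE; under [RHS]eq_bigr do rewrite mxE mulr_sumr.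
rewrite exchange_big/=; apply: eq_bigr => k _; rewrite mulr_suml; apply: eq_bigr => j _.
by rewrite mxE; ring.
Qed.

Lemma dir3E n (F : 'cV[R]_n -> R) (u x : 'cV[R]_n) : dir3 F u x = third_form F x u.
Proof.
rewrite /third_form.
under [RHS]eq_bigr do rewrite exchange_big/=.
rewrite [RHS]exchange_big/=.
under [RHS]eq_bigr do rewrite exchange_big/=.
apply: eq_bigr => k _; rewrite mulr_suml; apply: eq_bigr => j _.
rewrite !mulr_suml; apply: eq_bigr => i _; ring.
Qed.

(** The lower bound on [g3] is integrated three times from [0]. The negated functions give the
    matching upper bound. *)
Lemma taylor3_ge (g0 g1 g2 g3 : R -> R) (K : R) :
  (forall t : R, is_derive t (1 : R) g0 (g1 t)) -> (forall t : R, is_derive t (1 : R) g1 (g2 t)) ->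
  (forall t : R, is_derive t (1 : R) g2 (g3 t)) -> g0 0 = 0 -> g1 0 = 0 ->
  (forall t, 0 <= t <= 1 -> - K <= g3 t) ->
  g2 0 / 2 - K / 6 <= g0 1 /\ g2 0 - K / 2 <= g1 1.
Proof.
move=> D0 D1 D2 z0 z1 hK.
have h2 t : 0 <= t -> t <= 1 -> 0 <= g2 t - g2 0 + K * t.
  apply: (@derive_ge0_ge0 R (fun t => g2 t - g2 0 + K * t) (fun t => g3 t + K) 1 _ _ _ t); last first.
  - by move=> s /hK; lra.
  - by rewrite subrr mulr0 addr0.
  by move=> s; apply: is_derive_eq; rewrite /GRing.scale/=; ring.
have h1 t : 0 <= t -> t <= 1 -> 0 <= g1 t - g2 0 * t + K / 2 * t ^+ 2.
  apply: (@derive_ge0_ge0 R (fun t => g1 t - g2 0 * t + K / 2 * t ^+ 2) (fun t => g2 t - g2 0 + K * t) 1 _ _ _ t); last first.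
  - by move=> s /andP[s0 s1]; exact: h2.
  - by rewrite z1 !mulr0 expr0n/= mulr0 subrr addr0.
  by move=> s; apply: is_derive_eq; rewrite /GRing.scale/=; field.
have h0 t : 0 <= t -> t <= 1 -> 0 <= g0 t - g2 0 / 2 * t ^+ 2 + K / 6 * t ^+ 3.
  apply: (@derive_ge0_ge0 R (fun t => g0 t - g2 0 / 2 * t ^+ 2 + K / 6 * t ^+ 3) (fun t => g1 t - g2 0 * t + K / 2 * t ^+ 2) 1 _ _ _ t); last first.
  - by move=> s /andP[s0 s1]; exact: h1.
  - by rewrite z0 !expr0n/= !mulr0 subrr addr0.
  by move=> s; apply: is_derive_eq; rewrite /GRing.scale/=; field.
by split; [have := h0 1 ler01 (lexx _)|have := h1 1 ler01 (lexx _)];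
  rewrite ?expr1n; lra.
Qed.

Lemma slope_le (F : R -> R) (d c : R) : is_derive (0 : R) (1 : R) F d ->
  (forall s, 0 < s < 1 -> F s <= F 0 + c * s) -> d <= c.
Proof.
move=> [dF <-] h; rewrite ['D_1 F 0]cvg_at_rightE; last exact: dF.
apply: limr_le.
  rewrite -(cvg_at_rightE (fun h : R => h^-1 *: ((F \o shift 0) _ - F 0))) //.
  apply: cvg_trans dF; apply: cvg_app.
  move=> A [e egt0 Ae]; exists e => // x xe xgt0; apply: Ae => //.
  exact/lt0r_neq0.
near=> s.
have s0 : 0 < s by near: s; exact: nbhs_right_gt.
have s1 : s < 1 by near: s; exact: nbhs_right_lt.
rewrite /= /shift/= [s *: 1]mulr1 addr0 [_ *: _]mulrC ler_pdivrMr//.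
by rewrite lerBlDl h// s0.
Unshelve. all: by end_near. Qed.

Lemma convex_function_le n (F : 'cV[R]_n -> R) (x y : 'cV[R]_n) (s : R) :
  convex_function setT F -> 0 <= s <= 1 ->
  F (x + s *: (y - x)) <= F x + s * (F y - F x).
Proof.
move=> cF /andP[s0 s1].
pose t : {i01 R} := Itv01 s0 s1.
have h : F (s *: y + (1 - s) *: x) <= s * F y + (1 - s) * F x.
  exact: (cF t y x (in_setT _) (in_setT _)).
have -> : x + s *: (y - x) = s *: y + (1 - s) *: x.
  by rewrite scalerBl scale1r scalerBr addrCA.
lra.
Qed.

Lemma convex_tangent n (F : 'cV[R]_n -> R) (x u : 'cV[R]_n) (d : R) :
  convex_function setT F -> is_derive (0 : R) (1 : R) (fun s : R => F (x + s *: u)) d ->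
  F x + d <= F (x + u).
Proof.
move=> cF dF; suff : d <= F (x + u) - F x by lra.
apply: (slope_le dF) => s /andP[s0 s1].
have hs : 0 <= s <= 1 by rewrite (ltW s0) (ltW s1).
have := convex_function_le x (x + u) cF hs.
by rewrite addrAC subrr add0r scale0r addr0 mulrC.
Qed.

End calculus.

(** * Pointwise bounds on [dl] from strong concavity and the third-order hypothesis *)

Section strongly_log_concave.
Context (R : realType) (n : nat).
Variables (f : 'cV[R]_n -> R) (xs : 'cV[R]_n) (G D : 'M[R]_n) (N m : R).
Variable h : 'cV[R]_n -> R.
Let A := - hessian f xs.
Let B := G *m G.
Hypotheses (C3 : Ck 3 f) (fmax : forall y, f y <= f xs) (sG : G^T = G) (sD : D^T = D).
Hypotheses (DD : D *m D = A - B) (N0 : 0 < N) (m0 : 0 < m).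
Hypothesis hE : forall y, - (f y + 2^-1 * enorm (G *m (y - xs)) ^+ 2) = N * h y.
Hypothesis h_convex : convex_function setT (fun y => h y - m / 2 * enorm y ^+ 2).

Let df y : differentiable f y. Proof. by case: C3. Qed.

Let sB : B^T = B. Proof. by rewrite /B trmx_mul sG. Qed.

Let qB y : enorm (G *m y) ^+ 2 = quad_form B y.
Proof. by rewrite enorm_sqr quad_formE /B -mulmxA [RHS]dotv_mulmx sG. Qed.

Let hfE : h = fun y => - N^-1 * (f y + 2^-1 * quad_form B (y - xs)).
Proof.
apply/funext => y; have := hE y; rewrite qB => e.
rewrite mulNr -mulrN e mulrA mulVf ?mul1r// gt_eqF//.
Qed.

Lemma is_derive_quad_form (y v : 'cV[R]_n) :
  is_derive y v (fun z => 2^-1 * quad_form B (z - xs)) (dotv v (B *m (y - xs))).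
Proof.
have -> : y = y + 0 *: v by rewrite scale0r addr0.
apply/is_derive_ray; rewrite scale0r addr0.
have -> : (fun s : R => 2^-1 * quad_form B (y + s *: v - xs)) =
  (fun s : R => 2^-1 * quad_form B (y - xs) + s * dotv v (B *m (y - xs)) +
     s ^+ 2 * (2^-1 * quad_form B v)).
  apply/funext => s; have -> : y + s *: v - xs = y - xs + s *: v by rewrite addrAC.
  rewrite quad_form_addv// quad_form_scale -scalemxAr dotvZr.
  have -> : dotv (y - xs) (B *m v) = dotv v (B *m (y - xs)) by rewrite dotv_mulmx sB dotvC.
  by field.
by apply: is_derive_eq; rewrite /GRing.scale/=; ring.
Qed.

Lemma is_derive_dotv_mulmx (a y v : 'cV[R]_n) :
  is_derive y v (fun z => dotv a (B *m (z - xs))) (dotv a (B *m v)).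
Proof.
have -> : y = y + 0 *: v by rewrite scale0r addr0.
apply/is_derive_ray.
have -> : (fun s : R => dotv a (B *m (y + s *: v - xs))) =
  (fun s : R => dotv a (B *m (y - xs)) + s * dotv a (B *m v)).
  by apply/funext => s; rewrite addrAC mulmxDr dotvDr -scalemxAr dotvZr.
by apply: is_derive_eq; rewrite /GRing.scale/=; ring.
Qed.

Lemma is_derive_sqr_enorm (y v : 'cV[R]_n) :
  is_derive y v (fun z => enorm z ^+ 2) (2 * dotv y v).
Proof.
have -> : y = y + 0 *: v by rewrite scale0r addr0.
apply/is_derive_ray; rewrite scale0r addr0.
have -> : (fun s : R => enorm (y + s *: v) ^+ 2) =
  (fun s : R => dotv y y + s * (2 * dotv y v) + s ^+ 2 * dotv v v).
  apply/funext => s; rewrite enorm_sqr !dotvDl !dotvDr !dotvZl !dotvZr (dotvC v y); ring.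
by apply: is_derive_eq; rewrite /GRing.scale/=; ring.
Qed.

Lemma is_derive_affine (F1 F2 : 'cV[R]_n -> R) (c a1 a2 : R) (y v : 'cV[R]_n) :
  is_derive y v F1 a1 -> is_derive y v F2 a2 ->
  is_derive y v (fun z => c * (F1 z + F2 z)) (c * (a1 + a2)).
Proof. by move=> d1 d2; apply: is_deriveZ; exact: is_deriveD. Qed.

Lemma partial_h k : partial k h =
  fun y => - N^-1 * (partial k f y + dotv (delta_mx k 0) (B *m (y - xs))).
Proof.
apply/funext => y; apply: partial_is_derive; rewrite hfE.
apply: is_derive_affine; last exact: is_derive_quad_form.
exact: is_derive_partial.
Qed.

Lemma partial2_h j k : partial j (partial k h) =
  fun y => - N^-1 * (partial j (partial k f) y + dotv (delta_mx k 0) (B *m delta_mx j 0)).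
Proof.
apply/funext => y; apply: partial_is_derive; rewrite partial_h.
apply: is_derive_affine; last exact: is_derive_dotv_mulmx.
by apply: is_derive_partial; case: C3 => _ /(_ k) [].
Qed.

(** The quadratic term has no third derivative, so the hypothesis on [h] is one on [f]. *)
Lemma third_form_h y u : third_form h y u = - N^-1 * third_form f y u.
Proof.
rewrite /third_form mulr_sumr; apply: eq_bigr => i _.
rewrite mulr_sumr; apply: eq_bigr => j _; rewrite mulr_sumr; apply: eq_bigr => k _.
rewrite !mulrA; congr (_ * _ * _ * _).
apply: partial_is_derive; rewrite partial2_h.
have d : is_derive y (delta_mx i 0) (partial j (partial k f))
    (partial i (partial j (partial k f)) y).
  by apply: is_derive_partial; case: C3 => _ /(_ k) [_ /(_ j)] [].
have := is_derive_affine (- N^-1) d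
  (is_derive_cst (dotv (delta_mx k 0) (B *m delta_mx j 0)) y (delta_mx i 0)).
by rewrite addr0.
Qed.

Lemma quad_form_hessian_h u : quad_form (hessian h xs) u = enorm (D *m u) ^+ 2 / N.
Proof.
rewrite enorm_sqr; have -> : dotv (D *m u) (D *m u) = quad_form (D *m D) u.
  by rewrite quad_formE -mulmxA [RHS]dotv_mulmx sD.
rewrite mulrC -quad_formZ; congr quad_form; rewrite DD.
apply/matrixP => i j.
have dB : dotv (delta_mx j 0) (B *m delta_mx i 0) = B j i.
  by rewrite dotv_deltal -colE mxE.
rewrite !mxE partial2_h dB -[in B j i]sB mxE.
by rewrite /A !mxE; ring.
Qed.

Lemma sqr_enorm_D u : enorm (D *m u) ^+ 2 = quad_form A u - quad_form B u.
Proof.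
rewrite enorm_sqr -quad_formN -quad_formD -DD quad_formE -mulmxA.
by rewrite [RHS]dotv_mulmx sD.
Qed.

Lemma dir1_max u : dir1 f u xs = 0.
Proof.
have [d1 _ _] := Ck3_ray xs u C3.
have [e1] : is_derive (0 : R) (1 : R) (fun s : R => f (xs + s *: u)) 0.
  apply: (@derive1_at_max _ _ (-1) 1).
  - lra.
  - by move=> t _; case: (d1 t).
  - by rewrite in_itv/=; apply/andP; split; lra.
  - by move=> t _; rewrite scale0r addr0.
by have := d1 0; rewrite scale0r addr0 => -[_ ->].
Qed.

Lemma dir1Z (F : 'cV[R]_n -> R) (c : R) u y : dir1 F (c *: u) y = c * dir1 F u y.
Proof.
rewrite /dir1 mulr_sumr; apply: eq_bigr => k _; rewrite mxE; ring.
Qed.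

Let ka := N * m.
Let ka0 : 0 < ka. Proof. exact: mulr_gt0. Qed.
Let q y : R := 2^-1 * quad_form B (y - xs).

(** This is [N] times the tangent inequality of [h] minus its quadratic part; the squared norms
    recombine into the gain [ka / 2 * dotv v v]. *)
Lemma strong_tangent y v : f (y + v) + q (y + v) + ka / 2 * dotv v v <=
  f y + q y + dir1 f v y + dotv v (B *m (y - xs)).
Proof.
have d : is_derive (0 : R) (1 : R)
    (fun s : R => h (y + s *: v) - m / 2 * enorm (y + s *: v) ^+ 2)
    (- N^-1 * (dir1 f v y + dotv v (B *m (y - xs))) - m / 2 * (2 * dotv y v)).
  apply/(is_derive_ray (fun z => h z - m / 2 * enorm z ^+ 2)); rewrite scale0r addr0.
  apply: is_deriveB; last by apply: is_deriveZ; exact: is_derive_sqr_enorm.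
  rewrite hfE; apply: is_derive_affine; last exact: is_derive_quad_form.
  exact: differentiable_is_derive.
have := convex_tangent h_convex d; rewrite hfE /=.
rewrite -(ler_pM2l N0) !enorm_sqr !dotvDl !dotvDr (dotvC v y) -/(q _) -/(q _).
have -> : N * (- N^-1 * (f y + q y) - m / 2 * dotv y y +
   (- N^-1 * (dir1 f v y + dotv v (B *m (y - xs))) - m / 2 * (2 * dotv y v))) =
  - (f y + q y) - ka / 2 * dotv y y - (dir1 f v y + dotv v (B *m (y - xs))) - ka * dotv y v.
  by rewrite /ka; field; rewrite gt_eqF.
have -> : N * (- N^-1 * (f (y + v) + q (y + v)) -
    m / 2 * (dotv y y + dotv y v + (dotv y v + dotv v v))) =
  - (f (y + v) + q (y + v)) - ka / 2 * dotv y y - ka * dotv y v - ka / 2 * dotv v v.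
  by rewrite /ka; field; rewrite gt_eqF.
lra.
Qed.

(** The gradient of [f] vanishes at its maximizer. The outcome dominates [expR f] by a Gaussian,
    whence all integrability. *)
Lemma growth u : f (xs + u) + quad_form B u / 2 + ka / 2 * dotv u u <= f xs.
Proof.
have := strong_tangent xs u; rewrite /q dir1_max !subrr mulmx0 dotv0r quad_form0.
by rewrite mulr0 !addr0 [xs + u - xs]addrAC subrr add0r [2^-1 * _]mulrC.
Qed.

(* The ray function [g t = l xs - l (xs + t u)] and its first three derivatives. *)
Let g0 u (t : R) := f xs - f (xs + t *: u) - t ^+ 2 * (quad_form B u / 2).
Let g1 u (t : R) := - dir1 f u (xs + t *: u) - t * quad_form B u.
Let g2 u (t : R) := - dir2 f u (xs + t *: u) - quad_form B u.
Let g3 u (t : R) := - dir3 f u (xs + t *: u).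

Lemma ray_derivatives u : [/\ forall t : R, is_derive t (1 : R) (g0 u) (g1 u t),
   forall t : R, is_derive t (1 : R) (g1 u) (g2 u t) &
   forall t : R, is_derive t (1 : R) (g2 u) (g3 u t)].
Proof.
have [d1 d2 d3] := Ck3_ray xs u C3; split => t.
- rewrite /g0 /g1; have := d1 t => d.
  by apply: is_derive_eq; rewrite /GRing.scale/=; field.
- rewrite /g1 /g2; have := d2 t => d.
  by apply: is_derive_eq; rewrite /GRing.scale/=; ring.
- rewrite /g2 /g3; have := d3 t => d.
  by apply: is_derive_eq; rewrite /GRing.scale/=; ring.
Qed.

Lemma ray0 u : [/\ g0 u 0 = 0, g1 u 0 = 0 & g2 u 0 = enorm (D *m u) ^+ 2].
Proof.
rewrite /g0 /g1 /g2 scale0r addr0 dir1_max dir2E sqr_enorm_D /A quad_formN; split.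
- by rewrite subrr expr0n/= mul0r subrr.
- by rewrite mul0r subr0 oppr0.
- by [].
Qed.

(** Adding the strong tangent inequalities from [xs] to [xs + s *: u] and back gives
    [g1 u s >= ka * s * dotv u u]; the left side of the claim is compared with the slope of [g1 u]
    at [0]. In particular [D] is injective. *)
Lemma sqr_enorm_D_ge u : ka * dotv u u <= enorm (D *m u) ^+ 2.
Proof.
have [_ d2 _] := ray_derivatives u; have [_ g10 <-] := ray0 u.
have dn : is_derive (0 : R) (1 : R) (- g1 u) (- g2 u 0) by apply: is_deriveN; exact: d2.
rewrite -lerN2; apply: (slope_le dn).
move=> s /andP[s0 s1]; rewrite /= !fctE g10 oppr0 add0r.
have := strong_tangent (xs + s *: u) (- s *: u).
have -> : xs + s *: u + - s *: u = xs by rewrite scaleNr addrK.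
have e : xs + s *: u - xs = s *: u by rewrite addrAC subrr add0r.
rewrite /q e subrr quad_form0 dir1Z !dotvZl !dotvZr -scalemxAr dotvZr quad_form_scale.
rewrite -quad_formE => h1.
have := growth (s *: u); rewrite quad_form_scale dotvZl dotvZr => h2.
rewrite /g1 -(ler_pM2l s0).
lra.
Qed.

Lemma enorm_D_gt0 u : u != 0 -> 0 < enorm (D *m u).
Proof.
move=> u0; rewrite lt_neqAle enorm_ge0 andbT eq_sym; apply/negP => /eqP e.
have := sqr_enorm_D_ge u; rewrite e expr0n/= leNgt mulr_gt0//.
by rewrite lt_neqAle dotv_ge0 eq_sym dotv_eq0 u0.
Qed.

Variables (r w : R).
Hypotheses (r0 : 0 < r) (w0 : 0 <= w).
Hypothesis third_le : forall u, enorm (D *m u) <= r -> u != 0 ->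
  forall t : R, 0 <= t <= 1 -> `|third_form f (xs + t *: u) u| <= w * enorm (D *m u) ^+ 3.

Let dl u := f (xs + u) - f xs + quad_form A u / 2.

Let dlE u : dl u = enorm (D *m u) ^+ 2 / 2 - g0 u 1.
Proof. by rewrite /dl sqr_enorm_D /g0 scale1r expr1n mul1r; field. Qed.

Lemma taylor_ray u : enorm (D *m u) <= r ->
  [/\ `|dl u| <= w * enorm (D *m u) ^+ 3 / 6 &
      enorm (D *m u) ^+ 2 - w * enorm (D *m u) ^+ 3 / 2 <= g1 u 1].
Proof.
move=> ur; have [d1 d2 d3] := ray_derivatives u; have [z0 z1 z2] := ray0 u.
set Z := enorm (D *m u) in ur z2 *.
have g3b t : 0 <= t <= 1 -> `|g3 u t| <= w * Z ^+ 3.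
  have [->|u0] := eqVneq u 0.
    move=> _; rewrite /g3 /dir3 big1 ?oppr0 ?normr0 => [|k _].
      by rewrite mulr_ge0 ?exprn_ge0 ?enorm_ge0.
    by rewrite mxE mulr0.
  by move=> ht; rewrite /g3 normrN dir3E; exact: third_le.
have lo t : 0 <= t <= 1 -> - (w * Z ^+ 3) <= g3 u t.
  by move=> /g3b; rewrite ler_norml => /andP[].
have hi t : 0 <= t <= 1 -> - (w * Z ^+ 3) <= - g3 u t.
  by move=> /g3b; rewrite ler_norml => /andP[_ h3]; rewrite lerN2.
have [a1 a2] := taylor3_ge d1 d2 d3 z0 z1 lo.
have n1 (t : R) : is_derive t (1 : R) (- g0 u) (- g1 u t) by apply: is_deriveN; exact: d1.
have n2 (t : R) : is_derive t (1 : R) (- g1 u) (- g2 u t) by apply: is_deriveN; exact: d2.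
have n3 (t : R) : is_derive t (1 : R) (- g2 u) (- g3 u t) by apply: is_deriveN; exact: d3.
have nz0 : (- g0 u) 0 = 0 by rewrite fctE z0 oppr0.
have nz1 : (- g1 u) 0 = 0 by rewrite fctE z1 oppr0.
have [b1 _] := taylor3_ge n1 n2 n3 nz0 nz1 hi.
rewrite !fctE z2 in b1; rewrite z2 in a1 a2.
by split => //; rewrite dlE ler_norml -/Z; apply/andP; split; lra.
Qed.

Lemma dl_le_half u : dl u <= enorm (D *m u) ^+ 2 / 2.
Proof.
rewrite dlE gerBl /g0 scale1r expr1n mul1r; have := growth u.
have : 0 <= ka / 2 * dotv u u by rewrite mulr_ge0 ?dotv_ge0// divr_ge0// ltW.
lra.
Qed.

Lemma dl_out_le u : r < enorm (D *m u) -> dl u <=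
  (enorm (D *m u) - r) ^+ 2 / 2 + w * r ^+ 3 / 6 + w * r ^+ 2 * (enorm (D *m u) - r) / 2.
Proof.
set Z := enorm (D *m u) => rZ; have Z0 : 0 < Z by exact: lt_trans rZ.
(* [v] is the point of the ray at radius [r] and [u = v + k *: v], so the slope at [v] towards [u]
   is [k] times the one in [taylor_ray], whose two conclusions are both used. *)
pose v := (r / Z) *: u; pose k := Z / r - 1.
have enormZ (c : R) (y : 'cV[R]_n) : 0 <= c -> enorm (c *: y) = c * enorm y.
  move=> c0; apply/eqP; rewrite -(@eqrXn2 _ 2%N) ?enorm_ge0 ?mulr_ge0 ?enorm_ge0//.
  by rewrite exprMn !enorm_sqr dotvZl dotvZr mulrA.
have vr : enorm (D *m v) = r.
  by rewrite /v -scalemxAr enormZ ?divr_ge0 ?ltW// -/Z divfK// gt_eqF.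
have [] := @taylor_ray v; rewrite vr// dlE vr /g0 /g1 !scale1r expr1n !mul1r.
have k0 : 0 < k by rewrite /k subr_gt0 ltr_pdivlMr// mul1r.
have uE : u = v + k *: v.
  rewrite -[X in X + _]scale1r -scalerDl /k addrC subrK /v scalerA.
  by rewrite mulrA divfK ?gt_eqF// divff ?gt_eqF// scale1r.
have := strong_tangent (xs + v) (k *: v).
have -> : xs + v + k *: v = xs + u by rewrite [in RHS]uE addrA.
have e y : xs + y - xs = y by rewrite addrAC subrr add0r.
rewrite /q !e dir1Z [dotv (k *: v) (B *m _)]dotvZl -quad_formE => h1.
have h2 : 0 <= ka / 2 * dotv (k *: v) (k *: v).
  by rewrite mulr_ge0 ?dotv_ge0// divr_ge0// ltW.
rewrite ler_norml => /andP[h3 h4] h5.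
rewrite dlE -/Z /g0 scale1r expr1n mul1r.
have h6 : k * (r ^+ 2 - w * r ^+ 3 / 2) <= k * (- dir1 f v (xs + v) - quad_form B v).
  by rewrite ler_wpM2l// ltW.
have -> : (Z - r) ^+ 2 / 2 + w * r ^+ 3 / 6 + w * r ^+ 2 * (Z - r) / 2 =
  Z ^+ 2 / 2 - (r ^+ 2 / 2 - w * r ^+ 3 / 6 + k * (r ^+ 2 - w * r ^+ 3 / 2)).
  by rewrite /k; field; rewrite gt_eqF.
lra.
Qed.

End strongly_log_concave.

(** * Integrability of the Gibbs density and its mean as a tilted Gaussian mean *)

Section gibbs_integrals.
Context (R : realType) (n : nat).
Variables (f : 'cV[R]_n -> R) (xs : 'cV[R]_n) (A : 'M[R]_n) (ka : R).
Hypotheses (pA : posdef A) (ka0 : 0 < ka) (cf : continuous f).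
Hypothesis fdecay : forall u, f (xs + u) + ka / 2 * dotv u u <= f xs.

Local Notation m := (lebesgue_tuple R n).
Local Notation gd := (gauss_density A xs).
Let ctr (t : n.-tuple R) : 'cV[R]_n := col_of_tuple t - xs.
Let dl t := f (col_of_tuple t) - f xs + quad_form A (ctr t) / 2.
Let z : R := Num.sqrt (2 * pi) ^+ n / Num.sqrt (\det A).

Let z0 : 0 < z.
Proof.
have [dA _] := integral_gaussian 0 pA.
by rewrite divr_gt0 ?sqrtr_gt0// exprn_gt0// sqrtr_gt0 mulr_gt0// pi_gt0.
Qed.

Let mf : measurable_fun setT (fun t : n.-tuple R => f (col_of_tuple t)).
Proof. exact: measurable_continuous_col. Qed.

Lemma measurable_dl : measurable_fun setT dl.
Proof.
apply: measurable_funD; first exact: measurable_funB.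
by apply: measurable_funM => //; exact: measurable_quad_form_ctr.
Qed.

Let expR_dl t : expR (dl t) * gd t = expR (f (col_of_tuple t) - f xs) / z.
Proof.
by rewrite /gauss_density -/z mulrA -expRD; congr (expR _ / _); rewrite /dl addrK.
Qed.

Let expR_dl_le t : expR (dl t) * gd t <= z^-1 * expR (- (ka / 2 * dotv (ctr t) (ctr t))).
Proof.
rewrite expR_dl mulrC ler_wpM2l ?invr_ge0 ?(ltW z0)// ler_expR.
have e : xs + ctr t = col_of_tuple t by rewrite addrC subrK.
have := fdecay (ctr t); rewrite e; lra.
Qed.

Let H : 'M[R]_n := ka%:M.

Let quadH u : quad_form H u = ka * dotv u u.
Proof. by rewrite quad_formE mul_scalar_mx dotvZr. Qed.

Let pH : posdef H.
Proof.
split; first by rewrite tr_scalar_mx.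
move=> u u0; rewrite quadH mulr_gt0// lt_neqAle dotv_ge0 andbT eq_sym.
by rewrite dotv_eq0.
Qed.

Let int_gauss b : m.-integrable setT (EFin \o (fun t =>
  expR (- (ka / 2 * dotv (ctr t) (ctr t)) + dotv b (ctr t)))).
Proof.
have mF : measurable_fun setT (fun t =>
    expR (- (ka / 2 * dotv (ctr t) (ctr t)) + dotv b (ctr t))).
  have -> : (fun t => expR (- (ka / 2 * dotv (ctr t) (ctr t)) + dotv b (ctr t))) =
      (fun t => expR (- (quad_form H (ctr t) / 2) + dotv b (ctr t))).
    by apply/funext => t; rewrite quadH; congr expR; field.
  apply: measurableT_comp => //; apply: measurable_funD.
    apply: measurable_funN; apply: measurable_funM => //; exact: measurable_quad_form_ctr.
  exact: measurable_dotv_ctr.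
apply/integrableP; split; first exact/measurable_EFinP.
have E t : (`|(EFin \o (fun t => expR (- (ka / 2 * dotv (ctr t) (ctr t)) + dotv b (ctr t)))) t|)%E =
   (expR (- (quad_form H (ctr t) / 2) + dotv (H *m (ka^-1 *: b)) (ctr t)))%:E.
  rewrite /= ger0_norm ?expR_ge0// quadH mul_scalar_mx scalerA divff ?gt_eqF// scale1r.
  by congr (expR _)%:E; field.
under eq_integral do rewrite E.
by rewrite (integral_gaussian_ctr xs (ka^-1 *: b) pH) ltry.
Qed.

Lemma int_expR_dl : wint m gd (fun t => expR (dl t)).
Proof.
have i0 := integrableZl measurableT z^-1 (int_gauss 0).
apply: le_integrable i0 => //.
  apply/measurable_EFinP; apply: measurable_funM.
    by apply: measurableT_comp => //; exact: measurable_dl.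
  exact: measurable_gauss_density.
move=> t _ /=; rewrite lee_fin dotv0l addr0 ger0_norm; last first.
  by rewrite mulr_ge0 ?expR_ge0// gauss_density_ge0.
apply: (le_trans (expR_dl_le t)).
by rewrite ger0_norm// mulr_ge0 ?expR_ge0// invr_ge0 ltW.
Qed.

(** The linear factor is bounded by [expR b' + expR (- b')], so the majorant is a sum of two shifted
    Gaussians. *)
Lemma int_dotv_expR_dl b : wint m gd (fun t => dotv b (ctr t) * expR (dl t)).
Proof.
have i1 := integrableD measurableT (int_gauss b) (int_gauss (- b)).
have i0 := integrableZl measurableT z^-1 i1.
apply: le_integrable i0 => //.
  apply/measurable_EFinP; apply: measurable_funM; last exact: measurable_gauss_density.
  apply: measurable_funM; first exact: measurable_dotv_ctr.
  by apply: measurableT_comp => //; exact: measurable_dl.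
move=> t _ /=; rewrite lee_fin dotvNl.
set a := - (ka / 2 * _); set b' := dotv b _.
have -> : b' * expR (dl t) * gd t = b' * (expR (dl t) * gd t) by rewrite mulrA.
have e0 : 0 <= expR (dl t) * gd t by rewrite mulr_ge0 ?expR_ge0// gauss_density_ge0.
rewrite normrM (ger0_norm e0) (expRD a) (expRD a) -mulrDr.
have c0 : 0 <= z^-1 * (expR a * (expR b' + expR (- b'))).
  by rewrite !mulr_ge0 ?addr_ge0 ?expR_ge0// invr_ge0 ltW.
rewrite (ger0_norm c0) [leRHS]mulrA [leLHS]mulrC; apply: ler_pM => //; last exact: normr_le_expR.
Qed.

Let kk := expR (f xs) * z.

Let kk0 : kk != 0.
Proof. by rewrite gt_eqF// mulr_gt0 ?expR_gt0. Qed.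

Let expR_f t : expR (f (col_of_tuple t)) = kk * (expR (dl t) * gd t).
Proof.
rewrite expR_dl /kk expRB; field.
by rewrite expR_eq0 gt_eqF.
Qed.

Lemma fine_gibbs_mass : fine (gibbs_mass f) = kk * wE m gd (fun t => expR (dl t)).
Proof.
rewrite /gibbs_mass -[LHS]/(\int[m]_t expR (f (col_of_tuple t))) /wE.
rewrite -RintegralZl//; last exact: int_expR_dl.
by apply: eq_Rintegral => t _; exact: expR_f.
Qed.

(** [expR f] is [kk] times the tilted Gaussian density, and [kk] cancels in the quotient that
    defines the mean. *)
Lemma dotv_gibbs_mean b : 0 < wE m gd (fun t => expR (dl t)) ->
  dotv b (gibbs_mean f - xs) * wE m gd (fun t => expR (dl t)) =
  wE m gd (fun t => dotv b (ctr t) * expR (dl t)).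
Proof.
move=> M0; set M := wE _ _ (fun t => expR _) in M0 *.
have ctrE i t : col_of_tuple t i 0 * expR (dl t) =
    dotv (delta_mx i 0) (ctr t) * expR (dl t) + xs i 0 * expR (dl t).
  rewrite -mulrDl; congr (_ * _).
  by rewrite dotv_deltal !mxE subrK.
have ii i : wint m gd (fun t => col_of_tuple t i 0 * expR (dl t)).
  apply: eq_wint (wintD (int_dotv_expR_dl (delta_mx i 0)) (wintZ (xs i 0) int_expR_dl)) => t.
  by rewrite ctrE.
have meanE i : gibbs_mean f i 0 * M = wE m gd (fun t => col_of_tuple t i 0 * expR (dl t)).
  rewrite mxE fine_gibbs_mass -/M.
  have -> : \int[m]_t (col_of_tuple t i 0 * expR (f (col_of_tuple t))) =
     kk * wE m gd (fun t => col_of_tuple t i 0 * expR (dl t)).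
    rewrite /wE -RintegralZl//; last exact: ii.
    by apply: eq_Rintegral => t _; rewrite expR_f; ring.
  by field; rewrite kk0 gt_eqF.
have -> : dotv b (gibbs_mean f - xs) * M =
    \sum_i b i 0 * (gibbs_mean f i 0 * M + - xs i 0 * M).
  rewrite dotvE mulr_suml; apply: eq_bigr => i _; rewrite !mxE.
  by rewrite -mulrDl mulrA.
under eq_bigr do rewrite meanE.
have -> : wE m gd (fun t => dotv b (ctr t) * expR (dl t)) =
  wE m gd (fun t => \sum_i b i 0 * (col_of_tuple t i 0 * expR (dl t) + - xs i 0 * expR (dl t))).
  apply: eq_wE => t; rewrite dotvE mulr_suml; apply: eq_bigr => i _.
  by rewrite !mxE; ring.
have ij i : wint m gd (fun t => col_of_tuple t i 0 * expR (dl t) + - xs i 0 * expR (dl t)).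
  by apply: wintD => //; apply: wintZ; exact: int_expR_dl.
rewrite wE_sum => [|i]; last exact: wintZ.
apply: eq_bigr => i _; rewrite wEZ// wED// ?wEZ//; try exact: int_expR_dl.
by apply: wintZ; exact: int_expR_dl.
Qed.

End gibbs_integrals.

(** * Operator norm and bias *)

Section operator_norm.
Context (R : realType).

Lemma enormZ n (c : R) (v : 'cV[R]_n) : enorm (c *: v) = `|c| * enorm v.
Proof.
apply/eqP; rewrite -(@eqrXn2 _ 2)// ?mulr_ge0 ?enorm_ge0//.
by rewrite exprMn !enorm_sqr dotvZl dotvZr mulrA -expr2 real_normK ?num_real.
Qed.

Lemma enorm0 n : enorm (0 : 'cV[R]_n) = 0.
Proof. by rewrite -(scale0r 0) enormZ normr0 mul0r. Qed.

Lemma enorm_eq0 n (v : 'cV[R]_n) : (enorm v == 0) = (v == 0).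
Proof. by rewrite -dotv_eq0 -enorm_sqr sqrf_eq0. Qed.

Lemma dotv_le_enorm n (u v : 'cV[R]_n) : dotv u v <= enorm u * enorm v.
Proof.
apply: le_trans (ler_norm _) _.
rewrite -(@ler_pXn2r _ 2)// ?nnegrE ?mulr_ge0 ?enorm_ge0//.
by rewrite exprMn !enorm_sqr real_normK ?num_real// dotv_sqr_le.
Qed.

Section bounded.
Variables (q n : nat) (M : 'M[R]_(q, n)) (k : R).
Hypotheses (k0 : 0 <= k) (Mk : forall v : 'cV[R]_n, enorm (M *m v) <= k * enorm v).

Let S := [set enorm (M *m u) | u in [set u : 'cV[R]_n | enorm u <= 1]].

Let S0 : S !=set0.
Proof. by exists (enorm (M *m 0)), 0; rewrite //= enorm0. Qed.

Let ubS : ubound S k.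
Proof.
move=> _ [u /= u1 <-]; apply: le_trans (Mk u) _.
by rewrite -[leRHS]mulr1 ler_wpM2l.
Qed.

Lemma opnorm_le : opnorm M <= k.
Proof. exact: ge_sup. Qed.

Lemma enorm_mulmx_le_opnorm v : enorm (M *m v) <= opnorm M * enorm v.
Proof.
have [->|v0] := eqVneq v 0; first by rewrite mulmx0 !enorm0 mulr0.
have nv : 0 < enorm v by rewrite lt_neqAle enorm_ge0 eq_sym enorm_eq0 v0.
rewrite -ler_pdivrMr//; apply: ub_le_sup; first by exists k.
exists ((enorm v)^-1 *: v).
  by rewrite /= enormZ ger0_norm ?invr_ge0 ?enorm_ge0// mulVf// gt_eqF.
by rewrite -scalemxAr enormZ ger0_norm ?invr_ge0 ?enorm_ge0// mulrC.
Qed.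

Lemma opnorm_ge0 : 0 <= opnorm M.
Proof.
by apply: ub_le_sup; [exists k|exists 0; rewrite /= ?mulmx0 enorm0//].
Qed.

End bounded.

Section dual_norm.
Variables (q n : nat) (A : 'M[R]_n) (Q : 'M[R]_(q, n)).
Hypotheses (pA : posdef A) (QA : forall u, enorm (Q *m u) ^+ 2 <= quad_form A u).

Let M := Q *m invmx A *m Q^T.

Let sA : A^T = A. Proof. by case: pA. Qed.

(** With [c = A^-1 Q^T v], the square of [|M v| = |Q c|] is at most [<c, A c> = <M v, v>]. The bound
    makes [opnorm M] a supremum over a bounded set, and later removes its square root from the
    exponential error. *)
Lemma sandwich_contraction v : enorm (M *m v) <= 1 * enorm v.
Proof.
pose c := invmx A *m (Q^T *m v).
have Mv : M *m v = Q *m c by rewrite /M /c !mulmxA.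
have h : enorm (M *m v) ^+ 2 <= enorm (M *m v) * enorm v.
  rewrite {1}Mv; apply: le_trans (QA c) _.
  rewrite quad_formE (mulKVmx (posdef_unit pA)) dotv_mulmx trmxK -Mv.
  exact: dotv_le_enorm.
have [e|e] := eqVneq (enorm (M *m v)) 0; first by rewrite e mul1r enorm_ge0.
have e0 : 0 < enorm (M *m v) by rewrite lt_neqAle enorm_ge0 eq_sym e.
by rewrite mul1r -(ler_pM2l e0) -expr2.
Qed.

(* Duality: [|Q d|^2 = <Q^T Q d, d>], and [Q^T Q d] has squared dual norm at
   most [opnorm (Q A^-1 Q^T) |Q d|^2]. *)
Lemma enorm_mulmx_le_dual (d : 'cV[R]_n) (K : R) :
  (forall v, quad_form (invmx A) v <= 1 -> `|dotv v d| <= K) ->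
  enorm (Q *m d) <= Num.sqrt (opnorm M) * K.
Proof.
move=> dK; have o0 := opnorm_ge0 ler01 sandwich_contraction.
have sc := enorm_mulmx_le_opnorm ler01 sandwich_contraction.
have K0 : 0 <= K.
  by have := dK 0; rewrite quad_form0 dotv0l normr0; apply; exact: ler01.
pose e := Q *m d; pose b := Q^T *m e.
have be : dotv b d = enorm e ^+ 2 by rewrite enorm_sqr {2}/e dotv_mulmx.
have qb : quad_form (invmx A) b <= opnorm M * enorm e ^+ 2.
  have -> : quad_form (invmx A) b = dotv e (M *m e).
    by rewrite quad_formE /b -dotv_mulmx /M !mulmxA.
  apply: le_trans (dotv_le_enorm _ _) _.
  by rewrite mulrC expr2 mulrA ler_wpM2r ?enorm_ge0.
rewrite -/e; have [e0|e0] := eqVneq (enorm e) 0.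
  by rewrite e0 mulr_ge0// sqrtr_ge0.
have ep : 0 < enorm e by rewrite lt_neqAle enorm_ge0 eq_sym e0.
(* No rescaling of [b] is possible here; but the dual norm of [b] then vanishes, which forces
   [b = 0] and contradicts [e0]. *)
have [os|os] := eqVneq (opnorm M) 0.
  have b0 : b = 0.
    apply/eqP; apply: contraT => bn.
    pose v := invmx A *m b.
    have vn : v != 0.
      apply: contra_neq bn => v0; rewrite -[b]mul1mx -(mulmxV (posdef_unit pA)).
      by rewrite -mulmxA -/v v0 mulmx0.
    have := pA.2 v vn; rewrite quad_formE {2}/v (mulKVmx (posdef_unit pA)).
    by rewrite dotvC -quad_formE ltNge (le_trans qb)// os mul0r.
  by move: be; rewrite b0 dotv0l => /esym/eqP; rewrite sqrf_eq0 (negPf e0).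
have op : 0 < opnorm M by rewrite lt_neqAle eq_sym os.
have so : 0 < Num.sqrt (opnorm M) by rewrite sqrtr_gt0.
have s0 : 0 < Num.sqrt (opnorm M) * enorm e by rewrite mulr_gt0.
have : quad_form (invmx A) ((Num.sqrt (opnorm M) * enorm e)^-1 *: b) <= 1.
  rewrite quad_form_scale exprVn mulrC ler_pdivrMr ?exprn_gt0// mul1r.
  by rewrite exprMn sqr_sqrtr.
move=> /dK; rewrite dotvZl be ger0_norm; last first.
  by rewrite mulr_ge0 ?sqr_ge0// invr_ge0 ltW.
rewrite mulrC ler_pdivrMr// expr2 mulrA ler_pM2r//.
by rewrite [K * _]mulrC.
Qed.

End dual_norm.
End operator_norm.

(** * Bias of a linear form of dual norm at most one *)

Section normalized_bias.
Context (R : realType) (n : nat).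
Variables (f : 'cV[R]_n -> R) (xs : 'cV[R]_n) (G D : 'M[R]_n) (N m : R).
Variable h : 'cV[R]_n -> R.
Let A := - hessian f xs.
Hypotheses (C3 : Ck 3 f) (fmax : forall y, f y <= f xs) (pA : posdef A).
Hypotheses (sG : G^T = G) (sD : D^T = D).
Hypotheses (DD : D *m D = A - G *m G) (N0 : 0 < N) (m0 : 0 < m).
Hypothesis hE : forall y, - (f y + 2^-1 * enorm (G *m (y - xs)) ^+ 2) = N * h y.
Hypothesis h_convex : convex_function setT (fun y => h y - m / 2 * enorm y ^+ 2).
Variables (s c3 : R).
Let p := \tr ((A - G *m G) *m invmx A).
Let r := 2 * Num.sqrt p + s.
Hypotheses (s0 : 0 < s) (n0 : (0 < n)%N).
Hypothesis third_h : forall u, enorm (D *m u) <= r -> u != 0 ->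
  forall t : R, 0 <= t <= 1 ->
  `|third_form h (xs + t *: u) u| / quad_form (hessian h xs) u `^ (3 / 2) <= c3.
Hypothesis wr : c3 * r / Num.sqrt N <= 3 / 4.

Let w := c3 / Num.sqrt N.
Let sN : 0 < Num.sqrt N. Proof. by rewrite sqrtr_gt0. Qed.
Let r0 : 0 < r. Proof. by rewrite /r ltr_wpDl// mulr_ge0// sqrtr_ge0. Qed.

Let D_gt0 (u : 'cV[R]_n) : u != 0 -> 0 < enorm (D *m u).
Proof. exact: (enorm_D_gt0 C3 fmax sG sD DD N0 m0 hE h_convex). Qed.

(** The third-order hypothesis bounds a nonnegative ratio by [c3]; positive dimension supplies a
    nonzero [u], rescaled to satisfy [enorm (D *m u) <= r]. *)
Let c30 : 0 <= c3.
Proof.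
pose u0 : 'cV[R]_n := delta_mx (Ordinal n0) 0.
have u00 : u0 != 0.
  apply/eqP => /matrixP/(_ (Ordinal n0) 0); rewrite !mxE !eqxx/= => /eqP.
  by rewrite oner_eq0.
have Z0 := D_gt0 u00; pose u := (r / enorm (D *m u0)) *: u0.
have k0 : 0 < r / enorm (D *m u0) by rewrite divr_gt0.
have un : u != 0 by rewrite scaler_eq0 negb_or u00 gt_eqF.
have ur : enorm (D *m u) <= r.
  by rewrite -scalemxAr enormZ ger0_norm ?(ltW k0)// divfK// gt_eqF.
have /third_h h3 := ur; have := h3 un 0; rewrite lexx ler01 => /(_ isT).
by apply: le_trans; rewrite divr_ge0// powR_ge0.
Qed.

Let w0 : 0 <= w. Proof. by rewrite divr_ge0// ltW. Qed.

(** Passing from [h] to [f] multiplies the third derivative by [N] in absolute value, while the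
    Hessian [D^2 / N] of [h] contributes [N] to the power [- 3 / 2]: the factor [c3 / Num.sqrt N]
    remains. *)
Let third_f u : enorm (D *m u) <= r -> u != 0 -> forall t : R, 0 <= t <= 1 ->
  `|third_form f (xs + t *: u) u| <= w * enorm (D *m u) ^+ 3.
Proof.
move=> ur un t t01; have := third_h ur un t01; have Z0 := D_gt0 un.
rewrite (third_form_h C3 sG N0 hE) (quad_form_hessian_h C3 sG sD DD N0 hE).
have -> : (enorm (D *m u) ^+ 2 / N) `^ (3 / 2) = (enorm (D *m u) / Num.sqrt N) ^+ 3.
  have -> : enorm (D *m u) ^+ 2 / N = (enorm (D *m u) / Num.sqrt N) `^ 2.
    rewrite powR_mulrn; last by rewrite divr_ge0// ltW.
    by rewrite expr_div_n (sqr_sqrtr (ltW N0)).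
  have e : 2 * (3 / 2) = 3%:R :> R by field.
  by rewrite -powRrM e powR_mulrn// divr_ge0// ltW.
have iN : 0 <= N^-1 by rewrite invr_ge0 ltW.
rewrite normrM normrN (ger0_norm iN) expr_div_n.
rewrite ler_pdivrMr; last by rewrite divr_gt0// exprn_gt0.
set F := `|_|; set Z := enorm _ => hF.
have {hF} : N * (N^-1 * F) <= N * (c3 * (Z ^+ 3 / Num.sqrt N ^+ 3)) by rewrite ler_pM2l.
rewrite (mulVKf (lt0r_neq0 N0)) => /le_trans; apply.
rewrite [leLHS](_ : _ = w * Z ^+ 3)// -{1}(sqr_sqrtr (ltW N0)) /w.
by field; rewrite gt_eqF.
Qed.

Let quad_G_ge0 u : 0 <= quad_form (G *m G) u.
Proof. by rewrite quad_formE -mulmxA dotv_mulmx sG dotv_ge0. Qed.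

Let DA u : quad_form (D *m D) u <= quad_form A u.
Proof. by rewrite DD quad_formD [X in _ + X]quad_formN lerBlDr lerDl. Qed.

Let p_ge0 : 0 <= p.
Proof.
have -> : p = \tr (D *m invmx A *m D) by rewrite mxtrace_mulC mulmxA DD.
exact/psd_trace_ge0/psd_sandwich.
Qed.

Let ka := N * m.
Let ka0 : 0 < ka. Proof. exact: mulr_gt0. Qed.

Let fdecay u : f (xs + u) + ka / 2 * dotv u u <= f xs.
Proof.
have := growth C3 fmax sG N0 hE h_convex u; have := quad_G_ge0 u; rewrite -/ka; lra.
Qed.

Let cf : continuous f.
Proof. by move=> y; apply: differentiable_continuous; case: C3. Qed.

Local Notation mu := (lebesgue_tuple R n).
Let g := gauss_density A xs.
Let ctr (t : n.-tuple R) : 'cV[R]_n := col_of_tuple t - xs.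
Let Z t := enorm (D *m ctr t).
Let dl t := f (col_of_tuple t) - f xs + quad_form A (ctr t) / 2.

Let dlE t : dl t = f (xs + ctr t) - f xs + quad_form A (ctr t) / 2.
Proof. by rewrite /dl [xs + _]addrC subrK. Qed.

Let mg : measurable_fun setT g. Proof. exact: measurable_gauss_density. Qed.
Let g0 t : 0 <= g t. Proof. exact: gauss_density_ge0. Qed.

Let mZ : measurable_fun setT Z.
Proof.
have -> : Z = fun t => Num.sqrt (quad_form (D *m D) (ctr t)).
  apply/funext => t; rewrite /Z -[LHS]ger0_norm ?enorm_ge0// -sqrtr_sqr; congr Num.sqrt.
  by rewrite enorm_sqr quad_formE -mulmxA [RHS]dotv_mulmx sD.
apply: measurableT_comp; last exact: measurable_quad_form_ctr.
exact: continuous_measurable_fun (@sqrt_continuous R).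
Qed.

Let mdl : measurable_fun setT dl. Proof. exact: measurable_dl. Qed.

Let dl_in t : Z t <= r -> `|dl t| <= w * Z t ^+ 3 / 6.
Proof. by move=> Zr; rewrite dlE; case: (taylor_ray C3 fmax sD DD w0 third_f Zr). Qed.

Let dl_out t : r < Z t ->
  dl t <= (Z t - r) ^+ 2 / 2 + w * r ^+ 3 / 6 + w * r ^+ 2 * (Z t - r) / 2.
Proof.
move=> rZ; rewrite dlE.
exact: (dl_out_le C3 fmax sG sD DD N0 m0 hE h_convex r0 w0 third_f rZ).
Qed.

Let dl_half t : dl t <= Z t ^+ 2 / 2.
Proof. rewrite dlE; exact: (dl_le_half C3 fmax sG sD DD N0 m0 hE h_convex). Qed.

Let int_dl : wint mu g (fun t => expR (dl t)).
Proof. exact: (int_expR_dl pA ka0 cf fdecay). Qed.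

Let wr' : w * r <= 3 / 4.
Proof. by rewrite /w mulrAC. Qed.

Lemma normalized_bias v : quad_form (invmx A) v <= 1 ->
  `|dotv v (gibbs_mean f - xs)| <=
  12 / 5 * w * (p + 1) `^ (3 / 2) + tilt_const R * expR (- s ^+ 2 / 2).
Proof.
move=> hv; have [i1 E1] := gauss_wE1 xs pA.
have mgf lam tmu tau : 0 < lam <= 1 -> lam = 1 \/ p <= lam -> 0 <= tmu -> tmu * lam < 1 ->
    wint mu g (fun t => expR (tau * dotv v (ctr t) + tmu / 2 * Z t ^+ 2)) /\
    wE mu g (fun t => expR (tau * dotv v (ctr t) + tmu / 2 * Z t ^+ 2)) <=
    expR (- (p / (2 * lam)) * ln (1 - tmu * lam) + tau ^+ 2 / (2 * (1 - tmu * lam))).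
  move=> l1 l2 m1 m2; rewrite /p -DD.
  by apply: (gauss_mgf xs pA sD DA hv) => //; rewrite DD.
have mL : measurable_fun setT (fun t => dotv v (ctr t)) by exact: measurable_dotv_ctr.
have Z0 t : 0 <= Z t by exact: enorm_ge0.
have M0 := tilt_mass_gt0 mg g0 p_ge0 s0 w0 wr' mZ mdl Z0 i1 E1 mgf dl_in int_dl.
have := tilt_mean_le mg g0 p_ge0 s0 w0 wr' mZ mL mdl Z0 i1 E1 mgf dl_in dl_out dl_half
  int_dl (int_dotv_expR_dl pA ka0 cf fdecay v).
rewrite -(dotv_gibbs_mean pA ka0 cf fdecay v M0) normrM [X in _ * X <= _]ger0_norm ?(ltW M0)//.
by rewrite mulrC ler_pM2l.
Qed.

End normalized_bias.

Theorem theorem2p7 (R : realType) :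
  exists C : R,
    forall (p : nat) (f : 'cV[R]_p -> R) (xstar : 'cV[R]_p)
      (G D : 'M[R]_p) (nu x : R),
    let DG2 := - hessian f xstar in
    let D2 := DG2 - G *m G in
    let l := fun y : 'cV[R]_p => f y + 2^-1 * enorm (G *m (y - xstar)) ^+ 2 in
    let pG := \tr (D2 *m invmx DG2) in
    let rG := 2 * Num.sqrt pG + Num.sqrt (2 * x) in
    let U := [set u : 'cV[R]_p | enorm (D *m u) <= nu^-1 * rG] in
    Ck 3 f ->
    (gibbs_mass f < +oo)%E ->
    (forall y, f y <= f xstar) ->
    posdef DG2 ->
    psd G ->
    loewner_le (G *m G) DG2 ->
    psd_sqrt D D2 ->
    concave (fun u => l (xstar + u)) ->
    0 < nu < 1 ->
    0 < x ->
    forall (n c3 : R) (h : 'cV[R]_p -> R),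
    0 < n ->
    strongly_convex h ->
    (forall y, - l y = n * h y) ->
    (forall u, U u -> u != 0 -> forall t : R, 0 <= t <= 1 ->
       `|third_form h (xstar + t *: u) u|
         / quad_form (hessian h xstar) u `^ (3 / 2) <= c3) ->
    c3 * rG / Num.sqrt n <= 3 / 4 ->
    forall (q : nat) (Q : 'M[R]_(q, p)),
    (1 <= q)%N ->
    loewner_le (Q^T *m Q) D2 ->
    enorm (Q *m (gibbs_mean f - xstar)) <=
      24 / 10 * c3 * Num.sqrt (opnorm (Q *m invmx DG2 *m Q^T))
        * ((pG + 1) `^ (3 / 2) / Num.sqrt n)
      + C * expR (- x).
Proof.
exists `|tilt_const R| => p f xs G D nu x DG2 D2 l pG rG U C3 _ fmax pA [sG _] _.
move=> [[sD _] DD] _ /andP[nu0 nu1] x0 n c3 h n0 [m m0 hconv] hE third_h wr q Q _ [_ QD2].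
have rG0 : 0 <= rG by rewrite addr_ge0 ?mulr_ge0 ?sqrtr_ge0.
have QA u : enorm (Q *m u) ^+ 2 <= quad_form DG2 u.
  have := QD2 u; rewrite quad_formD quad_formN.
  have -> : quad_form (Q^T *m Q) u = enorm (Q *m u) ^+ 2.
    by rewrite enorm_sqr quad_formE -mulmxA [LHS]dotv_mulmx trmxK.
  have : 0 <= quad_form (G *m G) u.
    by rewrite quad_formE -mulmxA dotv_mulmx sG dotv_ge0.
  rewrite /D2 quad_formD [quad_form (- (G *m G)) u]quad_formN; lra.
have M1 := sandwich_contraction pA QA.
set M := Q *m invmx DG2 *m Q^T in M1 *.
(* Dimension zero is separate: no nonzero [u] exists there to fix the sign of [c3], but the operator
   norm vanishes and removes the term that contains it. *)
have [p0|p0] := posnP p.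
  have cV0 (v : 'cV[R]_p) : v = 0.
    by apply/matrixP => i; have := ltn_ord i; rewrite {2}p0.
  have M0 : opnorm M <= 0.
    apply: opnorm_le => // v; rewrite /M -!mulmxA [invmx _ *m _]cV0 mulmx0 enorm0.
    by rewrite mul0r.
  rewrite [gibbs_mean f - xs]cV0 mulmx0 enorm0 (eqP (_ : Num.sqrt _ == 0)) ?sqrtr_eq0//.
  by rewrite mulr0 mul0r add0r mulr_ge0 ?expR_ge0.
have s0 : 0 < Num.sqrt (2 * x) by rewrite sqrtr_gt0 mulr_gt0.
have third_r u : enorm (D *m u) <= rG -> u != 0 -> forall t : R, 0 <= t <= 1 ->
    `|third_form h (xs + t *: u) u| / quad_form (hessian h xs) u `^ (3 / 2) <= c3.
  (* Since [nu^-1 >= 1], the set [U] contains the ellipsoid of radius [rG]. *)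
  move=> ur; apply: third_h; apply: (le_trans ur).
  by rewrite ler_peMl// invf_ge1// ltW.
have bias := normalized_bias C3 fmax pA sG sD DD n0 m0 hE hconv s0 p0 third_r wr.
have /le_trans := enorm_mulmx_le_dual pA QA bias; apply.
rewrite sqr_sqrtr ?mulr_ge0 ?(ltW x0)// -/pG -/M mulrDr lerD//.
  rewrite le_eqVlt; apply/orP; left; apply/eqP; field; by rewrite gt_eqF// sqrtr_gt0.
have -> : - (2 * x) / 2 = - x by field.
rewrite mulrA ler_wpM2r ?expR_ge0//; apply: le_trans (ler_norm _) _.
(* The factor [Num.sqrt (opnorm M)] of the exponential error is at most [1] by the contraction
   [M1]. *)
rewrite normrM ger0_norm ?sqrtr_ge0// ler_piMl//.
by rewrite -sqrtr1 ler_sqrt ?ler01//; apply: opnorm_le => //; exact: ler01.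
Qed.
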